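(* Let $k$ and $\mathcal O=\mathcal P(E,R)$ be as in the standing assumptions of the context. If $A$ is a differential graded $\mathcal O$-algebra with trivial derived universal Massey product, $\gamma_A^{\mathcal O}=0$ in $\mathbb D H^{2,-1}_{\mathcal O}(H_*(A),H_*(A))$, then all torsion Massey products $\langle x_1,\dots,x_r\rangle_\mu^{t_1,\dots,t_r}$ vanish in $H_*(A)$ (i.e. they are zero in the quotient of $H_*(A)$ by the indeterminacy, for all $r$, $\mu\in E(r)$, $t_i\in k$ and $x_i\in H_*(A)$ for which they are defined).
   Context: **Torsion Massey products.** Let $\mu\in E(r)$, $t_i\in k$ with $\sum_{i=1}^rt_i=0$, and homogeneous $x_i\in H_*(A)$ with $t_ix_i=0$, $1\le i\le r$. Choose cycles $y_i\in A_{|x_i|}$ representing $x_i$ and $z_i\in A_{|x_i|+1}$ with $d(z_i)=t_iy_i$. The torsion Massey product $$\langle x_1,\dots,x_r\rangle_\mu^{t_1,\dots,t_r}\in\frac{H_{|\mu|+|x_1|+\cdots+|x_r|+1}(A)}{\sum_{i=1}^r\mu(x_1,\dots,x_{i-1},H_{|x_i|+1}(A),x_{i+1},\dots,x_r)}$$ is the element represented by the homology class of the cycle $\sum_{i=1}^r(-1)^{\beta_i}\mu(y_1,\dots,y_{i-1},z_i,y_{i+1},\dots,y_r)$, $\beta_i=|\mu|+\sum_{j<i}|x_j|$; the denominator is called the indeterminacy. **Standing assumptions.** $k$ is a commutative ring; complexes are $\mathbb Z$-graded chain complexes of $k$-modules and the Koszul sign rule is used. $\mathcal O=\mathcal P(E,R)$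 is a graded (zero differential), $k$-projective, quadratic Koszul operad with generating $\mathbb S$-module $E$, $E(0)=0$, and relations $R\subset E\circ_{(1)}E$ (the weight $2$ part of the free operad on $E$); either $\mathbb Q\subset k$ or $\mathcal O$ is the symmetrization of a non-symmetric operad. $\mathcal O$ has a weight grading with $E$ in weight $1$. $I$ denotes the $\mathbb S$-module $k$ in arity $1$, degree $0$. **Koszul dual.** $s$ is the degree $1$ suspension. $\mathcal O^{¡}=\mathcal C(sE,s^2R)$ is the Koszul dual cooperad, weighted with $(\mathcal O^{¡})^{(0)}=I$, $(\mathcal O^{¡})^{(1)}=sE$, $(\mathcal O^{¡})^{(2)}=s^2R$. The map $\kappa\colon\mathcal O^{¡}\to\mathcal O$ is projection to $sE$, followed by $s^{-1}$ and the inclusion $E\subset\mathcal O$. The infinitesimal decomposition is written $\Delta_{(1)}(\mu)=\sum_{(\mu)}(\mu^{(1)}\circ_l\mu^{(2)})\cdot\sigma$, $\sigma\in\mathbb S_r$. For $\mu\in E(r)$, $\Delta_{(1)}(s\mu)=1\circ_1 (s\mu)+\sum_i (s\mu)\circ_i1$; for $\Gamma=\sum(\mu^{(1)}\circ_l\mu^{(2)})\cdot\sigma\in R(r)$, $\Delta_{(1)}(s^2\Gamma)=1\circ_1(s^2\Gamma)+\sum_i(s^2\Gamma)\circ_i1+\sum(-1)^{|\mu^{(1)}|}((s\mu^{(1)})\circ_l(s\mu^{(2)}))\cdot\sigma$. $\mathcal O^{¡}(X)=\bigoplus_r\mathcal O^{¡}(r)\otimes_{\mathbb S_r}X^{\otimes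 r}$, with elements denoted $(\mu;x_1,\dots,x_r)$. **Bicomplexes and horizontal resolutions.** A bicomplex is a complex $X$ with a splitting $X_n=\bigoplus_{p+q=n}X_{p,q}$, $X_{p,q}=0$ for $p<0$ ($p$ horizontal, $q$ vertical degree), whose differential is $d=d_0+d_1$ with $d_1(X_{p,q})\subset X_{p-1,q}$, $d_0(X_{p,q})\subset X_{p,q-1}$. Morphisms are chain maps preserving bidegrees. An $E^2$-equivalence is a morphism inducing an isomorphism on the $E^2$ pages of the spectral sequences of the increasing filtration by horizontal degree. A bicomplex $\mathcal O$-algebra is a bicomplex with an $\mathcal O$-algebra structure compatible with the bigrading ($\mathcal O$ in horizontal degree $0$). It is minimal if $d_0=0$. A horizontal resolution of a graded (zero differential) $\mathcal O$-algebra $H$ is a $k$-projective minimal bicomplex $\mathcal O$-algebra $\tilde H$ with an $E^2$-equivalence of bicomplex $\mathcal O$-algebras $\rho\colon\tilde H\to H$ ($H$ in horizontal degree $0$). Equivalently, each $(\tilde H_{*,q},d_1)$ is a projective resolution of $H_q$ via $\rho$. **Derived operadic cohomology.** For a graded $\mathcal O$-algebra $H$, a graded $H$-module $M$, and a horizontal resolution $\rho\colon\tilde H\to H$ (so $M$ is an $\tilde H$-module), let $$C^{w,t}_{\mathcal O}(\tilde H,M)=\bigoplus_{u=0}^w\prod_{p\in\mathbb Z}\operatorname{Hom}\big((\mathcal O^{¡})^{(u)}(\tilde H)_{w-u,p-w+u},M_{p-w-t}\big),$$ with elements $\psi=(\psi_0,\dots,\psi_w)$ and differential $C^{w,t}\to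 C^{w+1,t}$, for $0\le u\le w+1$ and $\psi_{-1}=\psi_{w+1}=0$, $$\begin{aligned}d(\psi)_u(\mu;x_1,\dots,x_r)={}&\sum_{(\mu)}(-1)^{t+\eta_{w+t}}\kappa(\mu^{(1)})(x_{\sigma^{-1}(1)},\dots,\psi_{u-1}(\mu^{(2)};x_{\sigma^{-1}(l)},\dots),\dots)\\&-\sum_{(\mu)}(-1)^{w+\eta_1}\psi_{u-1}(\mu^{(1)};x_{\sigma^{-1}(1)},\dots,\kappa(\mu^{(2)})(x_{\sigma^{-1}(l)},\dots),\dots)\\&-\sum_{i}(-1)^{w+\beta_i}\psi_u(\mu;x_1,\dots,d_1(x_i),\dots,x_r),\end{aligned}$$ where $\beta_i=|\mu|+\sum_{j<i}|x_j|$, $\alpha_\sigma=\sum_{s<t',\,\sigma(s)>\sigma(t')}|x_s||x_{t'}|$, $\eta_n=\alpha_\sigma+|\mu^{(1)}|n+(|\mu^{(2)}|+n)\sum_{m=1}^{l-1}|x_{\sigma^{-1}(m)}|$, and $|\cdot|$ is total degree. Its cohomology $\mathbb D H^{w,t}_{\mathcal O}(H,M)$ is (up to canonical isomorphism) independent of the horizontal resolution and natural in $H$ (contravariantly) and $M$ (covariantly). **Derived homotopy algebras.** A homotopy $\mathcal O$-algebra ($\mathcal O_\infty=\Omega\mathcal O^{¡}$-algebra) is a complex $A$ with a degree $-1$ map of $\mathbb S$-modules $\phi\colon\mathcal O^{¡}\to\mathrm{End}_A$, written $\phi(\mu)(x_1,\dots,x_r)=\mu(x_1,\dots,x_r)$,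 with $\phi(1)=0$ and $\partial(\phi(\mu))+\sum_{(\mu)}(-1)^{|\mu^{(1)}|}(\phi(\mu^{(1)})\circ_l\phi(\mu^{(2)}))\cdot\sigma=0$, $\partial$ being the differential of $\mathrm{End}_A$. An $\infty$-morphism $f\colon A\leadsto B$ is a degree $0$ map of $\mathbb S$-modules $f\colon \mathcal O^{¡}\to\mathrm{End}^A_B$ ($\mathrm{End}^A_B(r)=\mathrm{Hom}(A^{\otimes r},B)$) with $\partial f=f*\phi_A-\phi_B\circledast f$, where $(f*\phi_A)(\mu)=\sum_{(\mu)}(-1)^{|\mu^{(1)}|}(f(\mu^{(1)})\circ_l\phi_A(\mu^{(2)}))\cdot\sigma$ and $\phi_B\circledast f$ is the full decomposition $\Delta\colon\mathcal O^{¡}\to\mathcal O^{¡}\circ\mathcal O^{¡}$ followed by $\phi_B\circ f$ and composition of maps. A derived homotopy $\mathcal O$-algebra is a homotopy $\mathcal O$-algebra $A$ with a splitting $A_n=\bigoplus_{p+q=n}A_{p,q}$, $A_{p,q}=0$ for $p<0$, such that $F_mA=\bigoplus_{p\le m}A_{p,q}$ satisfies $d(F_mA)\subset F_mA$ and $\mu(F_{m_1}A,\dots,F_{m_r}A)\subset F_{m_1+\cdots+m_r}A$. Hence $d=\sum_{i\ge0}d_i$ and $\mu(\cdots)=\sum_{i\geq 0}\mu_i(\cdots)$, where $d_i$ and $\mu_i$ lower the (sum of the) horizontal degree(s) by exactly $i$: $d_i\colon A_{p,q}\to A_{p-i,q-1+i}$. A derived $\infty$-morphism is an $\infty$-morphism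 $f$ with $f(\mu)(F_{m_1}A,\dots,F_{m_r}A)\subset F_{m_1+\cdots+m_r}B$; similarly $f(\mu)=\sum_{i\ge0} f(\mu)_i$. It is an $E^2$-equivalence if the filtered chain map $f(1)$ (whose effect on $E^1$ is induced by $f(1)_0$) is an isomorphism on $E^2$ pages of the spectral sequences of the filtrations. A differential graded $\mathcal O$-algebra is a derived homotopy $\mathcal O$-algebra concentrated in horizontal degree $0$ via $\kappa$ (so $(s\mu)_0=\mu$ for $\mu\in E$). A derived homotopy $\mathcal O$-algebra is minimal if $d_0=0$. A derived minimal model of a differential graded $\mathcal O$-algebra $A$ is an $E^2$-equivalence $f\colon\tilde A\leadsto A$ with $\tilde A$ a minimal $k$-projective derived homotopy $\mathcal O$-algebra; such models exist. **Induced horizontal resolution.** For a minimal model $f\colon\tilde A\leadsto A$, the differential $d_1$ and the operations $\mu(x_1,\dots,x_r)=(s\mu)_0(x_1,\dots,x_r)$, $\mu\in E(r)$, make $\tilde A$ into a minimal bicomplex $\mathcal O$-algebra; $f(1)_0\colon\tilde A\to A$ vanishes in positive horizontal degrees and takes values in cycles, and composing it with the projection from cycles to $H_*(A)$ gives a horizontal resolution $\rho\colon\tilde A\to H_*(A)$. **Derived universal Massey product.** $\gamma_A^{\mathcal O}=\{m\}\in\mathbb D H^{2,-1}_{\mathcal O}(H_*(A),H_*(A))$ is the class of the cocycle $m=(m_0,m_1,m_2)\in C^{2,-1}_{\mathcal O}(\tilde A,H_*(A))$ given by $m_0(1;x)=\rho(d_2(x))$, $m_1(s\mu;x_1,\dots,x_r)=\rho((s\mu)_1(x_1,\dots,x_r))$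 for $\mu\in E(r)$, and $m_2(s^2\Gamma;x_1,\dots,x_r)=\rho((s^2\Gamma)_0(x_1,\dots,x_r))$ for $\Gamma\in R(r)$, for any derived minimal model of $A$; it does not depend on the choice of minimal model. *)

(* Defs.v *)
From HB Require Import structures.
From mathcomp Require Import all_boot all_order all_algebra all_fingroup.
From mathcomp.classical Require Import boolp.
Set Implicit Arguments. Unset Strict Implicit. Unset Printing Implicit Defensive.
Import GRing.Theory.
Local Open Scope ring_scope.
Local Open Scope quotient_scope.

Section Modules.
Variable k : comPzRingType.

Inductive span (V : lmodType k) (S : V -> Prop) : V -> Prop :=
| span0 : span S 0
| spanS a x y : S x -> span S y -> span S (a *: x + y).

Lemma span_submod (V : lmodType k) (S : V -> Prop) :
  GRing.submod_closed [pred x | `[< span S x >]].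
Proof.
split=> [|a u v]; first by apply/asboolP/span0.
move=> /asboolP hu /asboolP hv; apply/asboolP.
elim: hu => [|b x y Sx _ IH]; first by rewrite scaler0 add0r.
by rewrite scalerDr scalerA -addrA; apply: spanS.
Qed.

Record subm (V : lmodType k) (S : V -> Prop) :=
  Subm { subm_val :> V; _ : subm_val \in [pred x | `[< span S x >]] }.

Section Subm.
Variables (V : lmodType k) (S : V -> Prop).
HB.instance Definition _ := [isSub for @subm_val V S].
HB.instance Definition _ := [Choice of subm S by <:].
HB.instance Definition _ :=
  GRing.isSubmodClosed.Build k V [pred x | `[< span S x >]] (span_submod S).
HB.instance Definition _ := [SubChoice_isSubLmodule of subm S by <:].
End Subm.

Section Quot.
Variables (V : lmodType k) (S : V -> Prop).
Definition qrel (x y : V) : bool := `[< span S (x - y) >].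
Let spanP := span_submod S.
Let spanB x y : span S x -> span S y -> span S (x - y).
Proof.
move=> hx hy; have [_ h] := spanP; have := h (-1) y x.
rewrite !inE => /(_ (asboolT hy) (asboolT hx)) /asboolP.
by rewrite scaleN1r addrC.
Qed.
Let spanD x y : span S x -> span S y -> span S (x + y).
Proof.
move=> hx hy; have [_ h] := spanP; have := h 1 x y.
by rewrite !inE => /(_ (asboolT hx) (asboolT hy)) /asboolP; rewrite scale1r.
Qed.
Let spanZ a x : span S x -> span S (a *: x).
Proof.
move=> hx; have [_ h] := spanP; have := h a x 0.
by rewrite !inE => /(_ (asboolT hx) (asboolT (span0 S))) /asboolP; rewrite addr0.
Qed.
Lemma qrel_equiv : equiv_class_of qrel.
Proof.
split=> [x|x y|y x z].
- by apply/asboolP; rewrite subrr; apply: span0.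
- apply/asboolP/asboolP => h; rewrite -opprB -scaleN1r; exact: spanZ.
- move=> /asboolP hxy /asboolP hyz; apply/asboolP.
  by rewrite -(subrK y x) -addrA; apply: spanD.
Qed.
Canonical qrel_equivr := EquivRelPack qrel_equiv.
Definition quot := {eq_quot qrel}.
HB.instance Definition _ := Choice.on quot.
HB.instance Definition _ := EqQuotient.on quot.
Definition qcls : V -> quot := \pi.
Lemma qclsP x y : qcls x = qcls y <-> span S (x - y).
Proof. by split => [/eqmodP/asboolP|h]; [|apply/eqmodP/asboolP]. Qed.
Definition qrep : quot -> V := generic_quotient.repr.
Lemma qrepK : cancel qrep qcls. Proof. exact: reprK. Qed.
Lemma qrepP x : span S (qrep (qcls x) - x).
Proof. by apply/qclsP; rewrite qrepK. Qed.
Definition qadd x y := qcls (qrep x + qrep y).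
Definition qopp x := qcls (- qrep x).
Definition qscale a x := qcls (a *: qrep x).
Lemma qaddE x y : qadd (qcls x) (qcls y) = qcls (x + y).
Proof. by apply/qclsP; rewrite opprD addrACA; apply: spanD; apply: qrepP. Qed.
Lemma qoppE x : qopp (qcls x) = qcls (- x).
Proof.
apply/qclsP; have -> : - qrep (qcls x) - - x = -1 *: (qrep (qcls x) - x).
  by rewrite scaleN1r opprB opprK addrC.
by apply: spanZ; apply: qrepP.
Qed.
Lemma qscaleE a x : qscale a (qcls x) = qcls (a *: x).
Proof. by apply/qclsP; rewrite -scalerBr; apply: spanZ; apply: qrepP. Qed.
Lemma qaddA : associative qadd.
Proof.
by move=> x y z; rewrite -(qrepK x) -(qrepK y) -(qrepK z) !qaddE addrA.
Qed.
Lemma qaddC : commutative qadd.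
Proof. by move=> x y; rewrite /qadd addrC. Qed.
Lemma qadd0 : left_id (qcls 0) qadd.
Proof. by move=> x; rewrite -(qrepK x) qaddE add0r. Qed.
Lemma qaddN : left_inverse (qcls 0) qopp qadd.
Proof. by move=> x; rewrite -(qrepK x) qoppE qaddE addNr. Qed.
HB.instance Definition _ := GRing.isZmodule.Build quot qaddA qaddC qadd0 qaddN.
Lemma qscaleA a b x : qscale a (qscale b x) = qscale (a * b) x.
Proof. by rewrite -(qrepK x) !qscaleE scalerA. Qed.
Lemma qscale1 : left_id 1 qscale.
Proof. by move=> x; rewrite -(qrepK x) qscaleE scale1r. Qed.
Lemma qscaleDr : right_distributive qscale +%R.
Proof.
by move=> a x y; rewrite -(qrepK x) -(qrepK y) [LHS](congr1 _ (qaddE _ _)) !qscaleE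
  [RHS]qaddE scalerDr.
Qed.
Lemma qscaleDl x : {morph qscale^~ x : a b / a + b}.
Proof.
by move=> a b; rewrite -(qrepK x) !qscaleE [RHS]qaddE scalerDl.
Qed.
HB.instance Definition _ :=
  GRing.Zmodule_isLmodule.Build k quot qscaleA qscale1 qscaleDr qscaleDl.
End Quot.

Definition fsum (X : Type) := seq (k * X).
Definition fev (X : Type) (W : lmodType k) (f : X -> W) (s : fsum X) : W :=
  \sum_(p <- s) p.1 *: f p.2.
Definition fbind (X Y : Type) (F : X -> fsum Y) (s : fsum X) : fsum Y :=
  flatten [seq [seq (p.1 * q.1, q.2) | q <- F p.2] | p <- s].

Lemma fev_cat (X : Type) (W : lmodType k) (f : X -> W) s s' : fev f (s ++ s') = fev f s + fev f s'.
Proof. by rewrite /fev big_cat. Qed.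
Lemma fev_scale (X : Type) (W : lmodType k) (f : X -> W) a s :
  fev f [seq (a * p.1, p.2) | p <- s] = a *: fev f s.
Proof. by rewrite /fev big_map scaler_sumr; apply: eq_bigr => p _; rewrite scalerA. Qed.

Section Pres.
Variables (X : Type) (rel : fsum X -> Prop).
Definition presrel (s s' : {classic fsum X}) : bool :=
  `[< forall (W : lmodType k) (f : X -> W),
        (forall r, rel r -> fev f r = 0) -> fev f s = fev f s' >].
Lemma presrel_equiv : equiv_class_of presrel.
Proof.
split=> [x|x y|y x z]; first by apply/asboolP.
- by apply/asboolP/asboolP => h W f /h.
- by move=> /asboolP hxy /asboolP hyz; apply/asboolP => W f hf; rewrite hxy // hyz.
Qed.
Canonical presrel_equivr := EquivRelPack presrel_equiv.
Definition pres := {eq_quot presrel}.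
HB.instance Definition _ := Choice.on pres.
HB.instance Definition _ := EqQuotient.on pres.
Definition pcls : fsum X -> pres := (\pi : {classic fsum X} -> pres).
Lemma pclsP s s' : pcls s = pcls s' <->
  forall (W : lmodType k) (f : X -> W),
    (forall r, rel r -> fev f r = 0) -> fev f s = fev f s'.
Proof. by split => [/eqmodP/asboolP|h]; [|apply/eqmodP/asboolP]. Qed.
Definition prep : pres -> fsum X := generic_quotient.repr.
Lemma prepK : cancel prep pcls. Proof. exact: reprK. Qed.
Lemma prepP s (W : lmodType k) (f : X -> W) :
  (forall r, rel r -> fev f r = 0) -> fev f (prep (pcls s)) = fev f s.
Proof. by apply: (pclsP _ _).1; rewrite prepK. Qed.
Definition padd x y := pcls (prep x ++ prep y).
Definition pscale a x := pcls [seq (a * p.1, p.2) | p <- prep x].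
Lemma paddE s t : padd (pcls s) (pcls t) = pcls (s ++ t).
Proof. by apply/pclsP => W f hf; rewrite !fev_cat !prepP. Qed.
Lemma pscaleE a s : pscale a (pcls s) = pcls [seq (a * p.1, p.2) | p <- s].
Proof. by apply/pclsP => W f hf; rewrite !fev_scale !prepP. Qed.
Lemma paddA : associative padd.
Proof.
by move=> x y z; rewrite -(prepK x) -(prepK y) -(prepK z) !paddE catA.
Qed.
Lemma paddC : commutative padd.
Proof. by move=> x y; apply/pclsP => W f _; rewrite !fev_cat addrC. Qed.
Lemma padd0 : left_id (pcls [::]) padd.
Proof. by move=> x; rewrite -(prepK x) paddE. Qed.
Lemma paddN : left_inverse (pcls [::]) (pscale (-1)) padd.
Proof.
move=> x; rewrite -(prepK x) pscaleE paddE; apply/pclsP => W f _.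
by rewrite fev_cat fev_scale scaleN1r addNr /fev big_nil.
Qed.
HB.instance Definition _ := GRing.isZmodule.Build pres paddA paddC padd0 paddN.
Lemma pscaleA a b x : pscale a (pscale b x) = pscale (a * b) x.
Proof.
rewrite -(prepK x) !pscaleE; apply/pclsP => W f _.
by rewrite !fev_scale scalerA.
Qed.
Lemma pscale1 : left_id 1 pscale.
Proof.
move=> x; rewrite -(prepK x) !pscaleE; apply/pclsP => W f _.
by rewrite !fev_scale scale1r.
Qed.
Lemma pscaleDr : right_distributive pscale +%R.
Proof.
move=> a x y; rewrite -(prepK x) -(prepK y) [LHS](congr1 _ (paddE _ _)) !pscaleE.
by rewrite [RHS]paddE; apply/pclsP => W f _; rewrite !(fev_cat, fev_scale) scalerDr.
Qed.
Lemma pscaleDl x : {morph pscale^~ x : a b / a + b}.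
Proof.
move=> a b; rewrite -(prepK x) !pscaleE [RHS]paddE; apply/pclsP => W f _.
by rewrite !(fev_cat, fev_scale) scalerDl.
Qed.
HB.instance Definition _ :=
  GRing.Zmodule_isLmodule.Build k pres pscaleA pscale1 pscaleDr pscaleDl.
End Pres.
End Modules.

Section Graded.
Variable k : comPzRingType.

Definition sg (n : int) : k := (-1) ^+ `|n|%N.

Definition projective (P : lmodType k) : Prop :=
  forall (U W : lmodType k) (g : {linear U -> W}) (f : {linear P -> W}),
    (forall w, exists u, g u = w) ->
    exists h : {linear P -> U}, forall p, g (h p) = f p.

(* Direct sum decompositions V = \bigoplus_i V_i are given by their projections
   (orthogonal, locally finite); V_i is the image of the i-th one. *)
Record gmod (I : eqType) := Gmod {
  gcar :> lmodType k;
  gpr : I -> gcar -> gcar;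
  gpr_linear : forall i a x y, gpr i (a *: x + y) = a *: gpr i x + gpr i y;
  gpr_gpr : forall i j x, gpr i (gpr j x) = if i == j then gpr i x else 0;
  gpr_sum : forall x, exists s, uniq s /\ x = \sum_(i <- s) gpr i x
}.

Definition homog (I : eqType) (V : gmod I) (i : I) (x : V) : Prop :=
  gpr i x = x.

(* alpha_sigma, for the word l = sigma^-1(1) ... sigma^-1(r) and dg the list of
   the degrees |x_j| : sum over the pairs of positions a < b with l_b < l_a. *)
Definition koszul (dg : seq int) (l : seq nat) : int :=
  \sum_(b < size l) \sum_(a < b | (nth 0%N l b < nth 0%N l a)%N)
     nth 0 dg (nth 0%N l a) * nth 0 dg (nth 0%N l b).

Definition pword (r : nat) (s : 'S_r) : seq nat :=
  [seq val ((s^-1)%g j) | j <- enum 'I_r].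

Definition psum (dg : seq int) (i : nat) : int := \sum_(d <- take i dg) d.

Definition args (T : Type) (x0 : T) (x : seq T) (l : seq nat) : seq T :=
  [seq nth x0 x j | j <- l].

Definition each (T : Type) (P : T -> Prop) (s : seq T) : Prop :=
  foldr (fun x Q => P x /\ Q) True s.

Definition homs (T : lmodType k) (I : eqType) (D : I -> T -> Prop) (i0 : I)
    (dg : seq I) (x : seq T) : Prop :=
  size x = size dg /\
  forall j, (j < size dg)%N -> D (nth i0 dg j) (nth 0 x j).

Definition is_linear (V W : lmodType k) (f : V -> W) : Prop :=
  forall a x y, f (a *: x + y) = a *: f x + f y.

Definition is_submod (V : lmodType k) (P : V -> Prop) : Prop :=
  P 0 /\ forall a x y, P x -> P y -> P (a *: x + y).

(* n-ary operations are functions on sequences, relevant on sequences of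
   size n only. *)
Definition multilinear (X Y : lmodType k) (n : nat) (g : seq X -> Y) : Prop :=
  forall u v a x y, (size u + size v).+1 = n ->
    g (u ++ (a *: x + y) :: v) = a *: g (u ++ x :: v) + g (u ++ y :: v).

(* Underlying data of an S-module.  With MathComp's (s * t)%g = t o s, a right
   action of the symmetric groups satisfies x.(s * t)%g = (x.t).s . *)
Record smod := Smod {
  scar :> nat -> lmodType k;
  sdeg : forall r, int -> scar r -> Prop;
  sact : forall r, 'S_r -> scar r -> scar r
}.

Record gsmod := Gsmod {
  gs_mod : nat -> gmod int;
  gs_act : forall r, 'S_r -> gs_mod r -> gs_mod r;
  gs_act_linear : forall r (s : 'S_r), is_linear (gs_act s);
  gs_act_homog : forall r (s : 'S_r) d x, homog d x -> homog d (gs_act s x);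
  gs_act1 : forall r x, gs_act (1%g : 'S_r) x = x;
  gs_actM : forall r (s t : 'S_r) x,
    gs_act (s * t)%g x = gs_act s (gs_act t x)
}.

Definition gs_smod (E : gsmod) : smod :=
  @Smod (gs_mod E) (fun r d x => homog d x) (@gs_act E).

Definition susp (M : smod) : smod :=
  @Smod M (fun r d x => sdeg (d - 1) x) (@sact M).

Definition graded_sub (M : smod) (P : forall n, M n -> Prop) : Prop :=
  forall n,
  [/\ is_submod (P n), forall s x, P n x -> P n (sact s x) &
      forall x, P n x -> exists xs : seq (M n),
        each (fun y => P n y /\ exists d, sdeg d y) xs /\ x = \sum_(y <- xs) y].

(* Degree e equivariant families of operations F_r(mu) : X^{(x) r} -> Y indexed
   by a sub-S-module C of M, i.e. maps of S-modules from C to End_{X,Y}.  The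
   values of F outside C are irrelevant. *)
Definition op_family (M : smod) (C : forall r, M r -> Prop) (X Y : lmodType k)
    (DX : int -> X -> Prop) (DY : int -> Y -> Prop) (e : int)
    (F : forall r, M r -> seq X -> Y) : Prop :=
  [/\ forall r a (m m' : M r) x, C r m -> C r m' -> size x = r ->
        F r (a *: m + m') x = a *: F r m x + F r m' x,
      forall r (m : M r), C r m -> multilinear r (F r m),
      forall r d (m : M r) dg x, C r m -> sdeg d m -> size x = r ->
        homs DX 0 dg x -> DY (d + e + \sum_(i <- dg) i) (F r m x) &
      forall r s (m : M r) dg x, C r m -> size x = r -> homs DX 0 dg x ->
        F r (sact s m) x =
        sg (koszul dg (pword s)) *: F r m (args 0 x (pword s))].

(* The differential of a degree n operation g in the complex of operations. *)
Definition bdry (X Y : lmodType k) (dX : X -> X) (dY : Y -> Y) (n : int)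
    (dg : seq int) (g : seq X -> Y) (x : seq X) : Y :=
  dY (g x) - sg n *: \sum_(i < size x)
               sg (psum dg i) *: g (set_nth 0 x i (dX (nth 0 x i))).

End Graded.

Section Trees.
Variables (k : comPzRingType) (M : smod k).

(* Tree monomials: leaves carry input labels 0, 1, 2, ...; a vertex carries an
   element of M r together with its degree.  The vertices of a monomial are
   ordered by planar preorder, which fixes the Koszul signs. *)
Inductive tree : Type :=
| Leaf of nat
| Node (r : nat) of int & M r & seq tree.

Fixpoint word (t : tree) : seq (int + nat) :=
  match t with
  | Leaf i => [:: inr i]
  | Node r d m ch => inl d :: flatten (map word ch)
  end.

Definition leaves (t : tree) : seq nat :=
  pmap (fun a => if a is inr i then Some i else None) (word t).
Definition vdegs (w : seq (int + nat)) : seq int :=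
  pmap (fun a => if a is inl d then Some d else None) w.
Definition tdeg (t : tree) : int := \sum_(d <- vdegs (word t)) d.
Definition weight (t : tree) : nat := size (vdegs (word t)).
Definition is_leaf (t : tree) : bool := if t is Leaf _ then true else false.

Fixpoint wft (t : tree) : Prop :=
  match t with
  | Leaf _ => True
  | Node r d m ch => [/\ size ch = r, sdeg d m & each wft ch]
  end.

Definition ntree (n : nat) (t : tree) : Prop :=
  wft t /\ perm_eq (leaves t) (iota 0 n).

Fixpoint all_dec (P : forall r, M r -> Prop) (t : tree) : Prop :=
  match t with
  | Leaf _ => True
  | Node r d m ch => P r m /\ each (all_dec P) ch
  end.

Fixpoint relabel (f : nat -> nat) (t : tree) : tree :=
  match t with
  | Leaf i => Leaf (f i)
  | Node r d m ch => Node d m (map (relabel f) ch)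
  end.

Definition corolla (r : nat) (d : int) (m : M r) : tree :=
  Node d m (map Leaf (iota 0 r)).

Inductive trel : fsum k tree -> Prop :=
| trel_lin r d a (m m' : M r) ch : sdeg d m -> sdeg d m' ->
    trel [:: (1, Node d (a *: m + m') ch); (- a, Node d m ch);
             (-1, Node d m' ch)]
| trel_act r d (s : 'S_r) (m : M r) ch : size ch = r ->
    trel [:: (1, Node d (sact s m) ch);
             (- sg k (koszul (map tdeg ch) (pword s)),
              Node d m (args (Leaf 0) ch (pword s)))]
| trel_ctx r d (m : M r) u v s : trel s ->
    trel [seq (p.1, Node d m (u ++ p.2 :: v)) | p <- s].

(* Span of the tree monomials with leaves labelled bijectively by 0, ..., n-1
   (the other monomials are killed), modulo multilinearity and equivariance in
   each vertex and further relations J. *)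
Definition tmod_rel (J : nat -> fsum k tree -> Prop) (n : nat)
    (s : fsum k tree) : Prop :=
  [\/ (exists t, ~ ntree n t /\ s = [:: (1, t)]), trel s | J n s].

Section TreeModule.
Variable J : nat -> fsum k tree -> Prop.
Definition tcls (n : nat) (s : fsum k tree) : pres (tmod_rel J n) :=
  pcls (tmod_rel J n) s.
Definition trep (n : nat) (x : pres (tmod_rel J n)) : fsum k tree :=
  [seq p <- prep x | `[< ntree n p.2 >]].
Definition is_rep (n : nat) (x : pres (tmod_rel J n)) (s : fsum k tree) : Prop :=
  each (fun p => ntree n p.2) s /\ tcls n s = x.

Definition tmod : smod k :=
  @Smod k (fun n => pres (tmod_rel J n))
    (fun n d x => exists2 s, is_rep x s & each (fun p => tdeg p.2 = d) s)
    (fun n s x => tcls n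
       [seq (p.1, relabel (nth 0%N (pword s)) p.2) | p <- trep x]).

Definition has_weight (n w : nat) (x : tmod n) : Prop :=
  exists2 s, is_rep x s & each (fun p => weight p.2 = w) s.
Definition wcomp (n w : nat) (x : tmod n) : tmod n :=
  tcls n [seq p <- trep x | weight p.2 == w].
Definition tone : tmod 1 := tcls 1 [:: (1, Leaf 0)].

(* Partial composition: u, with n inputs, is grafted onto the leaf i of t; the
   sign moves u across the vertices of t that come after that leaf. *)
Fixpoint graft (i n : nat) (u t : tree) : tree :=
  match t with
  | Leaf j => if j == i then relabel (addn i) u
              else Leaf (if (j < i)%N then j else (j + n).-1)
  | Node r d m ch => Node d m (map (graft i n u) ch)
  end.
Definition deg_after (i : nat) (t : tree) : int :=
  \sum_(d <- vdegs (drop (index (inr i) (word t)) (word t))) d.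
Definition tcomp (i n : nat) (t u : tree) : k * tree :=
  (sg k (tdeg u * deg_after i t), graft i n u t).
Definition circ (m n i : nat) (x : tmod m) (y : tmod n) : tmod (m + n).-1 :=
  tcls (m + n).-1 [seq (p.1 * q.1 * (tcomp i n p.2 q.2).1, (tcomp i n p.2 q.2).2)
                  | p <- trep x, q <- trep y].
End TreeModule.

Definition free_smod : smod k := tmod (fun _ _ => False).

Inductive ideal (R : forall n, free_smod n -> Prop) : nat -> fsum k tree -> Prop :=
| ideal_gen n x s : R n x -> is_rep x s -> ideal R n s
| ideal_compl m n i s u : (i < m)%N -> ideal R m s -> ntree n u ->
    ideal R (m + n).-1 (fbind (fun t => [:: tcomp i n t u]) s)
| ideal_compr m n i t s : (i < m)%N -> ntree m t -> ideal R n s ->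
    ideal R (m + n).-1 (fbind (fun u => [:: tcomp i n t u]) s)
| ideal_act n (g : 'S_n) s : ideal R n s ->
    ideal R n [seq (p.1, relabel (nth 0%N (pword g)) p.2) | p <- s].

Definition quadratic_operad (R : forall n, free_smod n -> Prop) : smod k :=
  tmod (ideal R).
End Trees.
Arguments Leaf {k M}.
Arguments tone {k M J}.
Arguments tmod : simpl never.
Arguments tcls : simpl never.
Arguments free_smod : simpl never.
Arguments quadratic_operad : simpl never.

Fixpoint tmap (k : comPzRingType) (M N : smod k) (e : int)
    (F : forall r, M r -> N r) (t : tree M) : tree N :=
  match t with
  | Leaf i => Leaf i
  | Node r d m ch => Node (d + e) (F r m) (map (tmap e F) ch)
  end.

Section Cofree.
Variables (k : comPzRingType) (M : smod k).
Notation T := (free_smod M).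

(* The underlying S-module of the cofree cooperad on M is free_smod M (the trees
   involved have no automorphisms since M 0 = 0).  The list [cuts t] consists
   of the ways to cut t into a lower tree and the upper trees grafted on its
   leaves; the sign comes from moving the vertices of the lower tree in front
   of the vertices of the upper trees. *)
Fixpoint cuts (t : tree M) : seq (k * tree M * seq (tree M)) :=
  match t with
  | Leaf i => [:: (1, Leaf i, [:: Leaf i])]
  | Node r d m ch =>
      (1, Leaf (head 0%N (leaves t)), [:: t]) ::
      [seq (p.1.1, Node d m p.1.2, p.2) | p <-
        foldr (fun u acc =>
          [seq (p.1.1 * q.1.1 * sg k ((\sum_(v <- p.2) tdeg v) *
                                      (\sum_(v <- q.1.2) tdeg v)),
                p.1.2 :: q.1.2, p.2 ++ q.2) | p <- cuts u, q <- acc])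
          [:: (1, [::], [::])] ch]
  end.

(* Leaves are renumbered in planar order. *)
Definition std (t : tree M) : tree M := relabel (index^~ (leaves t)) t.
Definition lower (l : tree M) (ch : seq (tree T)) : tree T :=
  Node (tdeg l) (tcls _ _ [:: (1, std l)] : T (size ch)) ch.
Definition upper (u : tree M) : tree T :=
  Node (tdeg u) (tcls _ _ [:: (1, std u)] : T (size (leaves u)))
       (map Leaf (leaves u)).
Definition slift (u : tree M) : tree T := Leaf (head 0%N (leaves u)).

(* Two-level monomials represent elements of C o C, two-vertex monomials
   represent elements of the infinitesimal composite C o_(1) C. *)
Definition Delta (t : tree M) : fsum k (tree T) :=
  [seq (p.1.1, lower p.1.2 (map upper p.2)) | p <- cuts t].
Definition Delta1 (t : tree M) : fsum k (tree T) :=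
  flatten [seq
    [seq (p.1.1, lower p.1.2
            [seq (if i == j then upper (nth (Leaf 0) p.2 i)
                  else slift (nth (Leaf 0) p.2 i)) | i <- iota 0 (size p.2)])
    | j <- iota 0 (size p.2) & all (fun i => (i == j) || is_leaf (nth (Leaf 0) p.2 i))
                                   (iota 0 (size p.2))]
  | p <- cuts t].

Definition two_level (N : smod k) (t : tree N) : bool :=
  if t is Node _ _ _ ch
  then all (fun u => if u is Node _ _ _ ls then all (@is_leaf k N) ls else false) ch
  else false.

(* s' is a representative in C o C, resp. C o_(1) C, of the full, resp.
   infinitesimal, decomposition of x. *)
Definition full_rep (C : forall n, T n -> Prop) (n : nat) (x : T n)
    (s' : fsum k (tree T)) : Prop :=
  (exists2 s, is_rep x s & is_rep (tcls (fun _ _ => False) n (fbind Delta s)) s') /\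
  each (fun p => two_level p.2 /\ all_dec C p.2) s'.
Definition inf_rep (C : forall n, T n -> Prop) (n : nat) (x : T n)
    (s' : fsum k (tree T)) : Prop :=
  (exists2 s, is_rep x s & is_rep (tcls (fun _ _ => False) n (fbind Delta1 s)) s') /\
  each (fun p => weight p.2 = 2 /\ all_dec C p.2) s'.

Definition subcooperad (C : forall n, T n -> Prop) : Prop :=
  graded_sub C /\ forall n x, C n x -> exists s', full_rep C x s'.

(* The value on a two-vertex monomial with root m1 and upper vertex m2; bf, mid
   and af are the labels before, at and after the upper vertex. *)
Definition inf_val (Y : lmodType k)
    (F : forall r1, int -> T r1 -> seq nat ->
         forall r2, int -> T r2 -> seq nat -> seq nat -> Y) (t : tree T) : Y :=
  match t with
  | Leaf _ => 0
  | Node r1 d1 m1 ch =>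
      let l := find (predC (@is_leaf k T)) ch in
      match nth (Leaf 0) ch l with
      | Leaf _ => 0
      | Node r2 d2 m2 ch2 =>
          F r1 d1 m1 (flatten (map (@leaves k T) (take l ch)))
            r2 d2 m2 (flatten (map (@leaves k T) ch2))
            (flatten (map (@leaves k T) (drop l.+1 ch)))
      end
  end.
End Cofree.

Section Quadratic.
Variables (k : comPzRingType) (E : gsmod k).
Notation ES := (gs_smod E).
Variable R : forall n, free_smod ES n -> Prop.
Notation O := (quadratic_operad R).
Notation SE := (susp ES).
Notation T := (free_smod SE).

Definition quadratic_relations : Prop :=
  graded_sub R /\ forall n (x : free_smod ES n), R x -> has_weight 2 x.

(* Bar construction of O: monomials with v vertices decorated by elements of
   positive weight of s O, of total weight w. *)
Inductive bar_tree : nat -> nat -> tree (susp O) -> Prop :=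
| bar_leaf i : bar_tree 0 0 (Leaf i)
| bar_node r d (m : susp O r) ch w0 (vw : seq (nat * nat)) :
    (0 < w0)%N -> has_weight w0 (m : O r) -> size vw = size ch ->
    (forall i, (i < size ch)%N ->
       bar_tree (nth (0, 0)%N vw i).1 (nth (0, 0)%N vw i).2 (nth (Leaf 0) ch i)) ->
    bar_tree (\sum_(p <- vw) p.1).+1 (w0 + \sum_(p <- vw) p.2) (Node d m ch).

(* Contraction of the edge joining the root of Node d m ch to its i-th child. *)
Definition contract (r : nat) (d : int) (m : susp O r) (ch : seq (tree (susp O)))
    (i : nat) : fsum k (tree (susp O)) :=
  match nth (Leaf 0) ch i with
  | Leaf _ => [::]
  | Node r' d' m' ch' =>
      [:: (sg k (d' * psum (map (@tdeg k _) ch) i + (d - 1)),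
           @Node k (susp O) (r + r').-1 (d + d' - 1) (circ i (m : O r) (m' : O r'))
             (take i ch ++ ch' ++ drop i.+1 ch))]
  end.

Fixpoint bar_d (t : tree (susp O)) : fsum k (tree (susp O)) :=
  match t with
  | Leaf _ => [::]
  | Node r d m ch =>
      flatten [seq contract d m ch i | i <- iota 0 (size ch)] ++
      flatten [seq
        [seq (sg k (d + psum (map (@tdeg k _) ch) i) * p.1,
              Node d m (set_nth (Leaf 0) ch i p.2))
        | p <- nth [::] (map bar_d ch) i]
      | i <- iota 0 (size ch)]
  end.

(* The inclusion of the Koszul dual cooperad in the bar construction of O is a
   quasi-isomorphism: the homology of the bar construction is concentrated in
   the diagonal v = w. *)
Definition koszul_operad : Prop :=
  forall n v w s, v <> w ->
    each (fun p => ntree n p.2 /\ bar_tree v w p.2) s ->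
    tcls (fun _ _ => False) n (fbind bar_d s) = 0 ->
    exists2 s', each (fun p => ntree n p.2 /\ bar_tree v.+1 w p.2) s' &
      tcls (fun _ _ => False) n (fbind bar_d s') =
      tcls (fun _ _ => False) n s.

(* O(n) = \bigoplus_{s in S_n} P(n).s for a non-symmetric suboperad P. *)
Definition is_symmetrization : Prop :=
  exists P : forall n, O n -> Prop,
  [/\ forall n, is_submod (P n) /\
        forall x, P n x -> exists xs : seq (O n),
          each (fun y => P n y /\ exists d, sdeg d y) xs /\ x = \sum_(y <- xs) y,
      P 1%N tone,
      forall m n i (x : O m) (y : O n), (i < m)%N -> P m x -> P n y ->
        P (m + n).-1 (circ i x y) &
      forall n x, exists! p : {ffun 'S_n -> O n},
        (forall s, P n (p s)) /\ x = \sum_s sact s (p s)].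

Definition rational : Prop := forall n, exists y : k, n.+1%:R * y = 1.

(* s^2 (m1 o_l m2) = (-1)^|m1| s m1 o_l s m2 *)
Definition susp2 (t : tree ES) : fsum k (tree SE) :=
  [:: (sg k (if t is Node _ d _ _ then d else 0),
       tmap (M := ES) (N := SE) 1 (fun r m => m) t)].
Definition s2R (n : nat) (y : T n) : Prop :=
  exists2 s, each (fun p => ntree n p.2 /\ weight p.2 = 2) s /\
             R (tcls _ n s) &
             y = tcls _ n (fbind susp2 s).

(* The Koszul dual cooperad C(sE, s^2R): the largest subcooperad of the cofree
   cooperad on sE whose projection to weight 2 is contained in s^2R. *)
Definition KD (n : nat) (x : T n) : Prop :=
  exists C, [/\ subcooperad C, forall m y, C m y -> s2R (wcomp 2 y) & C n x].

Definition kappa (n : nat) (x : T n) : O n :=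
  tcls _ n [seq (p.1, tmap (M := SE) (N := ES) (-1) (fun r m => m) p.2)
           | p <- trep x & weight p.2 == 1%N].

Definition gen (r : nat) (d : int) (m : ES r) : O r :=
  tcls _ r [:: (1, corolla d m)].
Definition sgen (r : nat) (d : int) (m : ES r) : T r :=
  tcls _ r [:: (1, @corolla k SE r (d + 1) m)].

Definition homotopy_algebra (A : lmodType k) (D : int -> A -> Prop) (d : A -> A)
    (phi : forall r, T r -> seq A -> A) : Prop :=
  [/\ is_linear d /\ (forall n x, D n x -> D (n - 1) (d x)),
      forall x, d (d x) = 0,
      op_family KD D D (-1) phi,
      forall x, phi 1%N tone [:: x] = 0 &
      forall n e (m : T n) s dg x, KD m -> sdeg e m -> inf_rep KD m s ->
        size x = n -> homs D 0 dg x ->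
        bdry d d (e - 1) dg (phi n m) x +
        fev (inf_val (fun r1 d1 m1 bf r2 d2 m2 mid af =>
          sg k (d1 + koszul dg (bf ++ mid ++ af)
                + (d2 - 1) * \sum_(j <- bf) nth 0 dg j) *:
          phi r1 m1 (args 0 x bf ++ phi r2 m2 (args 0 x mid) :: args 0 x af))) s
        = 0].

(* gamma(phi(m); f(m_1), ..., f(m_r)) on a two-level monomial, f of degree 0 *)
Definition full_val (A B : lmodType k) (phi : forall r, T r -> seq B -> B)
    (f : forall r, T r -> seq A -> B) (dg : seq int) (x : seq A) (t : tree T) : B :=
  match t with
  | Leaf _ => 0
  | Node r d m ch =>
      sg k (koszul dg (leaves t) +
            \sum_(j < size ch) tdeg (nth (Leaf 0) ch j) *
               \sum_(l <- flatten (map (@leaves k T) (take j ch))) nth 0 dg l) *: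
      phi r m [seq (if u is Node r' _ m' _ then f r' m' (args 0 x (leaves u)) else 0)
              | u <- ch]
  end.

Definition infty_morphism (A B : lmodType k)
    (DA : int -> A -> Prop) (DB : int -> B -> Prop) (dA : A -> A) (dB : B -> B)
    (phiA : forall r, T r -> seq A -> A) (phiB : forall r, T r -> seq B -> B)
    (f : forall r, T r -> seq A -> B) : Prop :=
  op_family KD DA DB 0 f /\
  forall n e (m : T n) s s' dg x, KD m -> sdeg e m ->
    inf_rep KD m s -> full_rep KD m s' -> size x = n -> homs DA 0 dg x ->
    bdry dA dB e dg (f n m) x =
    fev (inf_val (fun r1 d1 m1 bf r2 d2 m2 mid af =>
      sg k (d1 + koszul dg (bf ++ mid ++ af)
            + (d2 - 1) * \sum_(j <- bf) nth 0 dg j) *: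
      f r1 m1 (args 0 x bf ++ phiA r2 m2 (args 0 x mid) :: args 0 x af))) s
    - fev (full_val phiB f dg x) s'.

Record dg_algebra := DgAlgebra {
  dga :> gmod k int;
  dga_d : dga -> dga;
  dga_op : forall r, O r -> seq dga -> dga;
  dga_d_linear : is_linear dga_d;
  dga_d_homog : forall n x, homog n x -> homog (n - 1) (dga_d x);
  dga_dd : forall x, dga_d (dga_d x) = 0;
  dga_op_family :
    op_family (fun _ _ => True) (@homog k _ dga) (@homog k _ dga) 0 dga_op;
  dga_op1 : forall x, dga_op tone [:: x] = x;
  dga_op_circ : forall m n i e (a : O m) (b : O n) dg x,
    (i < m)%N -> sdeg e b -> size x = (m + n).-1 -> homs (@homog k _ dga) 0 dg x ->
    dga_op (circ i a b) x =
    sg k (e * psum dg i) *: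
      dga_op a (take i x ++ dga_op b (take n (drop i x)) :: drop (i + n) x);
  dga_op_d : forall r e (a : O r) dg x,
    sdeg e a -> size x = r -> homs (@homog k _ dga) 0 dg x ->
    bdry dga_d dga_d e dg (dga_op a) x = 0
}.

Section Homology.
Variable A : dg_algebra.
Definition cycles := subm (fun x : A => dga_d x = 0).
Definition homology : lmodType k :=
  quot (fun z : cycles => exists y : A, subm_val z = dga_d y).
Definition hcls (z : A) : homology := qcls _ (insubd (0 : cycles) z).
Definition hrep (h : homology) : A := subm_val (qrep h).
Definition hdeg (n : int) (h : homology) : Prop :=
  exists z : A, [/\ homog n z, dga_d z = 0 & h = hcls z].
Definition hop (r : nat) (a : O r) (h : seq homology) : homology :=
  hcls (dga_op a (map hrep h)).
End Homology.

(* Bigraded homotopy algebra data, p in (p, q) being the horizontal degree. *)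
Record dh_data := DhData {
  dh :> gmod k (int * int)%type;
  dh_d : dh -> dh;
  dh_op : forall r, T r -> seq dh -> dh
}.

Definition tot (V : gmod k (int * int)%type) (n : int) (x : V) : Prop :=
  forall p q, p + q <> n -> gpr (p, q) x = 0.
Definition fil (V : gmod k (int * int)%type) (m : int) (x : V) : Prop :=
  forall p q, (m < p)%R -> gpr (p, q) x = 0.

Definition derived_homotopy_algebra (X : dh_data) : Prop :=
  [/\ homotopy_algebra (@tot X) (@dh_d X) (@dh_op X),
      forall p q (x : X), (p < 0)%R -> gpr (p, q) x = 0,
      forall p (x : X), fil p x -> fil p (dh_d x) &
      forall r (m : T r) ps (x : seq X), KD m -> size x = r ->
        homs (@fil X) 0 ps x -> fil (\sum_(p <- ps) p) (dh_op m x)].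

Definition minimal (X : dh_data) : Prop :=
  forall p q (x : X), homog (p, q) x -> gpr (p, q - 1) (dh_d x) = 0.

Section HorizontalZero.
Variable A : dg_algebra.
Definition pr0 (b : int * int) (x : A) : A := if b.1 == 0 then gpr b.2 x else 0.
Lemma pr0_linear b a x y : pr0 b (a *: x + y) = a *: pr0 b x + pr0 b y.
Proof. by rewrite /pr0; case: eqP => _; rewrite ?gpr_linear // scaler0 addr0. Qed.
Lemma pr0_pr0 b c x : pr0 b (pr0 c x) = if b == c then pr0 b x else 0.
Proof.
have g0 i : gpr i (0 : A) = 0.
  by have := gpr_gpr i i (0 : A); have := gpr_linear i (-1) (0 : A) 0;
  rewrite scaler0 addr0 scaleN1r addNr.
case: b c => [p q] [p' q']; rewrite /pr0 xpair_eqE /=.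
case: (p =P 0) => [->|hp].
  case: (p' =P 0) => [->|hp']; first by rewrite eqxx gpr_gpr.
  by rewrite g0 eq_sym (introF eqP hp').
by case: ifP.
Qed.
Lemma pr0_sum x : exists s, uniq s /\ x = \sum_(b <- s) pr0 b x.
Proof.
have [s [us xs]] := gpr_sum x; exists (map (pair 0) s); split.
  by rewrite map_inj_uniq // => i j [].
by rewrite {1}xs big_map.
Qed.
(* A concentrated in horizontal degree 0, with structure induced by kappa *)
Definition dga_bi : gmod k (int * int)%type :=
  Gmod pr0_linear pr0_pr0 pr0_sum.
Definition dga_dh : dh_data :=
  @DhData dga_bi (@dga_d A) (fun r m => @dga_op A r (kappa m)).
End HorizontalZero.

Definition derived_infty_morphism (X Y : dh_data)
    (f : forall r, T r -> seq X -> Y) : Prop :=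
  infty_morphism (@tot X) (@tot Y) (@dh_d X) (@dh_d Y) (@dh_op X) (@dh_op Y) f /\
  forall r (m : T r) ps (x : seq X), KD m -> size x = r ->
    homs (@fil X) 0 ps x -> fil (\sum_(p <- ps) p) (f r m x).

(* E^2 in filtration p and total degree n is E2Z p n / E2B p n. *)
Definition E2Z (X : dh_data) (p n : int) (x : X) : Prop :=
  [/\ tot n x, fil p x & fil (p - 2) (dh_d x)].
Definition E2B (X : dh_data) (p n : int) (x : X) : Prop :=
  exists u y, [/\ [/\ tot n u, fil (p - 1) u & fil (p - 2) (dh_d u)],
                  [/\ tot (n + 1) y, fil (p + 1) y & fil p (dh_d y)] &
                  x = u + dh_d y].
Definition E2_iso (X Y : dh_data) (g : X -> Y) : Prop :=
  forall p n,
    (forall x, E2Z p n x -> E2B p n (g x) -> E2B p n x) /\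
    (forall y, E2Z p n y -> exists2 x, E2Z p n x & E2B p n (y - g x)).

Definition derived_minimal_model (A : dg_algebra) (X : dh_data)
    (f : forall r, T r -> seq X -> dga_dh A) : Prop :=
  [/\ derived_homotopy_algebra X, minimal X, projective X,
      derived_infty_morphism f & E2_iso (fun x => f 1%N tone [:: x])].

Section Cohomology.
Variables (A : dg_algebra) (X : dh_data) (f : forall r, T r -> seq X -> dga_dh A).

(* The part lowering the horizontal degree by i of a degree n operation whose
   inputs have total bidegree b takes values in bidegree lowb b n i. *)
Definition lowb (b : int * int) (n i : int) : int * int := (b.1 - i, b.2 + n + i).
Definition low (V : gmod k (int * int)%type) (b : int * int) (n i : int) (y : V) : V :=
  gpr (lowb b n i) y.
Definition bsum (bs : seq (int * int)) : int * int :=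
  (\sum_(b <- bs) b.1, \sum_(b <- bs) b.2).
Definition totd (bs : seq (int * int)) : seq int := [seq b.1 + b.2 | b <- bs].

(* rho on elements of bidegree b *)
Definition rho (b : int * int) (x : X) : homology A :=
  hcls (low b 0 0 (f tone [:: x])).
Definition rhos (bs : seq (int * int)) (x : seq X) (l : seq nat) : seq (homology A) :=
  [seq rho (nth (0, 0) bs j) (nth 0 x j) | j <- l].

(* Elements of C^{w,t}(X, H_*(A)): psi u is a map on the weight u part. *)
Definition cochain (w : nat) (t : int)
    (psi : nat -> forall r, T r -> seq X -> homology A) : Prop :=
  forall u : nat,
  [/\ op_family KD (@tot X) (@hdeg A) (- (w%:Z + t)) (psi u),
      forall v r (m : T r) x, KD m -> has_weight v m -> size x = r -> v <> u ->
        psi u r m x = 0,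
      (w < u)%N -> forall r (m : T r) x, KD m -> size x = r -> psi u r m x = 0 &
      forall r (m : T r) bs x, KD m -> size x = r ->
        homs (@homog k _ X) (0, 0) bs x -> (bsum bs).1 <> w%:Z - u%:Z ->
        psi u r m x = 0].

Definition pred_comp (psi : nat -> forall r, T r -> seq X -> homology A) (u : nat) :
    forall r, T r -> seq X -> homology A :=
  if u is u'.+1 then psi u' else fun _ _ _ => 0.

(* kappa(m)(x) in the bicomplex algebra X, for m of degree d *)
Definition kappaX (r : nat) (d : int) (m : T r) (bs : seq (int * int)) (x : seq X) : X :=
  low (bsum bs) (d - 1) 0 (dh_op (wcomp 1 m) x).

Definition eta (n d1 d2 : int) (dg : seq int) (bf mid af : seq nat) : int :=
  koszul dg (bf ++ mid ++ af) + d1 * n + (d2 + n) * \sum_(j <- bf) nth 0 dg j.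

Definition is_differential (w : nat) (t : int)
    (psi chi : nat -> forall r, T r -> seq X -> homology A) : Prop :=
  forall u r e (m : T r) s bs x, (u <= w.+1)%N ->
    KD m -> has_weight u m -> sdeg e m -> inf_rep KD m s ->
    size x = r -> homs (@homog k _ X) (0, 0) bs x ->
    let dg := totd bs in
    chi u r m x =
    fev (inf_val (fun r1 d1 m1 bf r2 d2 m2 mid af =>
      sg k (t + eta (w%:Z + t) d1 d2 dg bf mid af) *:
      hop (kappa m1)
        (rhos bs x bf ++ pred_comp psi u m2 (args 0 x mid) :: rhos bs x af))) s
    - fev (inf_val (fun r1 d1 m1 bf r2 d2 m2 mid af =>
      sg k (w%:Z + eta 1 d1 d2 dg bf mid af) *:
      pred_comp psi u m1
        (args 0 x bf ++ kappaX d2 m2 (args (0, 0) bs mid) (args 0 x mid)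
                     :: args 0 x af))) s
    - \sum_(i < r) sg k (w%:Z + e + psum dg i) *:
        psi u r m (set_nth 0 x i (low (nth (0, 0) bs i) (-1) 1 (dh_d (nth 0 x i)))).

Definition universal_cocycle
    (m : nat -> forall r, T r -> seq X -> homology A) : Prop :=
  [/\ cochain 2 (-1) m,
      forall b x, homog b x ->
        m 0%N 1%N tone [:: x] = rho (lowb b (-1) 2) (low b (-1) 2 (dh_d x)),
      forall r e (mu : ES r) bs x, homog e mu -> size x = r ->
        homs (@homog k _ X) (0, 0) bs x ->
        m 1%N r (sgen e mu) x =
        rho (lowb (bsum bs) e 1) (low (bsum bs) e 1 (dh_op (sgen e mu) x)) &
      forall r e s bs x, each (fun p => [/\ ntree r p.2, weight p.2 = 2 & tdeg p.2 = e]) s ->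
        R (tcls _ r s) -> size x = r -> homs (@homog k _ X) (0, 0) bs x ->
        let s2 := tcls _ r (fbind susp2 s) in
        m 2 r s2 x =
        rho (lowb (bsum bs) (e + 1) 0) (low (bsum bs) (e + 1) 0 (dh_op s2 x))].
End Cohomology.

(* gamma_A = 0 in cohomology.  The class does not depend on the derived minimal
   model, so it is computed on some model. *)
Definition trivial_universal_massey (A : dg_algebra) : Prop :=
  exists (X : dh_data) (f : forall r, T r -> seq X -> dga_dh A),
    derived_minimal_model f /\
    exists m psi, [/\ universal_cocycle f m, cochain 1 (-1) psi &
                      is_differential f 1 (-1) psi m].

Section Massey.
Variables (A : dg_algebra) (r : nat) (e : int) (mu : ES r).
Variables (t : r.-tuple k) (dg : r.-tuple int) (x : r.-tuple (homology A)).

Definition massey_defined : Prop :=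
  [/\ homog e mu, \sum_i tnth t i = 0,
      forall i, hdeg (tnth dg i) (tnth x i) &
      forall i, tnth t i *: tnth x i = 0].

Definition massey_choice (y z : r.-tuple A) : Prop :=
  forall i, [/\ homog (tnth dg i) (tnth y i), dga_d (tnth y i) = 0,
                tnth x i = hcls (tnth y i), homog (tnth dg i + 1) (tnth z i) &
                dga_d (tnth z i) = tnth t i *: tnth y i].

(* The quotient is taken by the span of this set. *)
Definition indeterminacy (h : homology A) : Prop :=
  exists (i : 'I_r) (h' : homology A),
    hdeg (tnth dg i + 1) h' /\ h = hop (gen e mu) (set_nth 0 x i h').

Definition massey_product (y z : r.-tuple A) : quot indeterminacy :=
  qcls indeterminacy (hcls (\sum_(i < r)
    sg k (e + psum dg i) *: dga_op (gen e mu) (set_nth 0 y i (tnth z i)))).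
End Massey.
End Quadratic.

(* Main.v *)
Require Import Defs.
From HB Require Import structures.
From mathcomp Require Import all_boot all_order all_algebra all_fingroup.
From mathcomp Require Import zify ring.
From mathcomp.classical Require Import boolp.
Set Implicit Arguments. Unset Strict Implicit. Unset Printing Implicit Defensive.
Import Order.TTheory GRing.Theory Num.Theory.
Local Open Scope ring_scope.

(** Let f : X ~> A be a derived minimal model on which the universal cocycle
    m = (m_0, m_1, m_2) is the differential of a cochain psi = (psi_0, psi_1).
    Let d_1 and d_2 be the parts of the differential of X that lower the
    horizontal degree by 1 and 2, and rho the map to the homology of A induced
    by f(1) on horizontal degree 0.

    Lifting. As f(1) is an E^2-equivalence, H(A) is the quotient of X_{0,*} by
    d_1 X_{1,*}. Hence x_i = rho(a_i) for some a_i of bidegree (0, |x_i|), and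
    t_i x_i = 0 gives b_i of bidegree (1, |x_i|) with d b_i = t_i a_i
    ([lift_cycle], [lift_boundary]). So f(1)(a_i) and f(1)(b_i) are admissible
    choices of y_i and z_i. Another choice changes the class of the Massey sum
    by an element of the indeterminacy only ([msum_homologous], [hop_hcls]).

    Computation ([massey_class_of_lifts]). Put
    B_i = (a_1, ..., b_i, ..., a_r). The operation f(s mu) is a homotopy between
    mu(f(1)(B_i)) and f(1)((s mu)(B_i)), up to a term in which the differential
    is applied to b_i. That term is t_i times an element that depends on i only
    through the sign of the i-th summand of the Massey product; as the t_i sum
    to 0, these terms cancel. Therefore the Massey sum is homologous to f(1)(c)
    for the signed sum c of the (s mu)(B_i), and d c = 0 by the same
    cancellation. Split c = c_1 + c_0 by horizontal degree.

    - c_1 is a d_1-cycle of horizontal degree 1, so c_1 = d_1 w for some w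
      ([lift_horizontal_cycle]). Since f(1)(d w) is a boundary, the class of
      f(1)(c_1) is - rho(d_2 w) = - m_0(w) = - psi_0(d_1 w) = - psi_0(c_1).
    - The class of f(1)(c_0) is the signed sum of the m_1(s mu; B_i). By
      m = d psi it consists of psi_0(c_1), of minus the signed sum of the
      mu(x_1, ..., psi_0(b_i), ..., x_r), and of multiples by t_i of one fixed
      value of psi_1, which cancel.

    The terms psi_0(c_1) cancel too, and what remains lies in the indeterminacy.

    The explicit form of the structure equations of X, f and d psi comes from
    representatives of the decompositions of 1 and s mu. The equations hold
    for representatives decorated by elements of the Koszul dual cooperad,
    and 1 and s mu belong to it because the elements of weight at most 1 form
    a subcooperad ([low_weight_subcooperad], [KD_low]). *)

(** * Signs, words, formal sums and gradings *)

Section Signs.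
Variable k : comPzRingType.
Implicit Types a b : int.

Lemma sgD a b : sg k (a + b) = sg k a * sg k b.
Proof.
have [c hc] : exists c, (`|a| + `|b| = `|(a + b)%R| + c.*2)%N.
  have [h|h] : (`|a| + `|b| = `|(a + b)%R| \/
                `|a| + `|b| = `|(a + b)%R| + (minn `|a| `|b|).*2)%N by lia.
  - by exists 0%N; rewrite h addn0.
  - by exists (minn `|a| `|b|).
by rewrite /sg -exprD hc exprD -[X in _ * X]signr_odd odd_double mulr1.
Qed.

Lemma sg0 : sg k 0 = 1. Proof. by []. Qed.
Lemma sg1 : sg k 1 = -1. Proof. by rewrite /sg expr1. Qed.
Lemma sgK a : sg k a * sg k a = 1.
Proof. by rewrite /sg -exprD addnn -signr_odd odd_double. Qed.
End Signs.

Section Each.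
Variable T : Type.
Implicit Types (P Q : T -> Prop) (s : seq T).

Lemma eachP P s : each P s <-> all (fun x => `[< P x >]) s.
Proof.
elim: s => //= x s IH; split; first by case=> Px /IH ->; rewrite andbT; apply/asboolP.
by case/andP=> /asboolP Px /IH.
Qed.

Lemma each_cat P s s' : each P (s ++ s') <-> each P s /\ each P s'.
Proof. by rewrite !eachP all_cat; split=> /andP. Qed.

Lemma each_impl P Q s : (forall x, P x -> Q x) -> each P s -> each Q s.
Proof. by move=> PQ; elim: s => //= x s IH [/PQ Qx /IH]. Qed.

Lemma each_map (U : Type) P (f : U -> T) (s : seq U) :
  each P (map f s) <-> each (fun u => P (f u)) s.
Proof. by elim: s => //= u s IH; rewrite IH; apply: iff_refl. Qed.

Lemma each_flatten P (ss : seq (seq T)) : each P (flatten ss) <-> each (each P) ss.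
Proof. by elim: ss => //= s ss IH; rewrite each_cat IH; apply: iff_refl. Qed.

Lemma each_args P (x0 : T) s l :
  perm_eq l (iota 0 (size s)) -> each P (args x0 s l) <-> each P s.
Proof.
move=> hl; rewrite !eachP /args all_map (perm_all _ hl).
by rewrite -[in X in _ <-> X](mkseq_nth x0 s) /mkseq all_map; apply: iff_refl.
Qed.
End Each.

Lemma each_mem (T : eqType) (P : T -> Prop) (s : seq T) :
  (forall x, x \in s -> P x) -> each P s.
Proof. by move=> h; apply/eachP/allP => x /h Px; apply/asboolP. Qed.

Lemma perm_args (T : eqType) (x0 : T) (s : seq T) l :
  perm_eq l (iota 0 (size s)) -> perm_eq (args x0 s l) s.
Proof. by move=> hl; rewrite -{2}(mkseq_nth x0 s); apply: perm_map. Qed.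

Lemma map_args (T U : Type) (f : T -> U) x0 y0 (s : seq T) l :
  perm_eq l (iota 0 (size s)) -> map f (args x0 s l) = args y0 (map f s) l.
Proof.
move=> hl; rewrite /args -map_comp; apply/eq_in_map => j /=.
by rewrite (perm_mem hl) mem_iota => /andP[_ hj]; rewrite (nth_map x0).
Qed.

Lemma size_pword r (s : 'S_r) : size (pword s) = r.
Proof. by rewrite size_map size_enum_ord. Qed.

Lemma pword_perm r (s : 'S_r) : perm_eq (pword s) (iota 0 r).
Proof.
have us : uniq (pword s).
  rewrite map_inj_uniq ?enum_uniq // => i j /val_inj; exact: perm_inj.
apply: uniq_perm; rewrite ?iota_uniq //.
have sub : {subset pword s <= iota 0 r}.
  by move=> i /mapP[j _ ->]; rewrite mem_iota /= add0n.
by apply: (uniq_min_size us sub _).2; rewrite size_pword size_iota.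
Qed.

Section Fsum.
Variables (k : comPzRingType) (X : Type) (W : lmodType k).
Implicit Types (f : X -> W) (s : fsum k X).

Lemma fev_cons f p s : fev f (p :: s) = p.1 *: f p.2 + fev f s.
Proof. by rewrite /fev big_cons. Qed.
Lemma fev_nil f : fev f [::] = 0. Proof. by rewrite /fev big_nil. Qed.
Lemma fev_map (Y : Type) f (g : Y -> X) (s : fsum k Y) :
  fev f [seq (p.1, g p.2) | p <- s] = fev (f \o g) s.
Proof. by rewrite /fev big_map. Qed.
Lemma fev_eq f f' s : each (fun p => f p.2 = f' p.2) s -> fev f s = fev f' s.
Proof. by elim: s => [|p s IH] /=; rewrite ?fev_nil ?fev_cons // => -[-> /IH ->]. Qed.
Lemma fev0 f s : each (fun p => f p.2 = 0) s -> fev f s = 0.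
Proof.
by elim: s => [|p s IH] /=; rewrite ?fev_nil ?fev_cons // => -[-> /IH ->]; rewrite scaler0 addr0.
Qed.
Lemma fev_filter f (P : pred X) s :
  fev f [seq p <- s | P p.2] = fev (fun x => if P x then f x else 0) s.
Proof.
elim: s => [|p s IH] /=; rewrite ?fev_nil // [RHS]fev_cons -IH.
by case: ifP => hp; rewrite ?fev_cons // scaler0 add0r.
Qed.
End Fsum.

Section LinearMaps.
Variables (k : comPzRingType) (V W : lmodType k) (f : V -> W).
Hypothesis f_lin : is_linear f.

Lemma is_linear0 : f 0 = 0.
Proof. by have := f_lin (-1) 0 0; rewrite scaler0 addr0 scaleN1r addNr. Qed.
Lemma is_linearZ a x : f (a *: x) = a *: f x.
Proof. by rewrite -[a *: x]addr0 f_lin is_linear0 addr0. Qed.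
Lemma is_linearD x y : f (x + y) = f x + f y.
Proof. by rewrite -[x]scale1r f_lin !scale1r. Qed.
Lemma is_linearB x y : f (x - y) = f x - f y.
Proof. by rewrite is_linearD -scaleN1r is_linearZ scaleN1r. Qed.
Lemma is_linear_sum (I : Type) (s : seq I) (P : pred I) (F : I -> V) :
  f (\sum_(i <- s | P i) F i) = \sum_(i <- s | P i) f (F i).
Proof. by apply: (big_morph f); [exact: is_linearD|exact: is_linear0]. Qed.
End LinearMaps.

Section Grading.
Variables (k : comPzRingType) (I : eqType) (V : gmod k I).

Lemma gpr0 i : gpr i (0 : V) = 0.
Proof. exact: (is_linear0 (@gpr_linear k I V i)). Qed.

Lemma homog_lin i a (x y : V) : homog i x -> homog i y -> homog i (a *: x + y).
Proof. by rewrite /homog gpr_linear => -> ->. Qed.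

Lemma gpr_is_linear i : is_linear (@gpr k I V i).
Proof. by move=> a x y; apply: gpr_linear. Qed.

Lemma homog_gpr i (x : V) : homog i (gpr i x).
Proof. by rewrite /homog gpr_gpr eqxx. Qed.

Lemma gpr_homog i j (x : V) : homog i x -> gpr j x = if j == i then x else 0.
Proof. by rewrite /homog => h; rewrite -h gpr_gpr; case: eqP => // ->; rewrite h. Qed.

Lemma homog0 i : homog i (0 : V). Proof. exact: gpr0. Qed.
Lemma homogD i (x y : V) : homog i x -> homog i y -> homog i (x + y).
Proof. by move=> hx hy; rewrite -[x]scale1r; apply: homog_lin. Qed.
Lemma homogZ i a (x : V) : homog i x -> homog i (a *: x).
Proof. by move=> h; rewrite -[_ *: _]addr0; apply: homog_lin => //; apply: homog0. Qed.
Lemma homogB i (x y : V) : homog i x -> homog i y -> homog i (x - y).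
Proof. by move=> hx hy; rewrite -scaleN1r addrC; apply: homog_lin. Qed.

Lemma gpr_inj (x y : V) : (forall i, gpr i x = gpr i y) -> x = y.
Proof.
move=> h; apply/subr0_eq; have [s [_ ->]] := gpr_sum (x - y).
by rewrite big1 // => i _; rewrite (is_linearB (gpr_is_linear i)) h subrr.
Qed.
End Grading.

(** * Tree monomials and their relations *)

Section TreeBasics.
Variables (k : comPzRingType) (M : smod k).
Notation tree := (tree M).
Implicit Types (t u : tree) (ch : seq tree) (s : fsum k tree).

Lemma tree_nested_ind (P : tree -> Prop) :
  (forall i, P (Leaf i)) ->
  (forall r d (m : M r) ch, each P ch -> P (Node d m ch)) -> forall t, P t.
Proof.
move=> hL hN; fix IH 1; case=> [i|r d m ch]; first exact: hL.
by apply: hN; elim: ch => [|t ch IHch]; [|split; [apply: IH|apply: IHch]].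
Qed.

Lemma leaves_node r d (m : M r) ch :
  leaves (Node d m ch) = flatten (map (@leaves k M) ch).
Proof. by rewrite /leaves /=; elim: ch => //= t ch IH; rewrite pmap_cat IH. Qed.

Lemma weight_node r d (m : M r) ch :
  weight (Node d m ch) = (sumn (map (@weight k M) ch)).+1.
Proof.
rewrite /weight /vdegs /=; congr _.+1; elim: ch => //= t ch IH.
by rewrite pmap_cat size_cat IH.
Qed.

Lemma tdeg_node r d (m : M r) ch :
  tdeg (Node d m ch) = d + \sum_(e <- map (@tdeg k M) ch) e.
Proof.
rewrite /tdeg /= big_cons; congr +%R; elim: ch => [|t ch IH] /=; first by rewrite !big_nil.
by rewrite /vdegs pmap_cat big_cat big_cons -IH.
Qed.

Lemma leaves_leaf i : leaves (Leaf i : tree) = [:: i]. Proof. by []. Qed.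
Lemma weight_leaf i : weight (Leaf i : tree) = 0%N. Proof. by []. Qed.
Lemma tdeg_leaf i : tdeg (Leaf i : tree) = 0.
Proof. by rewrite /tdeg /= big_nil. Qed.

Lemma leaves_corolla (l : seq nat) : flatten (map (@leaves k M) (map Leaf l)) = l.
Proof. by elim: l => //= i l ->. Qed.

Lemma tdeg_leaves (l : seq nat) :
  \sum_(e <- map (@tdeg k M) (map Leaf l)) e = 0.
Proof. by rewrite !big_map big1 // => i _; rewrite tdeg_leaf. Qed.

Lemma weight0_leaves ch :
  sumn (map (@weight k M) ch) = 0%N -> exists l, ch = map Leaf l.
Proof.
elim: ch => [|[i|r d m c] ch IH] /=; first by exists [::].
  by rewrite weight_leaf => /IH[l ->]; exists (i :: l).
by rewrite weight_node.
Qed.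

Lemma wft_leaves (l : seq nat) : each (@wft k M) (map Leaf l).
Proof. by elim: l. Qed.

Lemma word_relabel g t :
  word (relabel g t) = map (fun a => if a is inr i then inr (g i) else a) (word t).
Proof.
elim/tree_nested_ind: t => //= r d m ch; rewrite -!map_comp => IH; congr cons.
by elim: ch IH => //= t ch IH [-> /IH ->]; rewrite map_cat.
Qed.

Lemma leaves_relabel g t : leaves (relabel g t) = map g (leaves t).
Proof. by rewrite /leaves word_relabel; elim: (word t) => //= -[a|i] w ->. Qed.

Lemma vdegs_relabel g t : vdegs (word (relabel g t)) = vdegs (word t).
Proof. by rewrite /vdegs word_relabel; elim: (word t) => //= -[a|i] w ->. Qed.

Lemma tdeg_relabel g t : tdeg (relabel g t) = tdeg t.
Proof. by rewrite /tdeg vdegs_relabel. Qed.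

Lemma weight_relabel g t : weight (relabel g t) = weight t.
Proof. by rewrite /weight vdegs_relabel. Qed.

Lemma wft_relabel g t : wft t -> wft (relabel g t).
Proof.
elim/tree_nested_ind: t => //= r d m ch IH [sz hm hch]; rewrite size_map; split=> //.
by elim: ch IH hch {sz} => //= t ch IH [ht hts] [/ht h /(IH hts) h'].
Qed.

Lemma ntree_leaf : ntree 1 (Leaf 0 : tree). Proof. by []. Qed.

Lemma ntree_std n t : wft t -> uniq (leaves t) -> size (leaves t) = n ->
  ntree n (std t).
Proof.
move=> ht ul <-; split; first exact: wft_relabel.
rewrite leaves_relabel; move: (leaves t) ul => l ul.
suff -> : map (index^~ l) l = iota 0 (size l) by [].
apply: (@eq_from_nth _ 0%N); rewrite size_map ?size_iota // => i hi.
by rewrite (nth_map 0%N) // nth_iota // index_uniq.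
Qed.
End TreeBasics.

Section TreeRelations.
Variables (k : comPzRingType) (M : smod k).
Hypothesis sdeg_lin : forall r d a (m m' : M r),
  sdeg d m -> sdeg d m' -> sdeg d (a *: m + m').
Hypothesis sdeg_act : forall r d (g : 'S_r) (m : M r), sdeg d (sact g m) <-> sdeg d m.
Notation tree := (tree M).
Notation T := (free_smod M).
Implicit Types (t u : tree) (ch : seq tree) (s : fsum k tree).

(** Relations are homogeneous for well-formedness, labels and weight. Hence a
    functional that kills them still does when it is cut down to the monomials
    of one arity or of one weight. *)
Lemma trel_shape s : trel s -> exists (Wf : Prop) l w,
  each (fun p => [/\ wft p.2 <-> Wf, perm_eq (leaves p.2) l & weight p.2 = w.+1]) s.
Proof.
elim=> {s} [r d a m m' ch dm dm'|r d g m ch sz|r d m u v s _ [Wf [l [w IH]]]].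
- exists (size ch = r /\ each (@wft k M) ch), (flatten (map (@leaves k M) ch)).
  exists (sumn (map (@weight k M) ch)).
  have h (m0 : M r) : sdeg d m0 ->
      wft (Node d m0 ch) <-> size ch = r /\ each (@wft k M) ch.
    by move=> hm0; split=> [[]|[]].
  by do !(split; first by rewrite leaves_node weight_node; split=> //;
                           apply: h => //; apply: sdeg_lin).
- exists [/\ size ch = r, sdeg d m & each (@wft k M) ch].
  exists (flatten (map (@leaves k M) ch)), (sumn (map (@weight k M) ch)).
  have hp := pword_perm g; rewrite -[in iota _ _]sz in hp.
  split; first by rewrite leaves_node weight_node; split=> //=;
    split=> -[? /sdeg_act ? ?].
  split=> //; rewrite leaves_node weight_node; split.
  + rewrite /= size_map size_pword.
    have e := @each_args _ (@wft k M) (Leaf 0) _ _ hp.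
    by split=> -[? ? ?]; split=> //; apply/e.
  + have := @perm_args _ [:: 0%N] (map (@leaves k M) ch) (pword g).
    by rewrite size_map (map_args _ (Leaf 0) [:: 0%N] hp) => /(_ hp) /perm_flatten.
  + congr S; apply: perm_sumn.
    have := @perm_args _ 0%N (map (@weight k M) ch) (pword g).
    by rewrite size_map (map_args _ (Leaf 0) 0%N hp) => /(_ hp).
- exists ([/\ (size u + size v).+1 = r, sdeg d m, each (@wft k M) u, Wf
          & each (@wft k M) v]).
  exists (flatten (map (@leaves k M) u) ++ l ++ flatten (map (@leaves k M) v)).
  exists (sumn (map (@weight k M) u) + (w.+1 + sumn (map (@weight k M) v)))%N.
  apply/each_map; apply: each_impl IH => -[c t] /= [hw hl ht]; split.
  + rewrite size_cat /= addnS; split; first by case=> -> ? /each_cat[? [/hw ? ?]].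
    by case=> -> ? ? /hw ? ?; split=> //; apply/each_cat.
  + by rewrite leaves_node map_cat flatten_cat /= perm_cat2l perm_cat2r.
  + by rewrite weight_node map_cat sumn_cat /= ht.
Qed.

Lemma trel_ntree n s : trel s ->
  each (fun p => ntree n p.2) s \/ each (fun p => ~ ntree n p.2) s.
Proof.
move=> /trel_shape [Wf [l [w hs]]].
case: (pselect (Wf /\ perm_eq l (iota 0 n))) => [[hW hl]|no]; [left|right].
  apply: each_impl hs => p [/iffRL/(_ hW) hp hpl _]; split=> //.
  exact: perm_trans hpl hl.
apply: each_impl hs => p [hp hpl _] [/hp hW hl]; apply: no; split=> //.
by rewrite perm_sym in hpl; apply: perm_trans hpl hl.
Qed.

(** The operations on the module of trees are defined through a chosen
    representative; this is what makes them computable on a given one. *)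
Lemma fev_trep n (W : lmodType k) (f : tree -> W) s :
  (forall q, trel q -> each (fun p => ntree n p.2) q -> fev f q = 0) ->
  each (fun p => ntree n p.2) s ->
  fev f (trep (tcls (fun _ _ => False) n s)) = fev f s.
Proof.
move=> hf hs; rewrite /trep.
rewrite (fev_filter f (fun t => `[< ntree n t >])) prepP => [|q].
  by apply: fev_eq; apply: each_impl hs => p hp; rewrite asboolT.
case=> [[t [ht ->]]|hq|[]]; first by rewrite fev_cons fev_nil /= asboolF // scaler0 addr0.
have [nq|nq] := trel_ntree n hq.
  rewrite -(hf q) //; apply: fev_eq; apply: each_impl nq => p hp; exact: ifT (asboolT hp).
by apply: fev0; apply: each_impl nq => p hp; rewrite asboolF.
Qed.
End TreeRelations.

Section TreeClasses.
Variables (k : comPzRingType) (M : smod k) (J : nat -> fsum k (tree M) -> Prop).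
Implicit Types (t : tree M) (s : fsum k (tree M)).

Lemma tcls_rel n s : tmod_rel J n s -> tcls J n s = 0.
Proof. by move=> hs; apply/pclsP => W f hf; rewrite fev_nil hf. Qed.

Lemma tcls_cat n s s' : tcls J n (s ++ s') = tcls J n s + tcls J n s'.
Proof. by rewrite /tcls -paddE. Qed.

Lemma tcls_scale n a s : tcls J n [seq (a * p.1, p.2) | p <- s] = a *: tcls J n s.
Proof. by rewrite /tcls -pscaleE. Qed.

Lemma tcls_fev n s : tcls J n s = fev (fun t => tcls J n [:: (1, t)]) s.
Proof.
elim: s => [|[a t] s IH]; first by rewrite fev_nil.
by rewrite fev_cons -cat1s tcls_cat IH -tcls_scale /= mulr1.
Qed.

Lemma tcls_map n (Y : Type) (g : Y -> tree M) (s : fsum k Y) :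
  tcls J n [seq (p.1, g p.2) | p <- s] = fev (fun y => tcls J n [:: (1, g y)]) s.
Proof. by rewrite tcls_fev fev_map. Qed.
End TreeClasses.

Section Relabel.
Variables (k : comPzRingType) (M : smod k).
Notation tree := (tree M).

(** Relabelling the leaves does not move the vertices, so the Koszul signs of
    the relations stay the same. *)
Lemma trel_relabel g (s : fsum k tree) :
  trel s -> trel [seq (p.1, relabel g p.2) | p <- s].
Proof.
elim=> {s} [r d a m m' ch dm dm'|r d h m ch sz|r d m u v s _ IH].
- exact: trel_lin.
- have e : map (@tdeg k M) ch = map (@tdeg k M) (map (relabel g) ch).
    by rewrite -map_comp; apply: eq_map => t /=; rewrite tdeg_relabel.
  have hp := pword_perm h; rewrite -[in iota _ _]sz in hp.
  by rewrite /= e (map_args _ (Leaf 0) (Leaf 0) hp); apply: trel_act; rewrite size_map.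
- have -> : [seq (p.1, relabel g p.2) | p <- [seq (p.1, Node d m (u ++ p.2 :: v)) | p <- s]]
    = [seq (p.1, Node d m (map (relabel g) u ++ p.2 :: map (relabel g) v))
        | p <- [seq (p.1, relabel g p.2) | p <- s]].
    by rewrite -!map_comp; apply: eq_map => p /=; rewrite map_cat.
  exact: trel_ctx.
Qed.

Lemma ntree_relabel n (g : 'S_n) (t : tree) :
  ntree n t -> ntree n (relabel (nth 0%N (pword g)) t).
Proof.
case=> ht hl; split; first exact: wft_relabel.
rewrite leaves_relabel; apply: perm_trans (perm_map _ hl) _.
have := mkseq_nth 0%N (pword g); rewrite /mkseq size_pword => ->.
exact: pword_perm.
Qed.
End Relabel.

(** * The weight at most 1 part of the Koszul dual cooperad *)

Section LowWeight.
Variables (k : comPzRingType) (E : gsmod k).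
Notation ES := (gs_smod E).
Notation SE := (susp ES).
Notation T := (free_smod SE).

Lemma gs_act_homogE r d (g : 'S_r) (m : gs_mod E r) :
  homog d (gs_act g m) <-> homog d m.
Proof.
split; last exact: gs_act_homog.
by move/(@gs_act_homog _ _ _ (g^-1)%g _ _); rewrite -gs_actM mulVg gs_act1.
Qed.

Lemma susp_sdeg_lin r d a (m m' : SE r) : sdeg d m -> sdeg d m' -> sdeg d (a *: m + m').
Proof. exact: (@homog_lin _ _ (gs_mod E r)). Qed.

Lemma susp_sdeg_act r d (g : 'S_r) (m : SE r) : sdeg d (sact g m) <-> sdeg d m.
Proof. exact: gs_act_homogE. Qed.

Lemma each_ntree_relabel n (g : 'S_n) (s : fsum k (tree SE)) :
  each (fun p => ntree n p.2) s ->
  each (fun p => ntree n p.2) [seq (p.1, relabel (nth 0%N (pword g)) p.2) | p <- s].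
Proof. by move=> hs; apply/each_map; apply: each_impl hs => p; apply: ntree_relabel. Qed.

Lemma sact_tcls n (g : 'S_n) (s : fsum k (tree SE)) :
  each (fun p => ntree n p.2) s ->
  sact g (tcls _ n s : T n) =
  tcls _ n [seq (p.1, relabel (nth 0%N (pword g)) p.2) | p <- s].
Proof.
move=> hs; rewrite /= !tcls_map (fev_trep susp_sdeg_lin susp_sdeg_act) // => q hq _.
by rewrite -tcls_map; apply/tcls_rel/Or32/trel_relabel.
Qed.

(** Well defined since relations are homogeneous in the weight. *)
Lemma wcomp_tcls n w (s : fsum k (tree SE)) :
  each (fun p => ntree n p.2) s ->
  wcomp w (tcls _ n s : T n) = tcls _ n [seq p <- s | weight p.2 == w].
Proof.
move=> hs; rewrite /wcomp tcls_fev [RHS]tcls_fev.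
rewrite !(fev_filter _ (fun t => weight t == w))
  (fev_trep susp_sdeg_lin susp_sdeg_act) // => q hq _.
have [Wf [l [w' hq']]] := trel_shape susp_sdeg_lin susp_sdeg_act hq.
case: (eqVneq w'.+1 w) => [e|ne].
- rewrite -(tcls_rel (J := fun _ _ => False) (n := n) (s := q)); last exact: Or32.
  by rewrite tcls_fev; apply: fev_eq; apply: each_impl hq' => p [_ _ ->]; rewrite e eqxx.
- by apply: fev0; apply: each_impl hq' => p [_ _ ->]; rewrite (negbTE ne).
Qed.

(** The S-module I + sE inside the cofree cooperad on sE. *)
Definition low_weight n (x : T n) : Prop :=
  exists2 s, is_rep x s & each (fun p => weight p.2 <= 1)%N s.

Lemma low_weight_tree n (t : tree SE) : ntree n t -> (weight t <= 1)%N ->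
  low_weight (tcls _ n [:: (1, t)] : T n).
Proof. by case=> *; exists [:: (1, t)]; do !split. Qed.

Lemma sdeg_tree n (t : tree SE) : ntree n t -> sdeg (tdeg t) (tcls _ n [:: (1, t)] : T n).
Proof. by case=> *; exists [:: (1, t)]; do !split. Qed.

Lemma low_weight_graded_sub : graded_sub low_weight.
Proof.
move=> n; split.
- split; first by exists [::]; do !split.
  move=> a x y [s [hs <-] ws] [s' [hs' <-] ws'].
  exists ([seq (a * p.1, p.2) | p <- s] ++ s'); last first.
    by apply/each_cat; split=> //; apply/each_map.
  split; first by apply/each_cat; split=> //; apply/each_map.
  by rewrite -tcls_scale -tcls_cat.
- move=> g x [s [hs <-] ws]; rewrite sact_tcls //.
  exists [seq (p.1, relabel (nth 0%N (pword g)) p.2) | p <- s].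
    by split=> //; apply: each_ntree_relabel.
  by apply/each_map; apply: each_impl ws => p /=; rewrite weight_relabel.
- move=> x [s [hs <-] ws].
  exists [seq p.1 *: (tcls _ n [:: (1, p.2)] : T n) | p <- s].
  split; last by rewrite tcls_fev /fev big_map.
  apply/each_map; elim: s hs ws => //= -[a t] s IH [/= ht hs] [hw ws].
  split; last exact: IH.
  rewrite -tcls_scale; split.
    by case: ht => *; exists [:: (a * 1, t)]; do !split.
  by exists (tdeg t); case: ht => *; exists [:: (a * 1, t)]; do !split.
Qed.

Lemma ntree_leafE n i : ntree n (Leaf i : tree SE) -> n = 1%N /\ i = 0%N.
Proof.
case=> _; rewrite leaves_leaf => h.
have := perm_size h; rewrite size_iota => /= e; move: h; rewrite -e => /perm_mem/(_ 0%N).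
by rewrite !inE => /eqP <-.
Qed.

Lemma foldr_cuts_leaves (l : seq nat) :
  foldr (fun u acc =>
    [seq (p.1.1 * q.1.1 * sg k ((\sum_(v <- p.2) tdeg v) *
                                (\sum_(v <- q.1.2) tdeg v)),
          p.1.2 :: q.1.2, p.2 ++ q.2) | p <- cuts u, q <- acc])
    [:: (1, [::], [::])] (map Leaf l) =
  [:: (1, map Leaf l, map Leaf l) : k * seq (tree SE) * seq (tree SE)].
Proof.
elim: l => //= i l ->; rewrite /= big_seq1 tdeg_leaf mul0r sg0 !mulr1.
by [].
Qed.

Lemma cuts_corolla r d (m : SE r) (l : seq nat) :
  cuts (Node d m (map Leaf l)) =
  [:: (1, Leaf (head 0%N l), [:: Node d m (map Leaf l)]);
      (1, Node d m (map Leaf l), map Leaf l)].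
Proof. by rewrite /= foldr_cuts_leaves leaves_node leaves_corolla. Qed.

Lemma std_corolla r d (m : SE r) l : uniq l -> size l = r ->
  std (Node d m (map Leaf l)) = corolla d m.
Proof.
move=> ul sl; rewrite /std /corolla /= leaves_node leaves_corolla; congr Node.
rewrite -sl -map_comp.
apply: (@eq_from_nth _ (Leaf 0)); rewrite !size_map ?size_iota // => i hi.
by rewrite !(nth_map 0%N) ?size_iota //= nth_iota // index_uniq.
Qed.
Lemma std_leaf i : std (Leaf i : tree SE) = Leaf 0.
Proof. by rewrite /std /= eqxx. Qed.

Lemma corolla_tdeg r d (m : SE r) : tdeg (corolla d m) = d.
Proof. by rewrite tdeg_node tdeg_leaves addr0. Qed.
Lemma corolla_weight r d (m : SE r) : weight (corolla d m) = 1%N.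
Proof.
rewrite weight_node; congr S; rewrite -map_comp.
by elim: (iota 0 r) => //= i l ->.
Qed.
Lemma corolla_leaves r d (m : SE r) : leaves (corolla d m) = iota 0 r.
Proof. by rewrite leaves_node leaves_corolla. Qed.
Lemma ntree_corolla r d (m : SE r) : sdeg d m -> ntree r (corolla d m).
Proof.
move=> hm; split; last by rewrite corolla_leaves.
by split=> //; [rewrite size_map size_iota|apply: wft_leaves].
Qed.
End LowWeight.

Section Cuts.
Variables (k : comPzRingType) (E : gsmod k).
Notation ES := (gs_smod E).
Notation SE := (susp ES).
Notation T := (free_smod SE).
Implicit Types (t u l : tree SE) (ch : seq (tree T)).

Lemma wft_upper u : wft u -> uniq (leaves u) -> wft (upper u).
Proof.
move=> hu ul; split; rewrite ?size_map //; last exact: wft_leaves.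
rewrite -(tdeg_relabel (index^~ (leaves u))).
exact/sdeg_tree/ntree_std.
Qed.

Lemma wft_lower l ch : wft l -> uniq (leaves l) -> size (leaves l) = size ch ->
  each (@wft k T) ch -> wft (lower l ch).
Proof.
move=> hl ul sl hch; split=> //.
rewrite -(tdeg_relabel (index^~ (leaves l))).
exact/sdeg_tree/ntree_std.
Qed.

Lemma leaves_upper u : leaves (upper u) = leaves u.
Proof. by rewrite leaves_node leaves_corolla. Qed.

Lemma low_weight_std n u : wft u -> uniq (leaves u) -> size (leaves u) = n ->
  (weight u <= 1)%N -> low_weight (tcls _ n [:: (1, std u)] : T n).
Proof.
move=> hu ul su wu; apply: low_weight_tree; first exact: ntree_std.
by rewrite weight_relabel.
Qed.

Lemma all_dec_upper u : wft u -> uniq (leaves u) -> (weight u <= 1)%N ->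
  all_dec (M := T) (@low_weight k E) (upper u).
Proof.
move=> hu ul wu; split; first exact: low_weight_std.
by elim: (leaves u).
Qed.

Lemma ntree_cases n t : ntree n t -> (weight t <= 1)%N ->
  t = Leaf 0 /\ n = 1%N \/
  exists r d (m : SE r) (l : seq nat), [/\ t = Node d m (map Leaf l), n = r, uniq l,
                               perm_eq l (iota 0 n) & size l = r /\ sdeg d m].
Proof.
case: t => [i|r d m ch] ht; first by case/ntree_leafE: (ht) => -> ->; left.
rewrite weight_node ltnS leqn0 => /eqP/weight0_leaves[l e]; right.
case: ht; rewrite e leaves_node leaves_corolla /= size_map => -[sl hm _] hl.
exists r, d, m, l; split=> //; last by rewrite (perm_uniq hl) iota_uniq.
by rewrite -sl (perm_size hl) size_iota.
Qed.

(** A tree with at most one vertex can only be cut below or above that vertex,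
    so both levels of every cut have weight at most 1 again. *)
Lemma Delta_low n t : ntree n t -> (weight t <= 1)%N ->
  each (fun p => [/\ ntree n p.2, two_level p.2 & all_dec (M := T) (@low_weight k E) p.2])
    (Delta t).
Proof.
move=> ht wt; have [[-> ->]|[r [d [m [l [-> -> ul hl [sl hm]]]]]]] := ntree_cases ht wt.
  split=> //; split=> //.
  - split=> //; apply: wft_lower => //; split=> //; exact: (wft_upper (u := Leaf 0)).
  - by do !split; exact: (low_weight_std (u := Leaf 0)).
have ht' : wft (Node d m (map Leaf l)).
  by split; rewrite ?size_map //; apply: wft_leaves.
have et : leaves (Node d m (map Leaf l)) = l by rewrite leaves_node leaves_corolla.
have hwt : (weight (Node d m (map Leaf l)) <= 1)%N.
  by rewrite weight_node -map_comp; elim: (l).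
have hru : each (@wft k T) (map (@upper k SE) (map Leaf l)).
  by elim: (l) => //= i l' IH; split=> //; exact: (wft_upper (u := Leaf i)).
have hlu : flatten (map (@leaves k T) (map (@upper k SE) (map Leaf l))) = l.
  by elim: (l) => //= i l' ->.
rewrite /Delta cuts_corolla; split.
  split; [split| |].
  - apply: wft_lower => //=; split=> //; apply: wft_upper => //; by rewrite et.
  - by rewrite leaves_node /= cats0 leaves_upper et.
  - by rewrite /= andbT; elim: (leaves _).
  - split; first exact: (low_weight_std (u := Leaf _)).
    by split=> //; apply: all_dec_upper => //; rewrite et.
split=> //; split; [split| |].
- by apply: wft_lower => //; rewrite ?et ?size_map.
- by rewrite leaves_node hlu.
- by rewrite /=; elim: (l).
- split; first by apply: low_weight_std; rewrite ?et ?size_map.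
  by elim: (l) => //= i l' IH; split=> //; exact: (all_dec_upper (u := Leaf i)).
Qed.

Lemma low_weight_subcooperad : subcooperad (@low_weight k E).
Proof.
split; first exact: low_weight_graded_sub.
move=> n x [s hs ws]; exists (fbind (@Delta k SE) s).
have h : each (fun p => [/\ ntree n p.2, two_level p.2 &
    all_dec (M := T) (@low_weight k E) p.2]) (fbind (@Delta k SE) s).
  rewrite /fbind; apply/each_flatten/each_map.
  case: hs => hs _; elim: s hs ws => //= p s IH [hp hs] [wp ws]; split; last exact: IH.
  by apply/each_map; have := Delta_low hp wp; apply: each_impl.
split; last by apply: each_impl h => p [].
by exists s => //; split=> //; apply: each_impl h => p [].
Qed.
End Cuts.

Section KoszulDual.
Variables (k : comPzRingType) (E : gsmod k).
Notation ES := (gs_smod E).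
Notation SE := (susp ES).
Notation T := (free_smod SE).
Variable R : forall n, free_smod ES n -> Prop.
Hypothesis hR : quadratic_relations R.
Notation O := (quadratic_operad R).

(** The Koszul dual cooperad is the largest subcooperad whose weight 2 part lies
    in s^2 R, and in weight at most 1 this condition is empty. *)
Lemma KD_low n (x : T n) : low_weight x -> KD R x.
Proof.
move=> hx; exists (@low_weight k E); split=> //; first exact: low_weight_subcooperad.
move=> m y [s [hs <-] ws]; exists [::]; first by split=> //; case: hR => /(_ m) [[]].
rewrite wcomp_tcls //; congr (tcls _ _ _).
by elim: s ws {hs} => //= p s IH [wp /IH ->]; case: eqP wp => // ->.
Qed.

Lemma KD_tone : KD R (tone : T 1).
Proof. by apply/KD_low/low_weight_tree. Qed.

Lemma KD_sgen r e (mu : ES r) : homog e mu -> KD R (sgen e mu).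
Proof.
move=> hm; apply/KD_low/low_weight_tree; last by rewrite corolla_weight.
by apply: ntree_corolla; rewrite /= addrK.
Qed.

Lemma sdeg_tone : sdeg 0 (tone : T 1).
Proof. by rewrite -(tdeg_leaf SE 0); apply: sdeg_tree. Qed.

Lemma ntree_sgen r e (mu : ES r) : homog e mu -> ntree r (@corolla k SE r (e + 1) mu).
Proof. by move=> hm; apply: ntree_corolla; rewrite /= addrK. Qed.

Lemma sdeg_sgen r e (mu : ES r) : homog e mu -> sdeg (e + 1) (sgen e mu : T r).
Proof.
by move=> hm; rewrite -[e + 1](@corolla_tdeg _ _ r _ mu); apply/sdeg_tree/ntree_sgen.
Qed.

Lemma has_weight_tone : has_weight 0 (tone : T 1).
Proof. by exists [:: (1, Leaf 0)]; do !split. Qed.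

Lemma has_weight_sgen r e (mu : ES r) : homog e mu -> has_weight 1 (sgen e mu : T r).
Proof.
move=> hm; exists [:: (1, @corolla k SE r (e + 1) mu)]; last by rewrite /= corolla_weight.
by do 2!split=> //; apply: ntree_sgen.
Qed.

Lemma wcomp_sgen r e (mu : ES r) : homog e mu -> wcomp 1 (sgen e mu : T r) = sgen e mu.
Proof.
move=> hm; rewrite wcomp_tcls /=; first by rewrite corolla_weight.
by split=> //; apply: ntree_sgen.
Qed.

Lemma sdeg_gen r e (mu : ES r) : homog e mu -> sdeg e (gen R e mu).
Proof.
move=> hm; exists [:: (1, corolla e mu)]; last first.
  by split=> //; rewrite tdeg_node tdeg_leaves addr0.
do 2!split=> //; split; last by rewrite leaves_node leaves_corolla.
by split=> //; [rewrite size_map size_iota|apply: wft_leaves].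
Qed.

Lemma koszul0 dg l : (forall j, nth 0 dg j = 0) -> koszul dg l = 0.
Proof.
move=> h; rewrite /koszul big1 // => b _; rewrite big1 // => a _.
by rewrite h mul0r.
Qed.

(** Desuspension changes the degrees of the vertices and with them the Koszul
    signs of the relations in general. In weight 1 the subtrees that are permuted
    are leaves, of degree 0, so there are no signs. *)
Lemma kappa_tcls n (s : fsum k (tree SE)) : each (fun p => ntree n p.2) s ->
  kappa R (tcls _ n s : T n) =
  tcls _ n [seq (p.1, tmap (M := SE) (N := ES) (-1) (fun r m => m) p.2)
           | p <- s & weight p.2 == 1%N].
Proof.
move=> hs; rewrite /kappa !tcls_map.
rewrite !(fev_filter _ (fun t => weight t == 1%N)).
rewrite (fev_trep (@susp_sdeg_lin _ _) (@susp_sdeg_act _ _)) //.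
move=> q hq _; case: hq => {q} [r d a m m' ch dm dm'|r d g m ch sz|r d m u v q hq].
- rewrite /fev !big_cons big_nil /= !weight_node.
  case: eqP => [_|_]; last by rewrite !scaler0 !addr0.
  have := tcls_rel (J := ideal R) (n := n) (Or32 _ _ (trel_lin (M := ES) (d := d - 1)
    a (map (tmap (M := SE) (N := ES) (-1) (fun r m => m)) ch) dm dm')).
  by rewrite tcls_fev /fev !big_cons big_nil.
- have hp := pword_perm g; rewrite -[in iota _ _]sz in hp.
  have hsum : sumn (args 0%N (map (@weight k SE) ch) (pword g)) =
              sumn (map (@weight k SE) ch).
    by apply/perm_sumn/perm_args; rewrite size_map.
  rewrite /fev !big_cons big_nil /= !weight_node (map_args _ _ 0%N hp) hsum.
  case: eqP => [[/weight0_leaves[l e]]|_]; last by rewrite !scaler0 !addr0.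
  rewrite (map_args _ _ (Leaf 0) hp).
  have h (N : smod k) : koszul (map (@tdeg k N) (map Leaf l)) (pword g) = 0.
    by apply: koszul0; elim: (l) => [|i l' IH] [|j] //=; apply: tdeg_leaf.
  have el : map (tmap (M := SE) (N := ES) (-1) (fun r m => m)) ch = map Leaf l.
    by rewrite e -map_comp.
  have := tcls_rel (J := ideal R) (n := n) (Or32 _ _ (trel_act (M := ES) (d - 1) g
    m (ch := map (tmap (M := SE) (N := ES) (-1) (fun r m => m)) ch) _)).
  rewrite el !h e !h size_map; move: sz; rewrite e size_map => sz /(_ sz).
  by rewrite tcls_fev /fev !big_cons big_nil.
- have [Wf [l [w hw]]] := trel_shape (@susp_sdeg_lin _ _) (@susp_sdeg_act _ _) hq.
  rewrite (fev_map _ (fun t => Node d m (u ++ t :: v))).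
  apply: fev0; apply: each_impl hw => p [_ _ hp] /=.
  by rewrite weight_node map_cat sumn_cat /= hp addSn addnS.
Qed.

Lemma kappa_tone : kappa R (tone : T 1) = 0.
Proof. by rewrite kappa_tcls. Qed.

Lemma kappa_sgen r e (mu : ES r) : homog e mu -> kappa R (sgen e mu) = gen R e mu.
Proof.
move=> hm; rewrite kappa_tcls /=; last by split=> //; apply: ntree_sgen.
by rewrite corolla_weight /= addrK -map_comp.
Qed.
End KoszulDual.

(** * Decompositions of the unit and of the generators *)

Lemma koszul_iota dg n : koszul dg (iota 0 n) = 0.
Proof.
rewrite /koszul big1 // => b _; rewrite big_pred0 // => a.
have hb : (b < n)%N by rewrite -[X in (_ < X)%N](size_iota 0).
have ha := ltn_ord a.
by rewrite !nth_iota ?(ltn_trans ha) // !add0n ltnNge ltnW.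
Qed.

Lemma iota_split j n : (j < n)%N -> iota 0 j ++ j :: iota j.+1 (n - j.+1) = iota 0 n.
Proof.
by move=> hj; rewrite -[in RHS](subnKC hj) addSnnS iotaD.
Qed.

Section Decompositions.
Variables (k : comPzRingType) (E : gsmod k).
Notation ES := (gs_smod E).
Notation SE := (susp ES).
Notation T := (free_smod SE).
Variable R : forall n, free_smod ES n -> Prop.
Hypothesis hR : quadratic_relations R.
Implicit Types (u : tree SE) (l : seq nat).

Lemma std_sgen r e (mu : ES r) : std (@corolla k SE r (e + 1) mu) = @corolla k SE r (e + 1) mu.
Proof. by rewrite std_corolla ?iota_uniq ?size_iota. Qed.

Lemma upper_sgen r e (mu : ES r) :
  upper (@corolla k SE r (e + 1) mu) =
  @Node k T r (e + 1) (sgen e mu) (map Leaf (iota 0 r)).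
Proof.
by rewrite /upper std_sgen corolla_tdeg corolla_leaves size_iota.
Qed.

Lemma upper_leaf i : upper (Leaf i : tree SE) = @Node k T 1 0 tone [:: Leaf i].
Proof. by rewrite /upper std_leaf tdeg_leaf. Qed.

Lemma lower_leaf i (u : tree T) : lower (Leaf i : tree SE) [:: u] = @Node k T 1 0 tone [:: u].
Proof. by rewrite /lower std_leaf tdeg_leaf. Qed.

Lemma lower_sgen r e (mu : ES r) (ch : seq (tree T)) : size ch = r ->
  lower (@corolla k SE r (e + 1) mu) ch = @Node k T r (e + 1) (sgen e mu) ch.
Proof. by move=> sch; rewrite /lower std_sgen corolla_tdeg sch. Qed.

(** The monomial (s mu) o_j 1. *)
Definition grafted1 r e (mu : ES r) (j : nat) : tree T :=
  @Node k T r (e + 1) (sgen e mu)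
    (map Leaf (iota 0 j) ++ @Node k T 1 0 tone [:: Leaf j] ::
     map Leaf (iota j.+1 (r - j.+1))).

(** The corolla can be cut below its vertex, which gives 1 o_1 (s mu), or above it;
    in the second case each leaf in turn takes the unit. *)
Lemma Delta1_sgen r e (mu : ES r) :
  Delta1 (@corolla k SE r (e + 1) mu) =
  (1, @Node k T 1 0 tone [:: @Node k T r (e + 1) (sgen e mu) (map Leaf (iota 0 r))])
  :: [seq (1, grafted1 e mu j) | j <- iota 0 r].
Proof.
rewrite /Delta1 cuts_corolla /= lower_leaf upper_sgen cats0; congr cons.
rewrite size_map size_iota (@eq_in_filter _ _ predT) ?filter_predT; last first.
  move=> j _; apply/allP => i; rewrite mem_iota => /andP[_ hi].
  by rewrite (nth_map 0%N) ?size_iota // orbT.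
apply/eq_in_map => j; rewrite mem_iota => /andP[_ hj]; congr pair.
rewrite lower_sgen ?size_map ?size_iota // /grafted1; congr Node.
rewrite -[X in map _ X = _](iota_split hj) map_cat /=; congr (_ ++ _ :: _).
- apply/eq_in_map => i; rewrite mem_iota => /andP[_ hi].
  by rewrite (ltn_eqF hi) (nth_map 0%N) ?size_iota ?nth_iota // (ltn_trans hi).
- by rewrite eqxx (nth_map 0%N) ?size_iota // nth_iota // upper_leaf.
- apply/eq_in_map => i; rewrite mem_iota => /andP[hi hi'].
  have {}hi' : (i < r)%N by lia.
  by rewrite (gtn_eqF hi) (nth_map 0%N) ?size_iota // nth_iota.
Qed.

Lemma wft_tone (u : tree T) : wft u -> wft (@Node k T 1 0 tone [:: u]).
Proof. by split=> //; apply: sdeg_tone. Qed.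

Lemma wft_sgen r e (mu : ES r) (ch : seq (tree T)) : homog e mu -> size ch = r ->
  each (@wft k T) ch -> wft (@Node k T r (e + 1) (sgen e mu) ch).
Proof. by move=> hm sch hch; split=> //; apply: sdeg_sgen. Qed.

Lemma all_dec_leaves (C : forall n, T n -> Prop) l : each (all_dec (M := T) C) (map Leaf l).
Proof. by elim: l. Qed.

Lemma sumn_weight_leaves l : sumn (map (@weight k T) (map Leaf l)) = 0%N.
Proof. by elim: l. Qed.

Lemma fbind1 (X Y : Type) (F : X -> fsum k Y) x : fbind F [:: (1, x)] = F x.
Proof.
by rewrite /fbind /= cats0 -[RHS]map_id; apply: eq_map => -[a y]; rewrite mul1r.
Qed.

Lemma inf_rep_sgen r e (mu : ES r) : homog e mu ->
  inf_rep (KD R) (sgen e mu) (Delta1 (@corolla k SE r (e + 1) mu)).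
Proof.
move=> hm.
have h : each (fun p => [/\ ntree r p.2, weight p.2 = 2 & all_dec (M := T) (KD R) p.2])
    (Delta1 (@corolla k SE r (e + 1) mu)).
  rewrite Delta1_sgen; split.
    split; [split| |].
    - apply: wft_tone; apply: wft_sgen => //; last exact: wft_leaves.
      by rewrite size_map size_iota.
    - by rewrite !leaves_node /= leaves_node leaves_corolla cats0.
    - by rewrite !weight_node /= weight_node sumn_weight_leaves.
    - split; first exact: KD_tone.
      by do 2!split=> //; [apply: KD_sgen|apply: all_dec_leaves].
  apply/each_map/each_mem => j; rewrite mem_iota => /andP[_ hj].
  split; [split| |].
  - apply: wft_sgen => //.
      by rewrite size_cat /= !size_map !size_iota; lia.
    apply/each_cat; split; first exact: wft_leaves.
    by split; [apply: wft_tone|apply: wft_leaves].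
  - by rewrite leaves_node map_cat flatten_cat /= !leaves_corolla iota_split.
  - by rewrite weight_node map_cat sumn_cat /= !sumn_weight_leaves weight_node.
  - split; first exact: KD_sgen.
    apply/each_cat; split; first exact: all_dec_leaves.
    by split; [split; first exact: KD_tone|apply: all_dec_leaves].
split; last by apply: each_impl h => p [].
exists [:: (1, @corolla k SE r (e + 1) mu)]; first by do 2!split=> //; apply: ntree_sgen.
by split; [apply: each_impl h => p []|rewrite fbind1].
Qed.

Lemma inf_val_node (W : lmodType k) F r1 d1 (m1 : T r1) r2 d2 (m2 : T r2) l1 l l2 :
  inf_val (Y := W) F (Node d1 m1
    (map Leaf l1 ++ @Node k T r2 d2 m2 (map Leaf l) :: map Leaf l2)) =
  F r1 d1 m1 l1 r2 d2 m2 l l2.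
Proof.
have hl s : all (predC (predC (@is_leaf k T))) (map Leaf s) by elim: s.
rewrite /=.
have -> : find (predC (@is_leaf k T))
    (map Leaf l1 ++ @Node k T r2 d2 m2 (map Leaf l) :: map Leaf l2) = size l1.
  rewrite find_cat /= addn0 size_map.
  by have := hl l1; rewrite all_predC => /negbTE ->.
rewrite nth_cat size_map ltnn subnn /= take_size_cat ?size_map //.
by rewrite drop_cat size_map ltnNge leqnSn /= subSnn /= drop0 !leaves_corolla.
Qed.

Lemma fev_inf_sgen (W : lmodType k) F r e (mu : ES r) :
  fev (inf_val (Y := W) F) (Delta1 (@corolla k SE r (e + 1) mu)) =
  F 1%N 0 tone [::] r (e + 1) (sgen e mu) (iota 0 r) [::] +
  \sum_(j < r) F r (e + 1) (sgen e mu) (iota 0 j) 1%N 0 tone [:: val j]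
                 (iota j.+1 (r - j.+1)).
Proof.
rewrite Delta1_sgen fev_cons scale1r (inf_val_node F _ _ _ _ [::] _ [::]); congr (_ + _).
rewrite /fev big_map -[r in iota 0 r]subn0 big_mkord; apply: eq_bigr => j _.
by rewrite scale1r; exact: (inf_val_node F _ _ _ _ _ [:: _] _).
Qed.

Lemma Delta1_tone :
  Delta1 (Leaf 0 : tree SE) = [:: (1, @Node k T 1 0 tone [:: @Node k T 1 0 tone [:: Leaf 0]])].
Proof. by rewrite /Delta1 /= lower_leaf upper_leaf. Qed.

Lemma inf_rep_tone : inf_rep (KD R) (tone : T 1) (Delta1 (Leaf 0 : tree SE)).
Proof.
have h : each (fun p => [/\ ntree 1 p.2, weight p.2 = 2 & all_dec (M := T) (KD R) p.2])
    (Delta1 (Leaf 0 : tree SE)).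
  rewrite Delta1_tone; split=> //; split=> //.
  - by split=> //; do 2!apply: wft_tone.
  - by do !split; apply: KD_tone.
split; last by apply: each_impl h => p [].
exists [:: (1, Leaf 0)]; first by do !split.
by split; [apply: each_impl h => p []|rewrite fbind1].
Qed.

Lemma fev_inf_tone (W : lmodType k) F :
  fev (inf_val (Y := W) F) (Delta1 (Leaf 0 : tree SE)) =
  F 1%N 0 tone [::] 1%N 0 tone [:: 0%N] [::].
Proof.
by rewrite Delta1_tone fev_cons fev_nil scale1r addr0 (inf_val_node F _ _ _ _ [::] [:: _] [::]).
Qed.

(** The same two cuts, now with a unit on every leaf in the second case. *)
Lemma Delta_sgen r e (mu : ES r) :
  Delta (@corolla k SE r (e + 1) mu) =
  [:: (1, @Node k T 1 0 tone [:: @Node k T r (e + 1) (sgen e mu) (map Leaf (iota 0 r))]);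
      (1, @Node k T r (e + 1) (sgen e mu)
            [seq @Node k T 1 0 tone [:: Leaf i] | i <- iota 0 r])].
Proof.
rewrite /Delta cuts_corolla /= lower_leaf upper_sgen lower_sgen ?size_map ?size_iota //.
by congr [:: _; (_, Node _ _ _)]; rewrite -map_comp; apply: eq_map => i /=; rewrite upper_leaf.
Qed.

Lemma full_rep_tree n (t : tree SE) : ntree n t -> (weight t <= 1)%N ->
  full_rep (KD R) (tcls _ n [:: (1, t)] : T n) (Delta t).
Proof.
move=> ht wt; have h := Delta_low ht wt.
have hl (u : tree T) : all_dec (M := T) (@low_weight k E) u -> all_dec (M := T) (KD R) u.
  elim/tree_nested_ind: u => //= r d m ch IH [hm hch]; split; first exact: KD_low.
  by elim: ch IH hch => //= u ch IH' [hu hch] [/hu ? /IH']; split=> //; auto.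
split; last by apply: each_impl h => p [_ ? /hl].
exists [:: (1, t)]; first by do 2!split=> //.
by split; [apply: each_impl h => p []|rewrite fbind1].
Qed.

(** The unit has degree 0 and the leaves are in order, so no sign remains. *)
Lemma fev_full_sgen (A B : lmodType k) (phi : forall r, T r -> seq B -> B)
    (f : forall r, T r -> seq A -> B) dg (x : seq A) r e (mu : ES r) : size x = r ->
  fev (full_val phi f dg x) (Delta (@corolla k SE r (e + 1) mu)) =
  phi 1%N tone [:: f r (sgen e mu) x] +
  phi r (sgen e mu) (map (fun y => f 1%N tone [:: y]) x).
Proof.
move=> sx; rewrite Delta_sgen !fev_cons fev_nil addr0 !scale1r; congr (_ + _).
  rewrite /full_val leaves_node /= leaves_node leaves_corolla cats0 koszul_iota.
  rewrite big_ord_recl big_ord0 /= big_nil mulr0 !addr0 sg0 scale1r.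
  by have := mkseq_nth 0 x; rewrite /args /mkseq sx => ->.
rewrite /full_val /=.
have -> : leaves (@Node k T r (e + 1) (sgen e mu)
    [seq @Node k T 1 0 tone [:: Leaf i] | i <- iota 0 r]) = iota 0 r.
  by rewrite leaves_node; elim: (iota 0 r) => //= i l ->.
rewrite koszul_iota add0r big1 ?scale1r; last first.
  move=> j _; rewrite (nth_map 0%N) ?tdeg_node /= ?tdeg_leaf.
    by rewrite big_seq1 add0r mul0r.
  by apply: leq_trans (ltn_ord j) _; rewrite size_map.
by congr phi; rewrite -map_comp -[in RHS](mkseq_nth 0 x) /mkseq -map_comp sx.
Qed.

Lemma fev_full_tone (A B : lmodType k) (phi : forall r, T r -> seq B -> B)
    (f : forall r, T r -> seq A -> B) dg (x : A) :
  fev (full_val phi f dg [:: x]) (Delta (Leaf 0 : tree SE)) =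
  phi 1%N tone [:: f 1%N tone [:: x]].
Proof.
rewrite /Delta /= lower_leaf upper_leaf fev_cons fev_nil addr0 !scale1r /full_val /=.
rewrite (koszul_iota dg 1) big_ord_recl big_ord0 /= big_nil mulr0 !addr0 sg0 scale1r.
by [].
Qed.
End Decompositions.

(** * Multilinear operations on families of arguments *)

(** Arguments are families F : nat -> X read off on 0, ..., r - 1. Replacing one
    entry then is a pointwise operation, and replacements in different slots
    commute up to extensional equality. *)
Definition upd (T : Type) (F : nat -> T) (i : nat) (a : T) : nat -> T :=
  fun j => if j == i then a else F j.

Section Upd.
Variable T : Type.
Implicit Types (F G : nat -> T).

Lemma updE F i a : upd F i a i = a. Proof. by rewrite /upd eqxx. Qed.
Lemma upd_ne F i a j : j != i -> upd F i a j = F j.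
Proof. by rewrite /upd => /negbTE ->. Qed.

Lemma eq_mkseq_lt F G r : (forall j, (j < r)%N -> F j = G j) -> mkseq F r = mkseq G r.
Proof. by move=> h; apply/eq_in_map => j; rewrite mem_iota => /andP[_ /h]. Qed.

Lemma mkseq_upd_id F i r : mkseq (upd F i (F i)) r = mkseq F r.
Proof. by apply: eq_mkseq_lt => j _; rewrite /upd; case: eqP => // ->. Qed.

Lemma set_nth_mkseq x0 F r i a : (i < r)%N ->
  set_nth x0 (mkseq F r) i a = mkseq (upd F i a) r.
Proof.
move=> hi; apply: (@eq_from_nth _ x0).
  by rewrite size_set_nth !size_mkseq; apply/maxn_idPr.
move=> j; rewrite size_set_nth size_mkseq (maxn_idPr _) // => hj.
by rewrite nth_set_nth /= !nth_mkseq.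
Qed.

Lemma mkseq_upd_split F r i a : (i < r)%N ->
  mkseq (upd F i a) r = mkseq F i ++ a :: [seq F j | j <- iota i.+1 (r - i.+1)].
Proof.
move=> hi; rewrite /mkseq -(iota_split hi) map_cat /= updE; congr (_ ++ _ :: _).
- by apply/eq_in_map => j; rewrite mem_iota => /andP[_ hj]; rewrite upd_ne // neq_ltn hj.
- by apply/eq_in_map => j; rewrite mem_iota => /andP[hj _]; rewrite upd_ne // neq_ltn hj orbT.
Qed.

Lemma args_upd x0 F r j a : (j < r)%N ->
  args x0 (mkseq F r) (iota 0 j) ++ a :: args x0 (mkseq F r) (iota j.+1 (r - j.+1)) =
  mkseq (upd F j a) r.
Proof.
move=> hj; rewrite mkseq_upd_split //; congr (_ ++ _ :: _); apply/eq_in_map => l.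
  by rewrite mem_iota => /andP[_ hl]; rewrite nth_mkseq // (ltn_trans hl).
by rewrite mem_iota => /andP[_ hl]; rewrite nth_mkseq // -(subnKC hj).
Qed.

Lemma args_iota x0 (s : seq T) : args x0 s (iota 0 (size s)) = s.
Proof. exact: mkseq_nth. Qed.
End Upd.

Section Multilinear.
Variables (k : comPzRingType) (X Y : lmodType k) (r : nat) (g : seq X -> Y).
Hypothesis hg : multilinear r g.
Implicit Types (F : nat -> X).

Lemma mlin F i c a b : (i < r)%N ->
  g (mkseq (upd F i (c *: a + b)) r) =
  c *: g (mkseq (upd F i a) r) + g (mkseq (upd F i b) r).
Proof.
move=> hi; rewrite !mkseq_upd_split //; apply: hg.
by rewrite size_mkseq size_map size_iota; lia.
Qed.

Lemma mlin0 F i : (i < r)%N -> g (mkseq (upd F i 0) r) = 0.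
Proof.
move=> hi; have := mlin F (-1) (0 : X) 0 hi.
by rewrite scaler0 addr0 scaleN1r addNr.
Qed.

Lemma mlinZ F i c a : (i < r)%N ->
  g (mkseq (upd F i (c *: a)) r) = c *: g (mkseq (upd F i a) r).
Proof. by move=> hi; rewrite -[c *: a]addr0 mlin // mlin0 // addr0. Qed.

Lemma mlinD F i a b : (i < r)%N ->
  g (mkseq (upd F i (a + b)) r) = g (mkseq (upd F i a) r) + g (mkseq (upd F i b) r).
Proof. by move=> hi; rewrite -[a]scale1r mlin // !scale1r. Qed.

Lemma mlinB F i a b : (i < r)%N ->
  g (mkseq (upd F i (a - b)) r) = g (mkseq (upd F i a) r) - g (mkseq (upd F i b) r).
Proof. by move=> hi; rewrite mlinD // -scaleN1r mlinZ // scaleN1r. Qed.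

(** Carries statements over from homogeneous arguments, the only ones for which
    the signs of the structure equations make sense, to arbitrary arguments. *)
Lemma multilinear_span (B : Y -> Prop) (P : nat -> X -> Prop) :
  B 0 -> (forall a b, B a -> B b -> B (a + b)) ->
  (forall F, (forall l, (l < r)%N -> P l (F l)) -> B (g (mkseq F r))) ->
  forall F, (forall l, (l < r)%N -> exists s, (forall y, y \in s -> P l y) /\
                                              F l = \sum_(y <- s) y) ->
  B (g (mkseq F r)).
Proof.
move=> B0 BD hP.
suff h m F : (m <= r)%N ->
    (forall l, (l < m)%N -> exists s, (forall y, y \in s -> P l y) /\
                                      F l = \sum_(y <- s) y) ->
    (forall l, (m <= l < r)%N -> P l (F l)) -> B (g (mkseq F r)).
  by move=> F hF; apply: (h r) => // l /andP[hl /(leq_ltn_trans hl)]; rewrite ltnn.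
elim: m F => [|m IH] F hm h1 h2; first by apply: hP => l; apply: h2.
have [s [hs e]] := h1 m (ltnSn m).
rewrite -(mkseq_upd_id F m) e.
elim: s hs {e} => [|y s IHs] hs; first by rewrite big_nil mlin0.
rewrite big_cons mlinD //; apply: BD; last first.
  by apply: IHs => y' hy'; apply: hs; rewrite inE hy' orbT.
apply: IH => [|l hl|l /andP[hl hlr]]; first exact: ltnW.
- by rewrite upd_ne ?ltn_eqF //; apply/h1/ltnW.
- case: (eqVneq l m) => [->|ne]; first by rewrite updE; apply: hs; rewrite mem_head.
  by rewrite upd_ne //; apply: h2; rewrite hlr ltn_neqAle eq_sym ne hl.
Qed.
End Multilinear.

Section PartialSums.
Lemma psum_mkseq (N : nat -> int) r i : (i <= r)%N ->
  psum (mkseq N r) i = \sum_(0 <= l < i) N l.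
Proof.
move=> hi; rewrite /psum /mkseq -map_take take_iota (minn_idPl hi) big_map.
by rewrite /index_iota subn0.
Qed.

(** Raising the degree of the i-th argument by 1 is felt by the signs of the
    later slots only. *)
Lemma psum_upd (N : nat -> int) i j :
  \sum_(0 <= l < j) upd N i (N i + 1) l = \sum_(0 <= l < j) N l + (i < j)%N%:R.
Proof.
elim: j => [|j IH]; first by rewrite !big_geq.
rewrite !big_nat_recr //= IH ltnS /upd.
case: ltngtP => [h|h|->] /=; first exact: addrAC.
- by rewrite !addr0.
- by rewrite addr0 addrA.
Qed.

Lemma sum_upd r (N : nat -> int) i c : (i < r)%N ->
  \sum_(l < r) upd N i (N i + c) l = \sum_(l < r) N l + c.
Proof.
move=> hi; rewrite (bigD1 (Ordinal hi)) //= [in RHS](bigD1 (Ordinal hi)) //= updE.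
rewrite addrAC; congr (_ + _ + _); apply: eq_bigr => l; rewrite -val_eqE /= => ne.
by rewrite upd_ne.
Qed.

Lemma sum_mkseq r (N : nat -> int) : \sum_(l <- mkseq N r) l = \sum_(l < r) N l.
Proof.
by rewrite /mkseq big_map -(big_mkord predT (fun l => N l)) /index_iota subn0.
Qed.
End PartialSums.

Lemma bdry_mkseq (k : comPzRingType) (X Y : lmodType k) (dX : X -> X) (dY : Y -> Y)
    n r (N : nat -> int) (g : seq X -> Y) (F : nat -> X) :
  bdry dX dY n (mkseq N r) g (mkseq F r) =
  dY (g (mkseq F r)) - sg k n *:
    \sum_(i < r) sg k (\sum_(0 <= l < i) N l) *: g (mkseq (upd F i (dX (F i))) r).
Proof.
rewrite /bdry; congr (_ - _ *: _).
rewrite -(big_mkord predT (fun i => sg k (psum (mkseq N r) i) *: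
  g (set_nth 0 (mkseq F r) i (dX (nth 0 (mkseq F r) i))))) size_mkseq big_mkord.
apply: eq_bigr => i _; rewrite psum_mkseq 1?ltnW // set_nth_mkseq //.
by rewrite nth_mkseq.
Qed.

Lemma homs_mkseq (k : comPzRingType) (T : lmodType k) (I : eqType)
    (D : I -> T -> Prop) i0 (N : nat -> I) (F : nat -> T) r :
  (forall l, (l < r)%N -> D (N l) (F l)) -> homs D i0 (mkseq N r) (mkseq F r).
Proof.
by move=> h; split=> [|j]; rewrite !size_mkseq // => hj; rewrite !nth_mkseq //; apply: h.
Qed.

(** * Operations on the homology of a differential graded algebra *)

Section DgAlgebra.
Variables (k : comPzRingType) (E : gsmod k).
Notation ES := (gs_smod E).
Variable R : forall n, free_smod ES n -> Prop.
Notation O := (quadratic_operad R).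
Variable A : dg_algebra R.
Notation d := (@dga_d _ _ _ A).
Notation dlin := (@dga_d_linear _ _ _ A).
Implicit Types (F : nat -> A).

(** The differential is homogeneous, so it vanishes on each component of a cycle. *)
Lemma gpr_cycle i (x : A) : d x = 0 -> d (gpr i x) = 0.
Proof.
move=> hx; have [s [us e]] := gpr_sum x.
have hd j : homog (j - 1) (d (gpr j x)) by apply/dga_d_homog/homog_gpr.
have h0 : gpr (i - 1) (d x) = 0 by rewrite hx gpr0.
move: h0; rewrite {1}e (is_linear_sum dlin) (is_linear_sum (@gpr_is_linear _ _ _ _)).
have [hi|hi] := boolP (i \in s).
  rewrite (bigD1_seq i) //= big1 ?addr0 => [|j ne]; first by rewrite (hd i).
  rewrite (gpr_homog _ (hd j)) ifF //; apply: contra_neqF ne => /eqP/addIr.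
  by move=> ->.
move=> _; rewrite e (is_linear_sum (@gpr_is_linear _ _ _ _)) big1_seq ?(is_linear0 dlin) //.
move=> j /= hj; rewrite gpr_gpr ifF //; apply: contraNF hi => /eqP ->.
by [].
Qed.

Lemma cycle_span (x : A) : d x = 0 ->
  exists s, (forall y, y \in s -> d y = 0 /\ exists n, homog n y) /\ x = \sum_(y <- s) y.
Proof.
move=> hx; have [s [_ e]] := gpr_sum x; exists [seq gpr i x | i <- s].
split; last by rewrite big_map.
move=> y /mapP[i _ ->]; split; first exact: gpr_cycle.
by exists i; apply: homog_gpr.
Qed.

Lemma boundary_span (x : A) :
  exists s, (forall y, y \in s -> exists n w, homog n w /\ y = d w) /\ d x = \sum_(y <- s) y.
Proof.
have [s [_ e]] := gpr_sum x; exists [seq d (gpr i x) | i <- s].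
split; last by rewrite big_map {1}e (is_linear_sum dlin).
by move=> y /mapP[i _ ->]; exists i, (gpr i x); split=> //; apply: homog_gpr.
Qed.

Section Operation.
Variables (r : nat) (e : int) (a : O r).
Hypothesis ha : sdeg e a.

Lemma op_multilinear : multilinear r (dga_op a : seq A -> A).
Proof. by have [_ h _ _] := dga_op_family A; apply: h. Qed.
Let op_mlin := op_multilinear.

Lemma d_op (N : nat -> int) F : (forall l, (l < r)%N -> homog (N l) (F l)) ->
  d (dga_op a (mkseq F r)) =
  sg k e *: \sum_(i < r) sg k (\sum_(0 <= l < i) N l) *:
              dga_op a (mkseq (upd F i (d (F i))) r).
Proof.
move=> hF; apply/subr0_eq; rewrite -bdry_mkseq.
by apply: dga_op_d; rewrite ?size_mkseq //; apply: homs_mkseq.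
Qed.

Lemma op_cycle F : (forall l, (l < r)%N -> d (F l) = 0) -> d (dga_op a (mkseq F r)) = 0.
Proof.
move=> hF; apply: (multilinear_span op_mlin (B := fun x => d x = 0)
    (P := fun _ y => d y = 0 /\ exists n, homog n y)).
- exact: is_linear0 dlin.
- by move=> x y hx hy; rewrite (is_linearD dlin) hx hy addr0.
- move=> G hG; have [N hN] : exists N : nat -> int, forall l, (l < r)%N -> homog (N l) (G l).
    have h l : exists n : int, (l < r)%N -> homog n (G l).
      by case: ltnP => [/hG[_ [n hn]]|_]; [exists n|exists 0].
    by have [N hN] := choice h; exists N.
  rewrite (d_op hN) big1 ?scaler0 // => i _; have [-> _] := hG _ (ltn_ord i).
  by rewrite mlin0 // scaler0.
- by move=> l /hF /cycle_span.
Qed.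

(** Boundaries form an ideal among the cycles. For homogeneous arguments this is
    the Leibniz rule; the general case is needed because representatives of
    homology classes are chosen without regard to the grading. *)
Lemma op_boundary F i w : (i < r)%N ->
  (forall l, (l < r)%N -> l != i -> d (F l) = 0) ->
  exists w', dga_op a (mkseq (upd F i (d w)) r) = d w'.
Proof.
move=> hi hF; apply: (multilinear_span op_mlin (B := fun x => exists w', x = d w')
    (P := fun l y => if l == i then exists n w, homog n w /\ y = d w
                     else d y = 0 /\ exists n, homog n y)).
- by exists 0; rewrite (is_linear0 dlin).
- by move=> _ _ [x ->] [y ->]; exists (x + y); rewrite (is_linearD dlin).
- move=> G hG; have [N [W [hN hW]]] : exists (N : nat -> int) (W : nat -> A),
      (forall l, (l < r)%N -> homog (N l) (W l)) /\
      (forall l, (l < r)%N -> if l == i then G l = d (W l) else d (G l) = 0 /\ G l = W l).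
    have h l : exists nw : int * A, (l < r)%N -> homog nw.1 nw.2 /\
        if l == i then G l = d nw.2 else d (G l) = 0 /\ G l = nw.2.
      case: ltnP => [/hG|_]; last by exists (0, 0).
      case: eqP => _; first by move=> [n [w' [hn ->]]]; exists (n, w').
      by move=> [h [n hn]]; exists (n, G l).
    have [f hf] := choice h; exists (fun l => (f l).1), (fun l => (f l).2).
    by split=> l /hf [].
  pose s := sg k e * sg k (\sum_(0 <= l < i) N l).
  exists (s *: dga_op a (mkseq W r)).
  rewrite (is_linearZ dlin) (d_op hN) (bigD1 (Ordinal hi)) //= [X in _ + X]big1 ?addr0.
    rewrite !scalerA.
    have -> : s * (sg k e * sg k (\sum_(0 <= l < i) N l)) = 1 by rewrite -/s /s mulrACA !sgK mulr1.
    rewrite scale1r; congr dga_op; apply: eq_mkseq_lt => l hl; have := hW l hl.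
    by rewrite /upd; case: eqP => [->|_ []].
  move=> j ne; have := hW j (ltn_ord j); rewrite ifF; last first.
    by apply: contra_neqF ne => /eqP h; apply/val_inj.
  by move=> [h hj]; rewrite -hj h (mlin0 op_mlin) // scaler0.
- move=> l hl; rewrite /upd; case: eqP => h; first exact: boundary_span.
  by apply/cycle_span/hF => //; apply/eqP.
Qed.
End Operation.
End DgAlgebra.

Section Span.
Variables (k : comPzRingType) (V : lmodType k).

Lemma span_min (S P : V -> Prop) : is_submod P -> (forall x, S x -> P x) ->
  forall x, Defs.span S x -> P x.
Proof. by move=> [P0 Pl] h x; elim=> // a u v /h Pu _ Pv; apply: Pl. Qed.

Lemma span_is_submod (S : V -> Prop) : is_submod (Defs.span S).
Proof.
split=> [|a x y hx hy]; first exact: span0.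
have [_ h] := span_submod S; have := h a x y; rewrite !inE.
by move=> /(_ (asboolT hx) (asboolT hy)) /asboolP.
Qed.

Lemma span_gen (S : V -> Prop) x : S x -> Defs.span S x.
Proof. by move=> h; rewrite -[x]scale1r -[_ *: x]addr0; apply: spanS => //; apply: span0. Qed.
End Span.

Section Homology.
Variables (k : comPzRingType) (E : gsmod k).
Notation ES := (gs_smod E).
Variable R : forall n, free_smod ES n -> Prop.
Notation O := (quadratic_operad R).
Variable A : dg_algebra R.
Notation d := (@dga_d _ _ _ A).
Notation dlin := (@dga_d_linear _ _ _ A).
Notation H := (homology A).

Lemma cyclesP (z : A) :
  reflect (d z = 0) (z \in [pred x | `[< Defs.span (fun x : A => d x = 0) x >]]).
Proof.
apply: (iffP (asboolP _)) => [|h]; last exact: span_gen.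
apply: (span_min (P := fun z : A => d z = 0)) => //.
split; first exact: is_linear0 dlin.
by move=> a x y hx hy; rewrite dlin hx hy scaler0 addr0.
Qed.

Lemma cycles_valK (z : A) : d z = 0 -> subm_val (insubd (0 : cycles A) z) = z.
Proof. by move=> /cyclesP hz; apply: (insubdK (0 : cycles A)). Qed.

Lemma cycles_val_lin : is_linear (fun z : cycles A => subm_val z).
Proof. by move=> a x y; apply: (linearP (val : cycles A -> A)). Qed.

Lemma hcls_eq (z z' : A) : d z = 0 -> d z' = 0 ->
  hcls z = hcls z' <-> exists w, z - z' = d w.
Proof.
move=> hz hz'; rewrite /hcls qclsP.
have -> : (exists w, z - z' = d w) <->
  exists w, subm_val (insubd (0 : cycles A) z - insubd (0 : cycles A) z') = d w.
  have -> : subm_val (insubd (0 : cycles A) z - insubd (0 : cycles A) z') = z - z'.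
    by rewrite (is_linearB cycles_val_lin) !cycles_valK.
  by [].
split; last by move=> h; apply: span_gen.
apply: (span_min (P := fun z : cycles A => exists w, subm_val z = d w)) => //.
split; first by exists 0; rewrite (is_linear0 dlin).
move=> a x y [w hw] [w' hw']; exists (a *: w + w'); rewrite dlin -hw -hw'.
exact: cycles_val_lin.
Qed.

Lemma hcls_lin a (z z' : A) : d z = 0 -> d z' = 0 ->
  hcls (a *: z + z') = a *: hcls z + hcls z'.
Proof.
move=> hz hz'; rewrite -[RHS]/(qadd (qscale a (hcls z)) (hcls z')) /hcls qscaleE qaddE.
congr qcls; apply: val_inj => /=.
rewrite [RHS]cycles_val_lin.
by rewrite !cycles_valK // dlin hz hz' scaler0 addr0.
Qed.

Lemma hcls0 : hcls (0 : A) = 0.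
Proof.
have h := is_linear0 dlin; have := hcls_lin (-1) h h.
by rewrite scaler0 addr0 scaleN1r addNr.
Qed.

Lemma hclsZ a (z : A) : d z = 0 -> hcls (a *: z) = a *: hcls z.
Proof.
move=> hz; rewrite -[a *: z]addr0 hcls_lin ?hcls0 ?addr0 //; exact: is_linear0 dlin.
Qed.

Lemma hclsD (z z' : A) : d z = 0 -> d z' = 0 -> hcls (z + z') = hcls z + hcls z'.
Proof. by move=> hz hz'; rewrite -[z]scale1r hcls_lin // !scale1r. Qed.

Lemma hcls_sum (I : Type) (s : seq I) (F : I -> A) : (forall i, d (F i) = 0) ->
  hcls (\sum_(i <- s) F i) = \sum_(i <- s) hcls (F i).
Proof.
move=> hF; elim: s => [|i s IH]; first by rewrite !big_nil hcls0.
rewrite !big_cons hclsD ?IH // (is_linear_sum dlin) big1 //.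
Qed.

Lemma hcls_boundary (w : A) : hcls (d w) = 0.
Proof.
rewrite -hcls0; apply/(hcls_eq (dga_dd w) (is_linear0 dlin)).
by exists w; rewrite subr0.
Qed.

Lemma hrep_cycle (h : H) : d (hrep h) = 0.
Proof. exact/cyclesP/(valP (qrep h)). Qed.

Lemma hrepK (h : H) : hcls (hrep h) = h.
Proof. by rewrite /hcls /hrep (valKd (0 : cycles A)) qrepK. Qed.

Section HomologyOperation.
Variables (r : nat) (e : int) (a : O r).
Hypothesis ha : sdeg e a.
Let op_mlin := @op_multilinear _ _ _ A _ a.

(** Exchange the chosen representatives for the given ones slot by slot; each
    exchange changes the value by a boundary. *)
Lemma hop_hcls (F : nat -> A) : (forall l, (l < r)%N -> d (F l) = 0) ->
  hop a (mkseq (fun l => hcls (F l)) r) = hcls (dga_op a (mkseq F r)).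
Proof.
move=> hF; rewrite /hop /mkseq -map_comp -/(mkseq _ _).
pose G m l := if (l < m)%N then hrep (hcls (F l)) else F l.
have hG m l : (l < r)%N -> d (G m l) = 0.
  by rewrite /G; case: ifP => // _ /hF h; [apply: hrep_cycle|].
suff h m : (m <= r)%N ->
    hcls (dga_op a (mkseq (G m) r)) = hcls (dga_op a (mkseq F r)).
  rewrite -(h r) //; congr (hcls (dga_op _ _)); apply: eq_mkseq_lt => l hl.
  by rewrite /G /= hl.
elim: m => [|m IH] hm; first by congr (hcls (dga_op _ _)); apply: eq_mkseq_lt.
rewrite -IH ?(ltnW hm) //; apply/hcls_eq; [exact/(op_cycle ha)/hG..|].
have [w hw] : exists w, G m.+1 m - G m m = d w.
  apply/hcls_eq; rewrite ?hG //.
  by rewrite /G ltnSn ltnn hrepK.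
have -> : mkseq (G m.+1) r = mkseq (upd (G m) m (G m.+1 m)) r.
  apply: eq_mkseq_lt => l hl; rewrite /upd; case: eqP => [->//|/eqP ne].
  by rewrite /G ltnS leq_eqVlt (negbTE ne).
rewrite -[X in _ - dga_op a X](mkseq_upd_id (G m) m) -(mlinB op_mlin) // hw.
by apply: (op_boundary ha) => // l hl _; apply: hG.
Qed.

Lemma hop_eq0 (G : nat -> H) i : (i < r)%N -> G i = 0 -> hop a (mkseq G r) = 0.
Proof.
move=> hi h0; pose F := upd (fun l => hrep (G l)) i 0.
have hF l : d (F l) = 0.
  by rewrite /F /upd; case: eqP => _; [apply: is_linear0 dlin|apply: hrep_cycle].
have -> : mkseq G r = mkseq (fun l => hcls (F l)) r.
  apply: eq_mkseq_lt => l _; rewrite /F /upd; case: eqP => [->|_].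
    by rewrite hcls0 h0.
  by rewrite hrepK.
by rewrite hop_hcls // mlin0 ?hcls0.
Qed.

(** Its class is the torsion Massey product. *)
Definition msum (N : nat -> int) (y z : nat -> A) : A :=
  \sum_(i < r) sg k (e + \sum_(0 <= l < i) N l) *: dga_op a (mkseq (upd y i (z i)) r).

Lemma eq_msum N y z y' z' : (forall l, (l < r)%N -> y l = y' l) ->
  (forall l, (l < r)%N -> z l = z' l) -> msum N y z = msum N y' z'.
Proof.
move=> hy hz; apply: eq_bigr => i _; congr (_ *: dga_op _ _).
by apply: eq_mkseq_lt => l hl; rewrite /upd hy // hz.
Qed.

(** The data from which a torsion Massey product is formed. *)
Definition massey_system (t : nat -> k) (N : nat -> int) (y z : nat -> A) : Prop :=
  forall l, (l < r)%N -> [/\ homog (N l) (y l), d (y l) = 0, homog (N l + 1) (z l) &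
                            d (z l) = t l *: y l].

Lemma massey_system_step t N y z i v : massey_system t N y z -> homog (N i + 1) v ->
  massey_system t N (upd y i (y i - d v)) (upd z i (z i - t i *: v)).
Proof.
move=> hyz hv l hl; have [hy dy hz dz] := hyz l hl.
rewrite /upd; case: eqP => [e'|_] //; move: hy dy hz dz; rewrite e' => hy dy hz dz.
split.
- by apply: homogB => //; rewrite -[N i](addrK 1); apply: dga_d_homog.
- by rewrite (is_linearB dlin) dy dga_dd subr0.
- by apply: homogB => //; apply: homogZ.
- by rewrite (is_linearB dlin) dz (is_linearZ dlin) scalerBr.
Qed.

(** The differential of the i-th summand is t_i times the value on the y_j, the
    sign of the summand being the one that the Leibniz rule produces. *)
Lemma msum_cycle (t : nat -> k) N y z : \sum_(l < r) t l = 0 ->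
  massey_system t N y z -> d (msum N y z) = 0.
Proof.
move=> ht hyz; rewrite /msum (is_linear_sum dlin).
rewrite (eq_bigr (fun i : 'I_r => t i *: dga_op a (mkseq y r))) => [|i _].
  by rewrite -scaler_suml ht scale0r.
have hN l : (l < r)%N -> homog (upd N i (N i + 1) l) (upd y i (z i) l).
  move=> hl; have [hy _ hz _] := hyz l hl.
  by rewrite /upd; case: eqP => // e'; move: hz; rewrite e'.
have [_ _ _ dz] := hyz i (ltn_ord i).
rewrite (is_linearZ dlin) (d_op ha hN) (bigD1 i) //= [X in _ *: (_ *: (_ + X))]big1 => [|j ne].
  have -> : mkseq (upd (upd y i (z i)) i (d (upd y i (z i) i))) r =
            mkseq (upd y i (t i *: y i)) r.
    by apply: eq_mkseq => l; rewrite updE dz /upd; case: eqP.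
  rewrite (mlinZ op_mlin) // mkseq_upd_id psum_upd ltnn !addr0 !scalerA.
  rewrite sgD; congr (_ *: _); set u := sg k e; set w := sg k _.
  have -> : u * w * u * w * t i = (u * u) * (w * w) * t i by ring.
  by rewrite !sgK !mul1r.
have [_ dy _ _] := hyz j (ltn_ord j).
by rewrite upd_ne ?dy ?(mlin0 op_mlin) ?scaler0.
Qed.

Lemma msumD N y z c : msum N y (fun l => z l + c l) = msum N y z +
  \sum_(i < r) sg k (e + \sum_(0 <= l < i) N l) *: dga_op a (mkseq (upd y i (c i)) r).
Proof.
by rewrite /msum -big_split; apply: eq_bigr => i _; rewrite /= -scalerDr (mlinD op_mlin).
Qed.

Lemma upd_upd_comm (T : Type) (F : nat -> T) i j x y : i != j ->
  upd (upd F i x) j y =1 upd (upd F j y) i x.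
Proof. by move=> ne l; rewrite /upd; case: eqP => [->|//]; rewrite eq_sym (negbTE ne). Qed.

(** For j <> i let W_j have v in slot i, z_j in slot j and y_l elsewhere. The
    differential of the operation on W_j is, up to sign, the change of the j-th
    summand plus t_j times the operation on V, where V has v in slot i and y_l
    elsewhere. The i-th summand changes by t_i times the operation on V, and the
    t_j sum to 0. *)
Lemma msum_step (t : nat -> k) N y z i v : (i < r)%N -> \sum_(l < r) t l = 0 ->
  massey_system t N y z -> homog (N i + 1) v ->
  exists w, msum N y z - msum N (upd y i (y i - d v)) (upd z i (z i - t i *: v)) = d w.
Proof.
move=> hi ht hyz hv.
pose s j := sg k (e + \sum_(0 <= l < j) N l).
pose V := upd y i v.
pose NV := upd N i (N i + 1).
have eqop (F G : nat -> A) : F =1 G -> dga_op a (mkseq F r) = dga_op a (mkseq G r).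
  by move=> h; congr dga_op; apply: eq_mkseq_lt => l _.
suff h (j : 'I_r) : exists w,
    s j *: dga_op a (mkseq (upd y j (z j)) r) -
    s j *: dga_op a (mkseq (upd (upd y i (y i - d v)) j
                             (upd z i (z i - t i *: v) j)) r) =
    d w + (s i * t j) *: dga_op a (mkseq V r).
  have [w hw] := choice h; exists (\sum_j w j).
  rewrite /msum -sumrB (eq_bigr _ (fun j _ => hw j)) big_split /= -scaler_suml.
  by rewrite -mulr_sumr ht mulr0 scale0r addr0 (is_linear_sum dlin).
have [yi dyi zi dzi] := hyz i hi; have [yj dyj zj dzj] := hyz j (ltn_ord j).
case: (eqVneq (j : nat) i) => [ji|ne].
  exists 0; rewrite (is_linear0 dlin) add0r ji updE -scalerBr -scalerA; congr (_ *: _).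
  rewrite -[in X in _ - X](eqop (upd y i (z i - t i *: v))); last first.
    by move=> l; rewrite /upd; case: eqP.
  by rewrite (mlinB op_mlin) // (mlinZ op_mlin) // opprB addrC subrK.
rewrite upd_ne // -scalerBr.
pose W := upd V j (z j).
pose D := dga_op a (mkseq (upd W i (d v)) r).
have -> : dga_op a (mkseq (upd (upd y i (y i - d v)) j (z j)) r) =
          dga_op a (mkseq (upd y j (z j)) r) - D.
  rewrite (eqop _ (upd (upd y j (z j)) i (y i - d v))); last first.
    by apply: upd_upd_comm; rewrite eq_sym.
  rewrite (mlinB op_mlin) //; congr (_ - _); apply: eqop => l.
    by rewrite /upd; case: (eqVneq l i) => [->|//]; rewrite eq_sym (negbTE ne).
  by rewrite /W /V /upd; case: eqP.
rewrite opprB addrC subrK.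
pose NW := upd NV j (NV j + 1).
have hW l : (l < r)%N -> homog (NW l) (W l).
  move=> hl; rewrite /NW /W /NV /V /upd; case: (eqVneq l j) => [_|_].
    by rewrite (negbTE ne).
  by case: eqP => // _; have [] := hyz l hl.
have ji : (Ordinal hi != j) by rewrite -val_eqE /= eq_sym.
have := d_op ha hW; rewrite (bigD1 (Ordinal hi)) //= (bigD1 j) 1?eq_sym //=.
rewrite [X in _ + (_ + X)]big1 ?addr0; last first.
  move=> l /andP[/negPf hli /negPf hlj]; rewrite -val_eqE /= in hli; rewrite -val_eqE /= in hlj.
  have [_ dl _ _] := hyz l (ltn_ord l).
  by rewrite {2}/W /V /upd hli hlj dl (mlin0 op_mlin) // scaler0.
have -> : d (W i) = d v by rewrite /W /V /upd eq_sym (negbTE ne) eqxx.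
have -> : dga_op a (mkseq (upd W j (d (W j))) r) = t j *: dga_op a (mkseq V r).
  rewrite {2}/W updE dzj (mlinZ op_mlin) //; congr (_ *: _); apply: eqop => l.
  by rewrite /W /V /upd; case: eqP => // ->; rewrite (negbTE ne).
rewrite -/D /NW /NV !psum_upd !ltnn.
set ai := \sum_(0 <= l < i) N l; set aj := \sum_(0 <= l < j) N l => hd.
exists ((s j * (sg k e * sg k (ai + (j < i)%N%:R))) *: dga_op a (mkseq W r)).
rewrite (is_linearZ dlin) hd !scalerDr !scalerA -addrA -scalerDl.
(* Exactly one of j < i and i < j holds, so the two extra degrees contribute the
   same sign for every j. *)
have s1 : sg k ((j < i)%N%:R) * sg k ((i < j)%N%:R) = -1.
  by case: ltngtP ne => //= _ _; rewrite sg0 sg1 ?mulr1 ?mul1r.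
have hK x : sg k x * sg k x = 1 := sgK k x.
rewrite /s -/ai -/aj !sgD sg0 mulr1.
set se := sg k e; set si := sg k ai; set sj := sg k aj.
move: s1 (hK e) (hK ai) (hK aj) (hK ((j < i)%N%:R)); rewrite -/se -/si -/sj.
set u1 := sg k _; set u2 := sg k _ => s1 Ke Ki Kj Ku.
have -> : se * sj * (se * (si * u1)) * (se * (si * u1)) =
          se * sj * (se * se) * (si * si) * (u1 * u1) by ring.
have -> : se * sj * (se * (si * u1)) * (se * (sj * u2 * 1) * t j) + se * si * t j =
          ((se * se) * (sj * sj) * (u1 * u2) + 1) * (se * si * t j) by ring.
by rewrite Ke Ki Kj Ku s1 !mulr1 mul1r addNr mul0r scale0r addr0.
Qed.

Lemma msum_homologous (t : nat -> k) N y z v : \sum_(l < r) t l = 0 ->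
  massey_system t N y z -> (forall l, (l < r)%N -> homog (N l + 1) (v l)) ->
  exists w, msum N y z -
            msum N (fun l => y l - d (v l)) (fun l => z l - t l *: v l) = d w.
Proof.
move=> ht hyz hv.
pose Y m l := if (l < m)%N then y l - d (v l) else y l.
pose Z m l := if (l < m)%N then z l - t l *: v l else z l.
have step m l : Y m.+1 l = upd (Y m) m (Y m m - d (v m)) l /\
                Z m.+1 l = upd (Z m) m (Z m m - t m *: v m) l.
  rewrite /Y /Z /upd ltnn ltnS leq_eqVlt.
  by case: (eqVneq l m) => [->|].
suff h m : (m <= r)%N -> massey_system t N (Y m) (Z m) /\
    exists w, msum N y z - msum N (Y m) (Z m) = d w.
  have [_ [w hw]] := h r (leqnn r).
  exists w; rewrite -hw; congr (_ - _).
  by apply: eq_msum => l hl; rewrite /Y /Z hl.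
elim: m => [|m IH] hm.
  by split=> //; exists 0; rewrite (is_linear0 dlin) subrr.
have [hYZ [w hw]] := IH (ltnW hm).
have [w' hw'] := msum_step hm ht hYZ (hv m hm).
split.
  have := massey_system_step hYZ (hv m hm) => h l /h.
  by have [-> ->] := step m l.
exists (w + w'); rewrite (is_linearD dlin) -hw -hw'.
rewrite [msum N (Y m.+1) _](@eq_msum _ _ _ (upd (Y m) m (Y m m - d (v m)))
  (upd (Z m) m (Z m m - t m *: v m))); first by rewrite addrA subrK.
- by move=> l _; have [] := step m l.
- by move=> l _; have [] := step m l.
Qed.

End HomologyOperation.
End Homology.

(** * Bigradings and minimal derived homotopy algebras *)

Section Bigraded.
Variables (k : comPzRingType) (V : gmod k (int * int)%type).
Implicit Types (x y : V) (p q n : int).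

Lemma tot_lin n a x y : tot n x -> tot n y -> tot n (a *: x + y).
Proof.
by move=> hx hy p q ne; rewrite gpr_linear (hx _ _ ne) (hy _ _ ne) scaler0 addr0.
Qed.
Lemma tot0 n : tot n (0 : V). Proof. by move=> p q _; apply: gpr0. Qed.
Lemma fil0 p : fil p (0 : V). Proof. by move=> p' q _; apply: gpr0. Qed.
Lemma homog_tot p q x : homog (p, q) x -> tot (p + q) x.
Proof.
by move=> h p' q' ne; rewrite (gpr_homog _ h); case: eqP => // -[e1 e2]; case: ne; rewrite e1 e2.
Qed.
Lemma homog_fil p q x : homog (p, q) x -> fil p x.
Proof.
by move=> h p' q' lt; rewrite (gpr_homog _ h); case: eqP => // -[e _]; rewrite e ltxx in lt.
Qed.
(** In a fixed total degree there is one component for each horizontal degree. *)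
Lemma top_component p n x : tot n x -> fil p x ->
  tot n (x - gpr (p, n - p) x) /\ fil (p - 1) (x - gpr (p, n - p) x).
Proof.
move=> hx fx; split=> p' q h; rewrite (is_linearB (@gpr_is_linear _ _ _ _)) gpr_gpr.
  by rewrite (hx _ _ h) ifF ?subr0 //; apply/eqP => -[e1 e2]; apply: h; lia.
case: eqP => [[-> ->]|ne]; first by rewrite subrr.
rewrite subr0; case: (ltgtP p p') => [lt|lt|e]; first exact: fx.
  by exfalso; lia.
by apply: hx => e'; apply: ne; rewrite e; congr pair; lia.
Qed.
End Bigraded.

Section MinimalAlgebra.
Variables (k : comPzRingType) (E : gsmod k).
Notation ES := (gs_smod E).
Notation SE := (susp ES).
Notation T := (free_smod SE).
Variable R : forall n, free_smod ES n -> Prop.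
Hypothesis hR : quadratic_relations R.
Variable X : dh_data E.
Hypothesis hX : derived_homotopy_algebra R X.
Hypothesis hmin : minimal X.
Notation dX := (@dh_d _ _ X).
Implicit Types (x y : X) (p q n : int).

Lemma dX_lin : is_linear dX. Proof. by case: hX => -[[]]. Qed.
Lemma dX_tot n x : tot n x -> tot (n - 1) (dX x). Proof. by case: hX => -[[_ h]] *; apply: h. Qed.
Lemma dX_fil p x : fil p x -> fil p (dX x). Proof. by case: hX => _ _ h _; apply: h. Qed.

Lemma fil_neg p x : p < 0 -> fil p x -> x = 0.
Proof.
move=> hp fx; apply: gpr_inj => -[p' q]; rewrite gpr0.
case: hX => _ h _ _; case: (ltP p' 0) => [/h|h0]; first exact.
by apply: fx; apply: lt_le_trans h0.
Qed.

Lemma homog_bottom n x : tot n x -> fil 0 x -> homog (0, n) x.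
Proof.
move=> hx fx; have [_ /fil_neg h] := top_component hx fx.
by rewrite /homog; apply/eqP; rewrite eq_sym -subr_eq0 -[n]subr0 h.
Qed.

Lemma dX_min p n x : tot n x -> fil p x -> fil (p - 1) (dX x).
Proof.
move=> hx fx p' q lt.
case: (ltP p p') => [/(dX_fil fx)|le]; first exact.
have {lt le} -> : p' = p by lia.
case: (q =P n - 1 - p) => [->|ne]; last by apply: (dX_tot hx); lia.
have [_ f'] := top_component hx fx.
have -> : x = gpr (p, n - p) x + (x - gpr (p, n - p) x) by rewrite addrC subrK.
rewrite (is_linearD dX_lin) (is_linearD (@gpr_is_linear _ _ _ _)).
rewrite [X in _ + X](dX_fil f') ?addr0; last by lia.
have -> : n - 1 - p = n - p - 1 by lia.
exact/hmin/homog_gpr.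
Qed.

Lemma dX_bottom n x : homog (0, n) x -> dX x = 0.
Proof.
move=> h; apply: (fil_neg (p := 0 - 1)) => //.
by apply: (dX_min (n := 0 + n)); [apply: homog_tot|apply: homog_fil h].
Qed.

Section Operation.
Variables (r : nat) (e : int) (mu : ES r).
Hypothesis hmu : homog e mu.
Notation phi := (@dh_op _ _ X r (sgen e mu)).

Lemma phi_multilinear : multilinear r (phi : seq X -> X).
Proof. by case: hX => -[_ _ [_ h _ _]] *; apply: h; apply: KD_sgen. Qed.

Lemma phi_tot (N : nat -> int) (F : nat -> X) : (forall l, (l < r)%N -> tot (N l) (F l)) ->
  tot (e + \sum_(l <- mkseq N r) l) (phi (mkseq F r)).
Proof.
move=> hF; case: hX => -[_ _ [_ _ h _] _ _] _ _ _.
have := h r (e + 1) _ (mkseq N r) (mkseq F r) (KD_sgen hR hmu) (sdeg_sgen hmu).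
by rewrite addrK size_mkseq; apply=> //; apply: homs_mkseq.
Qed.

Lemma phi_fil (N : nat -> int) (F : nat -> X) : (forall l, (l < r)%N -> fil (N l) (F l)) ->
  fil (\sum_(l <- mkseq N r) l) (phi (mkseq F r)).
Proof.
move=> hF; case: hX => _ _ _ h; apply: h; [exact: KD_sgen|exact: size_mkseq|].
exact: homs_mkseq.
Qed.

Lemma phi_one x : @dh_op _ _ X 1 tone [:: x] = 0.
Proof. by case: hX => -[]. Qed.

(** In the equation for s mu the quadratic terms involve the action of 1, which is
    zero; so (s mu) commutes with the differential up to sign. *)
Lemma d_phi (N : nat -> int) (F : nat -> X) : (forall l, (l < r)%N -> tot (N l) (F l)) ->
  dX (phi (mkseq F r)) =
  sg k e *: \sum_(i < r) sg k (\sum_(0 <= l < i) N l) *: phi (mkseq (upd F i (dX (F i))) r).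
Proof.
move=> hF; case: hX => -[_ _ _ _ h] _ _ _.
have := h r (e + 1) _ _ (mkseq N r) (mkseq F r) (KD_sgen hR hmu) (sdeg_sgen hmu)
  (inf_rep_sgen hR hmu) (size_mkseq _ _) (homs_mkseq _ hF).
rewrite addrK bdry_mkseq fev_inf_sgen phi_one scaler0 add0r [X in _ + X = _ -> _]big1.
  by rewrite addr0 => /subr0_eq.
move=> j _; rewrite phi_one.
by rewrite args_upd // (mlin0 phi_multilinear) // scaler0.
Qed.
End Operation.
End MinimalAlgebra.

(** * Derived minimal models *)

Section HorizontalDegreeZero.
Variables (k : comPzRingType) (E : gsmod k).
Variable R : forall n, free_smod (gs_smod E) n -> Prop.
Variable A : dg_algebra R.

Lemma tot_dga n (y : dga_bi A) : tot n y <-> homog n (y : A).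
Proof.
split=> [h|h p q ne]; last first.
  rewrite /= /pr0 /=; case: eqP => // p0; rewrite (gpr_homog _ h) ifF //.
  by apply/eqP => e; apply: ne; rewrite p0 e add0r.
apply: (@gpr_inj _ _ A) => i; rewrite (gpr_gpr (g := A)); case: (eqVneq i n) => // ne.
have /(_ (elimN eqP _)) := h 0 i; rewrite /= /pr0 /= => -> //.
by rewrite add0r.
Qed.

Lemma fil_dga p (y : dga_bi A) : 0 <= p -> fil p y.
Proof.
by move=> hp p' q lt; rewrite /= /pr0 /=; case: eqP => // e; rewrite e in lt; lia.
Qed.

Lemma fil_dga_neg p (y : dga_bi A) : p < 0 -> fil p y -> y = 0.
Proof.
move=> hp h; apply: (@gpr_inj _ _ A) => i; rewrite (@gpr0 _ _ A).
exact: (h 0 i hp).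
Qed.

Lemma dga_op0 r (h : seq A) : size h = r -> dga_op (0 : quadratic_operad R r) h = 0.
Proof.
move=> sh; have [h1 _ _ _] := dga_op_family A.
have := h1 r (-1) 0 0 h I I sh.
by rewrite scaler0 addr0 scaleN1r addNr.
Qed.
End HorizontalDegreeZero.

Section Model.
Variables (k : comPzRingType) (E : gsmod k).
Notation ES := (gs_smod E).
Notation SE := (susp ES).
Notation T := (free_smod SE).
Variable R : forall n, free_smod ES n -> Prop.
Hypothesis hR : quadratic_relations R.
Variable A : dg_algebra R.
Variable X : dh_data E.
Variable f : forall r, T r -> seq X -> dga_dh A.
Hypothesis hX : derived_homotopy_algebra R X.
Hypothesis hmin : minimal X.
Hypothesis hf : derived_infty_morphism R f.
Hypothesis hE : E2_iso (fun x => f tone [:: x]).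
Notation dX := (@dh_d _ _ X).
Notation dA := (@dga_d _ _ _ A).
Notation g := (fun x : X => f tone [:: x] : A).
Implicit Types (x y : X) (p q n : int).

Lemma g_lin : is_linear g.
Proof.
case: hf => -[[_ h _ _] _] _ a x y.
exact: (h 1%N tone (KD_tone hR) [::] [::]).
Qed.

Lemma g_homog n x : tot n x -> homog n (g x).
Proof.
move=> hx; case: hf => -[[_ _ h _] _] _; apply/tot_dga.
have := h 1%N 0 tone [:: n] [:: x] (KD_tone hR) (sdeg_tone E) erefl.
by rewrite big_seq1 !add0r; apply; split=> // -[|j].
Qed.

(** The equation of an infinity-morphism for 1. The algebra A is an algebra over
    the operad itself, so 1 acts on it by kappa(1) = 0. *)
Lemma d_g n x : tot n x -> dA (g x) = g (dX x).
Proof.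
move=> hx; case: hf => -[_ h] _.
have hh : homs (@tot _ X) 0 [:: n] [:: x] by split=> // -[|j].
have := h 1%N 0 tone _ _ [:: n] [:: x] (KD_tone hR) (sdeg_tone E) (inf_rep_tone hR)
  (full_rep_tree hR (ntree_leaf SE) isT) erefl hh.
rewrite (fev_inf_tone _) fev_full_tone /= kappa_tone dga_op0 //.
rewrite (phi_one hX) (is_linear0 g_lin) scaler0 subr0.
rewrite /bdry big_ord_recl big_ord0 addr0 /= /psum /= big_nil !sg0 !scale1r.
by move/subr0_eq.
Qed.

Section Operation.
Variables (r : nat) (e : int) (mu : ES r).
Hypothesis hmu : homog e mu.
Notation phi := (@dh_op _ _ X r (sgen e mu)).
Notation fmu := (f (sgen e mu) : seq X -> A).

Lemma fmu_multilinear : multilinear r fmu.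
Proof. by case: hf => -[[_ h _ _] _] _; apply: h; apply: KD_sgen. Qed.

(** The equation of an infinity-morphism for s mu: f(1) is compatible with mu
    up to the homotopy f(s mu). *)
Lemma d_fmu (N : nat -> int) (F : nat -> X) : (forall l, (l < r)%N -> tot (N l) (F l)) ->
  dA (fmu (mkseq F r)) - sg k (e + 1) *: \sum_(i < r)
    sg k (\sum_(0 <= l < i) N l) *: fmu (mkseq (upd F i (dX (F i))) r) =
  g (phi (mkseq F r)) - dga_op (gen R e mu) (mkseq (fun l => g (F l)) r).
Proof.
move=> hF; case: hf => -[_ h] _.
have := h r (e + 1) _ _ _ (mkseq N r) (mkseq F r) (KD_sgen hR hmu) (sdeg_sgen hmu)
  (inf_rep_sgen hR hmu)
  (full_rep_tree hR (ntree_sgen hmu) (eq_leq (@corolla_weight _ _ r (e + 1) mu)))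
  (size_mkseq _ _) (homs_mkseq _ hF).
rewrite bdry_mkseq fev_inf_sgen fev_full_sgen ?size_mkseq // => ->.
rewrite /= kappa_tone dga_op0 // add0r (kappa_sgen R hmu) /mkseq -map_comp.
congr (_ - _).
  rewrite -/(mkseq F r) [X in _ + X]big1 ?addr0 => [|j _]; last first.
    by rewrite (phi_one hX) args_upd // (mlin0 fmu_multilinear) // scaler0.
  rewrite cats0 koszul_iota big_nil mulr0 !addr0 sg0 scale1r.
  by have := args_iota 0 (mkseq F r); rewrite size_mkseq => ->.
exact: add0r.
Qed.
End Operation.

(** E^2-surjectivity in filtration 0. *)
Lemma lift_cycle n (y : A) : homog n y -> dA y = 0 ->
  exists a v, [/\ homog (0, n) a, homog (n + 1) v & y - g a = dA v].
Proof.
move=> hy dy; have [_ /(_ y)] := hE 0 n.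
case=> [|a [ta fa _]]; first by split; [apply/tot_dga|apply: fil_dga|rewrite /= dy; apply: fil0].
move=> [u [v [[_ fu _] [tv _ _] e]]]; exists a, v.
split; first exact: (homog_bottom hX).
  exact/tot_dga.
by move: e; rewrite (fil_dga_neg _ fu) // add0r.
Qed.

(** E^2-injectivity in filtration 0. *)
Lemma lift_boundary n x (z : A) : homog (0, n) x -> homog (n + 1) z -> dA z = g x ->
  exists2 b, homog (1, n) b & dX b = x.
Proof.
move=> hx hz e.
have tx : tot n x by rewrite -[n]add0r; apply: homog_tot.
have [/(_ x) h _] := hE 0 n.
have [|| u [y [[_ fu _] [ty fy _] ex]]] := h.
- by split; [|apply: homog_fil hx|rewrite (dX_bottom hX hmin hx); apply: fil0].
- exists 0, z; split; last by rewrite add0r.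
    split; [exact: tot0|exact: fil0|rewrite /= (is_linear0 (@dga_d_linear _ _ _ A)); exact: fil0].
  by split; [apply/tot_dga|apply: fil_dga|apply: fil_dga].
have u0 : u = 0 by apply: (fil_neg hX _ fu).
have [t1 f1] := top_component ty fy.
have d0 : dX (y - gpr (1, n) y) = 0.
  rewrite -(addrK 1 n); apply: (dX_bottom hX hmin (n := n + 1)).
  exact: (homog_bottom hX).
exists (gpr (1, n) y); first exact: homog_gpr.
by rewrite ex u0 add0r -[LHS]addr0 -d0 (is_linearB (dX_lin hX)) addrC subrK.
Qed.

(** E^2-injectivity in filtration 1: as A is concentrated in filtration 0, every
    class there is mapped to zero. *)
Lemma lift_horizontal_cycle n c : homog (1, n) c -> dX c = 0 ->
  exists w c', [/\ homog (2, n) w, homog (0, n + 1) c' & dX w = c + c'].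
Proof.
move=> hc dc.
have tc : tot (n + 1) c by rewrite addrC; apply: homog_tot.
have [/(_ c) h _] := hE 1 (n + 1).
have [|| u [y [[tu fu _] [ty fy _] ec]]] := h.
- by split; [|apply: homog_fil hc|rewrite dc; apply: fil0].
- exists (g c), 0; split; last by rewrite /= (is_linear0 (@dga_d_linear _ _ _ A)) addr0.
    split; [exact/tot_dga/g_homog|exact: fil_dga|].
    by rewrite /= (d_g tc) dc (is_linear0 g_lin); apply: fil0.
  split; [exact: tot0|exact: fil0|].
  by rewrite /= (is_linear0 (@dga_d_linear _ _ _ A)); apply: fil0.
have [t1 f1] := top_component ty fy.
set w := gpr _ y in t1 f1.
have ew : n + 1 + 1 - (1 + 1) = n by lia.
exists w, (- (u + dX (y - w))); split.
- by rewrite -{1}ew; apply: homog_gpr.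
- rewrite -scaleN1r; apply/homogZ/homogD; apply: (homog_bottom hX) => //.
    by rewrite -[n + 1](addrK 1); apply: (dX_tot hX).
  exact: (dX_min hX hmin t1 f1).
- by rewrite {1}ec opprD addrACA subrr add0r -(is_linearB (dX_lin hX)) subKr.
Qed.
End Model.

(** * The equation m = d psi in weights 0 and 1 *)

Lemma bsum_mkseq (B : nat -> int * int) r :
  bsum (mkseq B r) = (\sum_(l < r) (B l).1, \sum_(l < r) (B l).2).
Proof.
by rewrite /bsum /mkseq !big_map -!(big_mkord predT (fun l => (B l).1))
  -!(big_mkord predT (fun l => (B l).2)) /index_iota subn0.
Qed.

Lemma totd_mkseq (B : nat -> int * int) r :
  totd (mkseq B r) = mkseq (fun l => (B l).1 + (B l).2) r.
Proof. by rewrite /totd /mkseq -map_comp. Qed.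

Lemma two_components (k : comPzRingType) (V : gmod k (int * int)%type) n (x : V) :
  (forall p q, p < 0 -> gpr (p, q) x = 0) -> tot (n + 1) x -> fil 1 x ->
  x = gpr (1, n) x + gpr (0, n + 1) x.
Proof.
move=> px hx fx; apply: gpr_inj => -[p q].
rewrite (is_linearD (@gpr_is_linear _ _ _ _)) !gpr_gpr.
case: eqP => [[-> ->]|n1]; first by rewrite xpair_eqE addr0.
case: eqP => [[-> ->]|n2]; first by rewrite add0r.
rewrite addr0; case: (ltP p 0) => [/px|h0]; first exact.
case: (ltP 1 p) => [/fx|h1]; first exact.
apply: hx => e; have [p0|p1] : p = 0 \/ p = 1 by lia.
- by apply: n2; rewrite p0 -e p0 add0r.
- by apply: n1; rewrite p1; congr pair; lia.
Qed.

Section Differential.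
Variables (k : comPzRingType) (E : gsmod k).
Notation ES := (gs_smod E).
Notation SE := (susp ES).
Notation T := (free_smod SE).
Variable R : forall n, free_smod ES n -> Prop.
Hypothesis hR : quadratic_relations R.
Variable A : dg_algebra R.
Variable X : dh_data E.
Variable f : forall r, T r -> seq X -> dga_dh A.
Hypothesis hX : derived_homotopy_algebra R X.
Hypothesis hmin : minimal X.
Hypothesis hf : derived_infty_morphism R f.
Variables (m psi : nat -> forall r, T r -> seq X -> homology A).
Hypothesis hm : universal_cocycle f m.
Hypothesis hpsi : cochain 1 (-1) psi.
Hypothesis hd : is_differential f 1 (-1) psi m.
Notation dX := (@dh_d _ _ X).
Notation g := (fun x : X => f tone [:: x] : A).
Notation psi0 := (fun x : X => psi 0%N tone [:: x]).
Implicit Types (x y : X) (p q n : int).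

Lemma hop_op0 r (h : seq (homology A)) : size h = r -> hop (0 : quadratic_operad R r) h = 0.
Proof. by move=> sh; rewrite /hop dga_op0 ?size_map // hcls0. Qed.

Lemma rho_bottom n x : homog (0, n) x -> rho f (0, n) x = hcls (g x).
Proof.
move=> /homog_tot; rewrite add0r => hx; congr hcls.
by rewrite /low /lowb /= subr0 !addr0 /pr0 /=; apply: (g_homog hR hf).
Qed.

Lemma rhos_upd (B : nat -> int * int) (F : nat -> X) r j h : (j < r)%N ->
  rhos f (mkseq B r) (mkseq F r) (iota 0 j) ++
    h :: rhos f (mkseq B r) (mkseq F r) (iota j.+1 (r - j.+1)) =
  mkseq (upd (fun l => rho f (B l) (F l)) j h) r.
Proof.
move=> hj; rewrite mkseq_upd_split //; congr (_ ++ _ :: _); apply/eq_in_map => l.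
  by rewrite mem_iota => /andP[_ hl]; rewrite !nth_mkseq // (ltn_trans hl).
by rewrite mem_iota => /andP[_ hl]; rewrite !nth_mkseq // -(subnKC hj).
Qed.

Lemma psi0_lin : is_linear psi0.
Proof.
have [[_ h _ _] _ _ _] := hpsi 0%N.
by move=> a x y; apply: (h 1%N tone (KD_tone hR) [::] [::]).
Qed.

(** psi_0 is concentrated in horizontal degree 1. *)
Lemma psi0_bottom n x : homog (0, n) x -> psi0 x = 0.
Proof.
move=> hx; have [_ _ _ h] := hpsi 0%N.
apply: (h 1%N tone [:: (0, n)] [:: x] (KD_tone hR)) => //; first by split=> // -[|j].
by rewrite /bsum /= big_seq1.
Qed.

Lemma psi0_hdeg n x : homog (1, n) x -> hdeg (n + 1) (psi0 x).
Proof.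
move=> /homog_tot hx; have [[_ _ h _] _ _ _] := hpsi 0%N.
have := h 1%N 0 tone [:: 1 + n] [:: x] (KD_tone hR) (sdeg_tone E) erefl.
rewrite big_seq1 (_ : 0 - (1%:Z + -1) + (1 + n) = n + 1); last by lia.
by apply; split=> // -[|j].
Qed.

(** In weight 0 the only term of d psi is psi_0 d_1, and m_0 is rho d_2. *)
Lemma differential_tone n w c c' : homog (2, n) w -> homog (1, n) c ->
  homog (0, n + 1) c' -> dX w = c + c' -> hcls (g c') = psi0 c.
Proof.
move=> hw hc hc' e; have [_ h0 _ _] := hm.
have /= := h0 _ _ hw; rewrite /low /lowb /= subrr -[n + -1 + 2]addrA e.
have gl := @gpr_is_linear _ _ X.
rewrite (is_linearD (gl _)) (gpr_homog _ hc) (gpr_homog _ hc') /= add0r eqxx.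
rewrite rho_bottom // => <-.
have hh : homs (@homog k _ X) (0, 0) [:: (2, n)] [:: w] by split=> // -[|j].
have -> := hd (u := 0%N) isT (KD_tone hR) (has_weight_tone E) (sdeg_tone E)
  (inf_rep_tone hR) (erefl : size [:: w] = 1%N) hh.
rewrite /= !fev_inf_tone /= kappa_tone hop_op0 // !scaler0 sub0r oppr0 add0r.
rewrite big_ord_recl big_ord0 /= !addr0 /psum /= big_nil !addr0 sg1 scaleN1r opprK.
rewrite /low /lowb /= e addrNK (is_linearD (gl _)) (gpr_homog _ hc) (gpr_homog _ hc') /=.
by rewrite eqxx addr0.
Qed.

Section Operation.
Variables (r : nat) (e : int) (mu : ES r).
Hypothesis hmu : homog e mu.
Notation phi := (@dh_op _ _ X r (sgen e mu)).
Notation psi1 := (psi 1 (sgen e mu)).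

Lemma psi1_multilinear : multilinear r psi1.
Proof. by have [[_ h _ _] _ _ _] := hpsi 1%N; apply: h; apply: KD_sgen. Qed.

(** Of Delta_(1)(s mu) only the summands (s mu) o_j 1 contribute to the first term
    of d psi, as kappa(1) = 0, and only 1 o_1 (s mu) to the second, as psi_0
    vanishes in weight 1. *)
Lemma differential_sgen (B : nat -> int * int) (F : nat -> X) :
  (forall l, (l < r)%N -> homog (B l) (F l)) ->
  rho f (lowb (bsum (mkseq B r)) e 1) (low (bsum (mkseq B r)) e 1 (phi (mkseq F r))) =
  psi0 (low (bsum (mkseq B r)) e 0 (phi (mkseq F r)))
  - \sum_(j < r) hop (gen R e mu) (mkseq (upd (fun l => rho f (B l) (F l)) j (psi0 (F j))) r)
  - \sum_(i < r) sg k (e + \sum_(0 <= l < i) ((B l).1 + (B l).2)) *: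
      psi1 (mkseq (upd F i (low (B i) (-1) 1 (dX (F i)))) r).
Proof.
move=> hF; have hh := homs_mkseq (0, 0) hF; have [_ _ h1 _] := hm.
rewrite -(h1 _ _ _ _ _ hmu (size_mkseq _ _) hh).
have -> := hd (u := 1%N) isT (KD_sgen hR hmu) (has_weight_sgen hmu) (sdeg_sgen hmu)
  (inf_rep_sgen hR hmu) (size_mkseq _ _) hh.
rewrite /= totd_mkseq !fev_inf_sgen; congr (_ - _).
- rewrite kappa_tone hop_op0 // scaler0 add0r addrC; congr (_ + _).
  + rewrite [X in _ + X]big1 ?addr0 => [|j _]; last first.
      have [_ h _ _] := hpsi 0%N.
      rewrite (h 1%N _ (sgen e mu)) ?scaler0 //; [exact: KD_sgen|exact: has_weight_sgen|].
      by rewrite args_upd // size_mkseq.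
    rewrite /Defs.eta /= cats0 koszul_iota big_nil mul0r mulr0 !addr0 sg1 scaleN1r opprK.
    have := args_iota 0 (mkseq F r); rewrite size_mkseq => ->.
    have := args_iota (0, 0) (mkseq B r); rewrite size_mkseq => ->.
    by rewrite /kappaX addrK (wcomp_sgen hmu).
  + rewrite -sumrN; apply: eq_bigr => j _.
    rewrite (kappa_sgen R hmu) /Defs.eta /= iota_split // koszul_iota.
    rewrite (_ : 1%Z - 1 = 0 :> int) // mulr0 !addr0 mul0r addr0.
    rewrite (_ : sg k _ = -1) ?scaleN1r; last exact: expr1.
    by rewrite /= nth_mkseq // rhos_upd.
- apply: eq_bigr => i _.
  rewrite psum_mkseq 1?ltnW // nth_mkseq // nth_mkseq // set_nth_mkseq //.
  by rewrite (addrC 1%Z) -(addrA e) (addrAC e) [in LHS]sgD (sgD _ 1 1%Z) sgK mulr1.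
Qed.
End Operation.
End Differential.

(** * The Massey class of lifted cycles *)

Section Core.
Variables (k : comPzRingType) (E : gsmod k).
Notation ES := (gs_smod E).
Notation SE := (susp ES).
Notation T := (free_smod SE).
Variable R : forall n, free_smod ES n -> Prop.
Hypothesis hR : quadratic_relations R.
Variable A : dg_algebra R.
Variable X : dh_data E.
Variable f : forall r, T r -> seq X -> dga_dh A.
Hypothesis hX : derived_homotopy_algebra R X.
Hypothesis hmin : minimal X.
Hypothesis hf : derived_infty_morphism R f.
Hypothesis hE : E2_iso (fun x => f tone [:: x]).
Variables (m psi : nat -> forall r, T r -> seq X -> homology A).
Hypothesis hm : universal_cocycle f m.
Hypothesis hpsi : cochain 1 (-1) psi.
Hypothesis hd : is_differential f 1 (-1) psi m.
Notation dX := (@dh_d _ _ X).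
Notation dA := (@dga_d _ _ _ A).
Notation g := (fun x : X => f tone [:: x] : A).
Notation psi0 := (fun x : X => psi 0%N tone [:: x]).

Variables (r : nat) (e : int) (mu : ES r).
Hypothesis hmu : homog e mu.
Notation phi := (@dh_op _ _ X r (sgen e mu)).
Notation fmu := (f (sgen e mu) : seq X -> A).
Notation psi1 := (psi 1 (sgen e mu)).
Notation op := (@dga_op _ _ _ A r (gen R e mu)).

Variables (t : nat -> k) (N : nat -> int) (a b : nat -> X).
Hypothesis ht : \sum_(l < r) t l = 0.
Hypothesis ha : forall l, (l < r)%N -> homog (0, N l) (a l).
Hypothesis hb : forall l, (l < r)%N -> homog (1, N l) (b l).
Hypothesis hdb : forall l, (l < r)%N -> dX (b l) = t l *: a l.

Let s i := sg k (e + \sum_(0 <= l < i) N l).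
Let B i := upd a i (b i).
Let bidB i : nat -> int * int := upd (fun l => (0, N l)) i (1, N i).
Let degB i := upd N i (N i + 1).
Let n := e + \sum_(l < r) N l.
Let phB i := phi (mkseq (B i) r).
Let phB1 i := gpr (1, n) (phB i).
Let phB0 i := gpr (0, n + 1) (phB i).
Let glin := g_lin hR hf.

Let da0 l : (l < r)%N -> dX (a l) = 0.
Proof. by move=> /ha; apply: (dX_bottom hX hmin). Qed.

Let B_homog i l : (i < r)%N -> (l < r)%N -> homog (bidB i l) (B i l).
Proof.
by move=> hi hl; rewrite /bidB /B /upd; case: eqP => _; [apply: hb|apply: ha].
Qed.

Let B_tot i l : (i < r)%N -> (l < r)%N -> tot (degB i l) (B i l).
Proof.
move=> hi hl; have := homog_tot (q := (bidB i l).2) (p := (bidB i l).1) (x := B i l).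
rewrite -surjective_pairing => /(_ (B_homog hi hl)).
by rewrite /degB /bidB /upd; case: eqP => _ /=; rewrite ?add0r // addrC.
Qed.

Let phB_tot i : (i < r)%N -> tot (n + 1) (phB i).
Proof.
move=> hi; have := phi_tot hR hX hmu (fun l hl => B_tot hi hl).
by rewrite sum_mkseq sum_upd // addrA.
Qed.

Let phB_fil i : (i < r)%N -> fil 1 (phB i).
Proof.
move=> hi; have := phi_fil hR hX hmu (N := upd (fun=> 0) i (0 + 1)) (F := B i).
rewrite sum_mkseq (@sum_upd _ (fun=> 0)) // big1 // add0r; apply=> l hl.
have := homog_fil (q := (bidB i l).2) (p := (bidB i l).1) (x := B i l).
rewrite -surjective_pairing => /(_ (B_homog hi hl)).
by rewrite /bidB /upd; case: eqP.
Qed.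

Let phB_split i : (i < r)%N -> phB i = phB1 i + phB0 i.
Proof.
move=> hi; apply: two_components; [|exact: phB_tot|exact: phB_fil].
by move=> p q hp; case: hX => _ h _ _; apply: h.
Qed.

Let bsum_bidB i : (i < r)%N -> bsum (mkseq (bidB i) r) = (1, \sum_(l < r) N l).
Proof.
move=> hi; rewrite bsum_mkseq; congr pair.
  rewrite (bigD1 (Ordinal hi)) //= /bidB updE big1 // => l.
  by rewrite -val_eqE /= => ne; rewrite upd_ne.
by apply: eq_bigr => l _; rewrite /bidB /upd; case: eqP => // ->.
Qed.

Let upd2 i c : upd (B i) i c =1 upd a i c.
Proof. by move=> l; rewrite /B /upd; case: eqP. Qed.

(** In B_i only the i-th argument is not a cycle, and its differential is
    t_i a_i. The maps D_j stand for the projections to bidegrees that occur in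
    the differential of cochains. *)
Let sum_d (Y : lmodType k) (h : seq X -> Y) (c : nat -> k) i (D : nat -> X -> X) :
  multilinear r h -> (i < r)%N -> (forall j, D j 0 = 0) -> D i (t i *: a i) = t i *: a i ->
  \sum_(j < r) c j *: h (mkseq (upd (B i) j (D j (dX (B i j)))) r) =
  (c i * t i) *: h (mkseq a r).
Proof.
move=> hh hi D0 Di; rewrite (bigD1 (Ordinal hi)) //= big1 ?addr0 => [|j]; last first.
  rewrite -val_eqE /= => ne; rewrite {2}/B upd_ne // da0 // D0.
  by rewrite (mlin0 hh) // scaler0.
rewrite {2}/B updE hdb // Di.
rewrite (eq_mkseq (upd2 i _)) (mlinZ hh) // scalerA; congr (_ *: h _).
exact: mkseq_upd_id.
Qed.

Let d_phB i : (i < r)%N -> dX (phB i) = (s i * t i) *: phi (mkseq a r).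
Proof.
move=> hi; rewrite /phB (d_phi hR hX hmu (fun l hl => B_tot hi hl)).
rewrite (sum_d (fun j => sg k (\sum_(0 <= l < j) degB i l)) (D := fun _ x => x)) //.
  by rewrite psum_upd ltnn addr0 scalerA mulrA -sgD.
exact: (phi_multilinear hR hX hmu).
Qed.

Let c := \sum_(i < r) s i *: phB i.
Let c1 := \sum_(i < r) s i *: phB1 i.
Let c0 := \sum_(i < r) s i *: phB0 i.

Let c_split : c = c1 + c0.
Proof.
by rewrite /c /c1 /c0 -big_split; apply: eq_bigr => i _; rewrite /= -scalerDr -phB_split.
Qed.

Let hc1 : homog (1, n) c1.
Proof.
rewrite /c1; apply: (big_ind (homog (1, n))) => [|x y|i _].
- exact: homog0.
- exact: homogD.
- exact/homogZ/homog_gpr.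
Qed.

Let hc0 : homog (0, n + 1) c0.
Proof.
rewrite /c0; apply: (big_ind (homog (0, n + 1))) => [|x y|i _].
- exact: homog0.
- exact: homogD.
- exact/homogZ/homog_gpr.
Qed.

Let dlin := dX_lin hX.

Let dc : dX c = 0.
Proof.
rewrite /c (is_linear_sum dlin).
rewrite (eq_bigr (fun i : 'I_r => t i *: phi (mkseq a r))) => [|i _].
  by rewrite -scaler_suml ht scale0r.
by rewrite (is_linearZ dlin) d_phB // scalerA mulrA sgK mul1r.
Qed.

Let dc1 : dX c1 = 0.
Proof.
by have := dc; rewrite c_split (is_linearD dlin) (dX_bottom hX hmin hc0) addr0.
Qed.

Let tc1 : tot (n + 1) c1. Proof. by rewrite addrC; apply: homog_tot. Qed.
Let tc0 : tot (n + 1) c0. Proof. by rewrite -[n + 1]add0r; apply: homog_tot. Qed.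
Let dgc1 : dA (g c1) = 0. Proof. by rewrite (d_g hR hX hf tc1) dc1 (is_linear0 glin). Qed.
Let dg_phB0 i : dA (g (phB0 i)) = 0.
Proof.
have h : homog (0, n + 1) (phB0 i) by apply: homog_gpr.
have tP : tot (n + 1) (phB0 i) by rewrite -[n + 1]add0r; apply: homog_tot.
by rewrite (d_g hR hX hf tP) (dX_bottom hX hmin h) (is_linear0 glin).
Qed.

(** If d w = c_1 + c' then the class of f(1)(c_1) is minus that of f(1)(c'), and
    c' = d_2 w. *)
Let hcls_c1 : hcls (g c1) = - psi0 c1.
Proof.
have [w [c' [hw hc' e']]] := lift_horizontal_cycle hR hX hmin hf hE hc1 dc1.
rewrite -(differential_tone hR hf hm hd hw hc1 hc' e').
have dgc' : dA (g c') = 0.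
  have tc' : tot (n + 1) c' by rewrite -[n + 1]add0r; apply: homog_tot.
  by rewrite (d_g hR hX hf tc') (dX_bottom hX hmin hc') (is_linear0 glin).
have : hcls (g c1 + g c') = 0.
  rewrite -(is_linearD glin) -e' -(d_g hR hX hf (homog_tot hw)).
  exact: hcls_boundary.
by rewrite hclsD // => /eqP; rewrite addr_eq0 => /eqP.
Qed.

Let Q i := hop (gen R e mu) (mkseq (upd (fun l => hcls (g (a l))) i (psi0 (b i))) r).

Let hcls_phB0 i : (i < r)%N ->
  hcls (g (phB0 i)) = psi0 (phB1 i) - Q i - (s i * t i) *: psi1 (mkseq a r).
Proof.
move=> hi; have := differential_sgen hR hm hpsi hd hmu (fun l hl => B_homog hi hl).
rewrite bsum_bidB // /low /lowb /= subrr subr0 addr0.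
rewrite (addrC (\sum_(l < r) N l) e) -/n (rho_bottom hR hf) -/(phB0 i) -/(phB1 i) //; last first.
  exact: homog_gpr.
move->; congr (_ - _ - _).
- rewrite (bigD1 (Ordinal hi)) //= big1 ?addr0 => [|j].
    congr hop; apply: eq_mkseq_lt => l hl; rewrite /upd /=; case: eqP => [_|/eqP ne].
      by rewrite /B updE.
    by rewrite /bidB /B !upd_ne // (rho_bottom hR hf) //; apply: ha.
  rewrite -val_eqE /= => ne; apply: (hop_eq0 (sdeg_gen R hmu) (ltn_ord j)).
  rewrite updE /B upd_ne //; apply: (psi0_bottom hR hpsi); exact: ha.
- rewrite (sum_d (fun j => sg k (e + \sum_(0 <= l < j) ((bidB i l).1 + (bidB i l).2)))
    (D := fun j x => gpr ((bidB i j).1 - 1, (bidB i j).2 - 1 + 1) x)) //.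
  + congr ((_ * _) *: _); congr (sg k (e + _)); apply: eq_big_nat => l /andP[_ hl].
    by rewrite /bidB upd_ne ?ltn_eqF // add0r.
  + exact: (psi1_multilinear hR hpsi hmu).
  + by move=> j; apply: gpr0.
  + by rewrite /bidB updE /= subrr subrK; apply/homogZ/ha.
Qed.

(** The terms in psi_1 cancel since the t_i sum to 0. *)
Let hcls_c0 : hcls (g c0) = psi0 c1 - \sum_(i < r) s i *: Q i.
Proof.
rewrite /c0 (is_linear_sum glin) hcls_sum => [|i]; last first.
  by rewrite (is_linearZ glin) (is_linearZ (@dga_d_linear _ _ _ A)) dg_phB0 scaler0.
rewrite (eq_bigr (fun i : 'I_r => psi0 (s i *: phB1 i) - s i *: Q i
    - t i *: psi1 (mkseq a r))) => [|i _].
  rewrite !sumrB -scaler_suml ht scale0r subr0.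
  by rewrite -(is_linear_sum (psi0_lin hR hpsi)).
rewrite (is_linearZ glin) hclsZ // hcls_phB0 // !scalerBr scalerA mulrA sgK mul1r.
by rewrite (is_linearZ (psi0_lin hR hpsi)).
Qed.

(** The homotopies f(s mu)(B_i) make up the boundary. *)
Let msum_eq : exists w : A,
  msum e (gen R e mu) N (fun l => g (a l)) (fun l => g (b l)) = g c - dA w.
Proof.
pose G i : A := g (phB i); pose H i : A := fmu (mkseq (B i) r); pose M : A := fmu (mkseq a r).
have gc : g c = \sum_(i < r) s i *: G i.
  rewrite /c (is_linear_sum glin); apply: eq_bigr => i _.
  by rewrite (is_linearZ glin).
have key (i : 'I_r) : s i *: op (mkseq (upd (fun l => g (a l)) i (g (b i))) r) =
    s i *: G i - dA (s i *: H i) - t i *: M.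
  have := d_fmu hR hX hf hmu (fun l hl => B_tot (ltn_ord i) hl).
  rewrite (sum_d (fun j => sg k (\sum_(0 <= l < j) degB i l)) (D := fun _ x => x)) //; last first.
    exact: (fmu_multilinear hR hf hmu).
  rewrite -/(phB i) psum_upd ltnn addr0 scalerA mulrA -sgD.
  have -> : mkseq (fun l => f tone [:: B i l]) r =
            mkseq (upd (fun l => f tone [:: a l]) i (f tone [:: b i])) r.
    by apply: eq_mkseq => l; rewrite /B /upd; case: eqP.
  have ss : sg k (e + 1 + \sum_(0 <= l < i) N l) = - s i.
    by rewrite /s !sgD sg1 mulrN1 mulNr.
  rewrite ss => h.
  have {}h : op (mkseq (upd (fun l => g (a l)) i (g (b i))) r) =
      G i - (dA (H i) - (- s i * t i) *: M).
    by rewrite [X in _ - X]h opprB addrC subrK.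
  have st : s i * (- s i * t i) = - t i by rewrite mulrA mulrN sgK mulN1r.
  rewrite h (is_linearZ (@dga_d_linear _ _ _ A)) !scalerBr scalerA st scaleNr.
  by rewrite opprK opprD addrA.
rewrite /msum (eq_bigr _ (fun i _ => key i)) !sumrB -scaler_suml ht scale0r subr0 -gc.
exists (\sum_(i < r) s i *: H i).
by rewrite (is_linear_sum (@dga_d_linear _ _ _ A)).
Qed.

Lemma massey_class_of_lifts :
  hcls (msum e (gen R e mu) N (fun l => g (a l)) (fun l => g (b l))) =
  - \sum_(i < r) s i *: Q i.
Proof.
have [w ->] := msum_eq.
have dgc : dA (g c) = 0.
  have tc : tot (n + 1) c by rewrite c_split -[c1]scale1r; apply: tot_lin.
  by rewrite (d_g hR hX hf tc) dc (is_linear0 glin).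
have -> : hcls (g c - dA w) = hcls (g c).
  have h0 := is_linearB (@dga_d_linear _ _ _ A) (g c) (dA w).
  apply/hcls_eq => //; first by rewrite h0 dgc dga_dd subrr.
  exists (- w); rewrite addrAC subrr add0r -scaleN1r -[- w]scaleN1r.
  by rewrite (is_linearZ (@dga_d_linear _ _ _ A)).
have dgc0 : dA (g c0) = 0.
  by rewrite (d_g hR hX hf tc0) (dX_bottom hX hmin hc0) (is_linear0 glin).
by rewrite c_split (is_linearD glin) hclsD // hcls_c1 hcls_c0 addrA addNr add0r.
Qed.
End Core.

(** * Vanishing of torsion Massey products *)

Lemma tuple_mkseq (T : Type) (x0 : T) r (s : r.-tuple T) : mkseq (nth x0 s) r = s.
Proof. by rewrite -[r in mkseq _ r](size_tuple s) mkseq_nth. Qed.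

Section Vanishing.
Variables (k : comPzRingType) (E : gsmod k).
Variable R : forall n, free_smod (gs_smod E) n -> Prop.
Variable A : dg_algebra R.
Variables (r : nat) (e : int) (mu : gs_smod E r).
Variables (dg : r.-tuple int) (x : r.-tuple (homology A)).

Lemma massey_product_msum (y z : r.-tuple A) :
  massey_product e mu dg x y z =
  qcls _ (hcls (msum e (gen R e mu) (nth 0 dg) (nth 0 y) (nth 0 z))).
Proof.
congr (qcls _ (hcls _)); apply: eq_bigr => i _.
rewrite -[in psum dg i](tuple_mkseq 0 dg) psum_mkseq 1?ltnW //.
by rewrite -[in set_nth 0 y](tuple_mkseq 0 y) set_nth_mkseq // (tnth_nth 0).
Qed.

Lemma indeterminacy_sum (c : 'I_r -> k) (h : nat -> homology A) :
  (forall i, (i < r)%N -> hdeg (nth 0 dg i + 1) (h i)) ->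
  Defs.span (indeterminacy e mu dg x)
    (\sum_(i < r) c i *: hop (gen R e mu) (mkseq (upd (nth 0 x) i (h i)) r)).
Proof.
move=> hh; have [S0 SD] := span_is_submod (indeterminacy e mu dg x).
apply: (big_ind (Defs.span (indeterminacy e mu dg x))) => [|a b ha hb|i _].
- exact: S0.
- by rewrite -[a]scale1r; apply: SD.
rewrite -[_ *: _]addr0; apply: SD => //; apply: span_gen; exists i, (h i); split.
  by rewrite (tnth_nth 0); apply: hh.
by rewrite -[in RHS](tuple_mkseq 0 x) set_nth_mkseq.
Qed.
End Vanishing.

Theorem proposition6p6 (k : comPzRingType) (E : gsmod k)
    (R : forall n, free_smod (gs_smod E) n -> Prop)
    (hE0 : forall x : gs_smod E 0%N, x = 0)
    (hR : quadratic_relations R)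
    (hproj : forall n, projective (quadratic_operad R n))
    (hkoszul : koszul_operad R)
    (hk : rational k \/ is_symmetrization R)
    (A : dg_algebra R)
    (hA : trivial_universal_massey A)
    (r : nat) (e : int) (mu : gs_smod E r) (t : r.-tuple k) (dg : r.-tuple int)
    (x : r.-tuple (homology A)) (hx : massey_defined e mu t dg x)
    (y z : r.-tuple A) (hyz : massey_choice t dg x y z) :
  massey_product e mu dg x y z = 0.
Proof.
have [X [f [[hX hmin _ hf hE] [m [psi [hm hpsi hd]]]]]] := hA.
have [hmu ht _ _] := hx.
pose g (u : X) : A := f 1%N tone [:: u].
pose N := nth 0 dg; pose T := nth 0 t.
have hT : \sum_(l < r) T l = 0 by rewrite -[RHS]ht; apply: eq_bigr => i _; rewrite (tnth_nth 0).
have hsys : massey_system r T N (nth 0 y) (nth 0 z).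
  move=> l hl; have := hyz (Ordinal hl); rewrite !(tnth_nth 0) /= => -[? ? _ ? ?].
  by split.
(* a lifts the class of y, v bounds the difference of y and f(1)(a), and b is
   the horizontal bounding element of t a. *)
have hlift l : exists avb : X * A * X, (l < r)%N ->
    [/\ homog (0, N l) avb.1.1, homog (N l + 1) avb.1.2,
        nth 0 y l - g avb.1.1 = dga_d avb.1.2,
        homog (1, N l) avb.2 & dh_d avb.2 = T l *: avb.1.1].
  case: ltnP => [hl|_]; last by exists (0, 0, 0).
  have [hy dy hz dz] := hsys l hl.
  have [a [v [ha hv e1]]] := lift_cycle hX hE hy dy.
  have hTa : homog (0, N l) (T l *: a) by apply: homogZ.
  have hz' : homog (N l + 1) (nth 0 z l - T l *: v) by apply/homogB/homogZ.
  have dz' : dga_d (nth 0 z l - T l *: v) = g (T l *: a).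
    rewrite (is_linearB (@dga_d_linear _ _ _ A)) (is_linearZ (@dga_d_linear _ _ _ A)).
    by rewrite dz -scalerBr -e1 subKr /g -(is_linearZ (g_lin hR hf)).
  have [b hb db] := lift_boundary hX hmin hE hTa hz' dz'.
  by exists (a, v, b).
have [avb havb] := choice hlift.
pose a l := (avb l).1.1; pose v l := (avb l).1.2; pose b l := (avb l).2.
have ha l : (l < r)%N -> homog (0, N l) (a l) by move=> /havb [].
have hv l : (l < r)%N -> homog (N l + 1) (v l) by move=> /havb [].
have hy l : (l < r)%N -> nth 0 y l - dga_d (v l) = g (a l).
  by move=> /havb [_ _ <- _ _]; rewrite subKr.
have hb l : (l < r)%N -> homog (1, N l) (b l) by move=> /havb [].
have db l : (l < r)%N -> dh_d (b l) = T l *: a l by move=> /havb [].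
(* The cycles by which the given z_l differ from the lifted ones; they produce
   the indeterminacy, together with the values psi_0(b_l). *)
pose c l : A := nth 0 z l - T l *: v l - g (b l).
have tb l : (l < r)%N -> tot (N l + 1) (b l).
  by move=> /hb /homog_tot; rewrite addrC.
have hc l : (l < r)%N -> homog (N l + 1) (c l).
  move=> hl; have [_ _ hz _] := hsys l hl.
  apply: homogB; last exact/(g_homog hR hf)/tb.
  by apply: homogB => //; apply/homogZ/hv.
have dc l : (l < r)%N -> dga_d (c l) = 0.
  move=> hl; have [_ _ _ dz] := hsys l hl.
  rewrite /c !(is_linearB (@dga_d_linear _ _ _ A)) dz.
  rewrite (is_linearZ (@dga_d_linear _ _ _ A)) -scalerBr hy //.
  rewrite (d_g hR hX hf (tb l hl)) db // (is_linearZ (g_lin hR hf)).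
  exact: subrr.
have ta l : (l < r)%N -> tot (N l) (a l).
  by move=> /ha /homog_tot; rewrite add0r.
have dga l : (l < r)%N -> dga_d (g (a l)) = 0.
  move=> hl; rewrite (d_g hR hX hf (ta l hl)) (dX_bottom hX hmin (ha l hl)).
  exact: (is_linear0 (g_lin hR hf)).
have hcls_a l : (l < r)%N -> hcls (g (a l)) = nth 0 x l.
  move=> hl; have := hyz (Ordinal hl); rewrite !(tnth_nth 0) /= => -[_ dy -> _ _].
  apply/hcls_eq; rewrite ?dga //; exists (- v l).
  rewrite -hy // addrAC subrr add0r -[in RHS]scaleN1r.
  by rewrite (is_linearZ (@dga_d_linear _ _ _ A)) scaleN1r.
have hgen := sdeg_gen R hmu.
have sys' : massey_system r T N (fun l => g (a l)) (fun l => g (b l)).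
  move=> l hl; split; [exact/(g_homog hR hf)/ta|exact: dga| |].
  - exact/(g_homog hR hf)/tb.
  - rewrite (d_g hR hX hf (tb l hl)) db //; exact: (is_linearZ (g_lin hR hf)).
have [w hw] := msum_homologous hgen hT hsys hv.
have ez : msum e (gen R e mu) N (fun l => nth 0 y l - dga_d (v l))
    (fun l => nth 0 z l - T l *: v l) =
  msum e (gen R e mu) N (fun l => g (a l)) (fun l => g (b l) + c l).
  by apply: eq_msum => l hl; [apply: hy|rewrite /c [RHS]addrC subrK].
rewrite {}ez in hw.
rewrite massey_product_msum; apply/qclsP; rewrite subr0 -/N.
set M := msum _ _ _ (nth 0 y) _ in hw *.
have dM : dga_d M = 0 by apply: msum_cycle hT hsys.
have dQ i : (i < r)%N ->
    dga_d (dga_op (gen R e mu) (mkseq (upd (fun l => g (a l)) i (c i)) r)) = 0.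
  move=> hi; apply: (op_cycle hgen) => l hl.
  by rewrite /upd; case: eqP => [_|_]; [apply: dc|apply: dga].
have hQ i : (i < r)%N ->
    hcls (dga_op (gen R e mu) (mkseq (upd (fun l => g (a l)) i (c i)) r)) =
    hop (gen R e mu) (mkseq (upd (nth 0 x) i (hcls (c i))) r).
  move=> hi; rewrite -(hop_hcls hgen) => [|l hl]; last first.
    by rewrite /upd; case: eqP => [_|_]; [apply: dc|apply: dga].
  congr hop; apply: eq_mkseq_lt => l hl; rewrite /upd.
  by case: eqP => // _; apply: hcls_a.
pose s i := sg k (e + \sum_(0 <= l < i) N l).
have eM : hcls M =
    \sum_(i < r) s i *: hop (gen R e mu) (mkseq (upd (nth 0 x) i (hcls (c i))) r)
    - \sum_(i < r) s i *: hop (gen R e mu) (mkseq (upd (nth 0 x) i (psi 0%N 1%N tone [:: b i])) r).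
  have -> : M = msum e (gen R e mu) N (fun l => g (a l)) (fun l => g (b l)) +
      \sum_(i < r) s i *: dga_op (gen R e mu) (mkseq (upd (fun l => g (a l)) i (c i)) r)
      + dga_d w.
    by rewrite -hw msumD addrC subrK.
  have dS : dga_d (\sum_(i < r) s i *: dga_op (gen R e mu)
      (mkseq (upd (fun l => g (a l)) i (c i)) r)) = 0.
    rewrite (is_linear_sum (@dga_d_linear _ _ _ A)) big1 // => i _.
    by rewrite (is_linearZ (@dga_d_linear _ _ _ A)) dQ // scaler0.
  have dm := msum_cycle hgen hT sys'.
  rewrite hclsD ?dga_dd ?(is_linearD (@dga_d_linear _ _ _ A)) ?dm ?dS ?addr0 //.
  rewrite hcls_boundary addr0 hclsD // addrC; congr (_ + _).
    rewrite hcls_sum => [|i]; last first.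
      by rewrite (is_linearZ (@dga_d_linear _ _ _ A)) dQ // scaler0.
    by apply: eq_bigr => i _; rewrite hclsZ ?dQ // hQ.
  rewrite (massey_class_of_lifts hR hX hmin hf hE hm hpsi hd hmu hT ha hb db).
  congr (- _); apply: eq_bigr => i _; congr (_ *: hop _ _).
  by apply: eq_mkseq_lt => l hl; rewrite /upd; case: eqP => // _; apply: hcls_a.
have [_ SD] := span_is_submod (indeterminacy e mu dg x).
rewrite eM addrC -scaleN1r; apply: SD.
- apply: (@indeterminacy_sum _ _ _ _ _ _ _ _ _ s (fun i => psi 0%N 1%N tone [:: b i])).
  by move=> i hi; apply: (psi0_hdeg hR hpsi); apply: hb.
- apply: (@indeterminacy_sum _ _ _ _ _ _ _ _ _ s (fun i => hcls (c i))) => i hi.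
  by exists (c i); split; [apply: hc|apply: dc|].
Qed.
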